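(* Let $\sigma\in\mathbb{R}^2$ and let $w_{\epsilon,\sigma}(x,t)$ satisfy the two-dimensional helical Euler equation $\partial_t w+Hw\cdot\nabla w=0$, with non-negative initial vorticity $w_{\epsilon,\sigma}(\cdot,0)\in L^1_2\cap L^\infty_2(\mathbb{R}^2)$ such that $$\int_{\mathbb{R}^2}w_{\epsilon,\sigma}(x,0)\,dx=1\qquad\text{and}\qquad\int_{\mathbb{R}^2}|x|^2w_{\epsilon,\sigma}(x,0)\,dx\lesssim\epsilon^2+|\sigma|^2 .$$ Then for any $\alpha<1$ and $t\ge0$ there holds $$\int_{|x|\ge(\epsilon^2+|\sigma|^2)^{\alpha/2}}w_{\epsilon,\sigma}(x,t)\,dx\lesssim\left(\epsilon^2+|\sigma|^2\right)^{1-\alpha}.$$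
   Context: Notation. For $x\in\mathbb{R}^2$, $\langle x\rangle=\sqrt{1+|x|^2}$ and $R_\theta x=(x_1\cos\theta+x_2\sin\theta,\,-x_1\sin\theta+x_2\cos\theta)$. For $x\in\mathbb{R}^3$, $\xi(x)=(x_2,-x_1,1)$; $\wedge$ is the cross product in $\mathbb{R}^3$. $a\lesssim b$ means $a\le Cb$ with $C>0$ independent of $x,y,\epsilon$ and $\sigma$. Weighted spaces on $\mathbb{R}^2$: $\|g\|_{L^p_m}=\left(\int_{\mathbb{R}^2}\langle y\rangle^{pm}|g(y)|^p\,dy\right)^{1/p}$ for $1\le p<\infty$, and $\|g\|_{L^\infty_m}=\sup_x\langle x\rangle^m|g(x)|$. Two-dimensional helical Euler equation: $\partial_t w+Hw\cdot\nabla w=0$ on $\mathbb{R}^2$, where, for $x,y\in\mathbb{R}^2$, $$K(x,y)=-\frac1{4\pi}\int_{\mathbb{R}}\frac{(x_1,x_2,0)-(R_a y,a)}{|(x_1,x_2,0)-(R_a y,a)|^3}\wedge\xi\big((R_a y,a)\big)\,da,$$ $U(x)=\int_{\mathbb{R}^2}K(x,y)w(y)\,dy=(U^1,U^2,U^3)$ and $Hw(x)=(U^1,U^2)+(-x_2,x_1)U^3$ (a divergence-free field). Weak solution: for all $t\ge 0$ and all $\phi\in C_c^\infty(\mathbb{R}^2\times[0,\infty))$, $$\int_{\mathbb{R}^2}w(x,t)\phi(x,t)\,dx-\int_{\mathbb{R}^2}w(x,0)\phi(x,0)\,dx=\int_0^t\int_{\mathbb{R}^2}w(\partial_t\phi+Hw\cdot\nabla\phi)\,dx\,ds.$$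 For every positive integer $m$ the equation is globally well-posed in $L^1_m\cap L^\infty_m(\mathbb{R}^2)$; the solution is the one in this class (here with $m=2$). *)

(* Defs.v *)
From HB Require Import structures.
From mathcomp Require Import all_boot all_order all_algebra.
From mathcomp Require Import all_classical all_reals all_analysis.

Set Implicit Arguments.
Unset Strict Implicit.
Unset Printing Implicit Defensive.

Import Order.TTheory GRing.Theory Num.Theory.
Import numFieldNormedType.Exports.

Local Open Scope classical_set_scope.
Local Open Scope ring_scope.

Notation leb1 R := (@lebesgue_measure R).
Notation leb2 R := ((@lebesgue_measure R \x @lebesgue_measure R)%E).

(* Points of the plane are pairs and points of space are triples
   ((x1, x2), x3).  The library norm on a product type is the max norm, hence
   the explicit Euclidean norms below. *)
Section HelicalEuler.
Variable R : realType.

Definition enorm2 (x : R * R) : R := Num.sqrt (x.1 ^+ 2 + x.2 ^+ 2).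

Definition enorm3 (u : R * R * R) : R :=
  Num.sqrt (u.1.1 ^+ 2 + u.1.2 ^+ 2 + u.2 ^+ 2).

Definition jbracket (x : R * R) : R := Num.sqrt (1 + enorm2 x ^+ 2).

Definition rot (theta : R) (x : R * R) : R * R :=
  (x.1 * cos theta + x.2 * sin theta, - x.1 * sin theta + x.2 * cos theta).

Definition xi (u : R * R * R) : R * R * R := (u.1.2, - u.1.1, 1).

Definition cross (u v : R * R * R) : R * R * R :=
  (u.1.2 * v.2 - u.2 * v.1.2,
   u.2 * v.1.1 - u.1.1 * v.2,
   u.1.1 * v.1.2 - u.1.2 * v.1.1).

Definition helK_integrand (x y : R * R) (a : R) : R * R * R :=
  let d : R * R * R := (x, 0) - (rot a y, a) in
  cross ((enorm3 d ^+ 3)^-1 *: d) (xi (rot a y, a)).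

Definition helK (x y : R * R) : R * R * R :=
  - (4 * pi)^-1 *:
  (\int[leb1 R]_a (helK_integrand x y a).1.1,
   \int[leb1 R]_a (helK_integrand x y a).1.2,
   \int[leb1 R]_a (helK_integrand x y a).2).

Definition helU (w : R * R -> R) (x : R * R) : R * R * R :=
  (\int[leb2 R]_y ((helK x y).1.1 * w y),
   \int[leb2 R]_y ((helK x y).1.2 * w y),
   \int[leb2 R]_y ((helK x y).2 * w y)).

Definition helH (w : R * R -> R) (x : R * R) : R * R :=
  (helU w x).1 + (helU w x).2 *: (- x.2, x.1).

(* For p = +oo this is the essential supremum of <x>^m |g(x)|. *)
Definition wnorm (p : \bar R) (m : nat) (g : R * R -> R) : \bar R :=
  Lnorm (leb2 R) p (fun y => (jbracket y ^+ m * g y)%:E).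

Definition in_L1Linf (m : nat) (g : R * R -> R) : Prop :=
  [/\ measurable_fun setT g, (wnorm 1 m g < +oo)%E &
      (wnorm +oo m g < +oo)%E].

Fixpoint iter_deriv (vs : seq (R * R * R)) (f : R * R * R -> R) :
    R * R * R -> R :=
  if vs is v :: vs' then (fun p => 'D_v (iter_deriv vs' f) p) else f.

Definition smooth (f : R * R * R -> R) : Prop :=
  forall vs : seq (R * R * R),
    continuous (iter_deriv vs f) /\
    (forall v p, derivable (iter_deriv vs f) p v).

(* C_c^oo (R^2 x [0, +oo[) is the set of restrictions to t >= 0 of such
   functions; nothing is required of them at t = 0. *)
Definition test_function (phi : R * R * R -> R) : Prop :=
  smooth phi /\ compact (closure [set p | phi p != 0]).

Definition dt (phi : R * R * R -> R) (p : R * R * R) : R :=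
  'D_((0, 0, 1) : R * R * R) phi p.

Definition gradx (phi : R * R * R -> R) (p : R * R * R) : R * R :=
  ('D_((1, 0, 0) : R * R * R) phi p, 'D_((0, 1, 0) : R * R * R) phi p).

Definition dot2 (x y : R * R) : R := x.1 * y.1 + x.2 * y.2.

Definition weak_formulation (w : R * R -> R -> R) : Prop :=
  forall t phi, 0 <= t -> test_function phi ->
  \int[leb2 R]_x (w x t * phi (x, t)) - \int[leb2 R]_x (w x 0 * phi (x, 0)) =
  \int[leb1 R]_(s in `[0, t])
    \int[leb2 R]_x (w x s *
      (dt phi (x, s) + dot2 (helH (w ^~ s) x) (gradx phi (x, s)))).

(* The class Loo_loc([0, +oo[; L^1_m \cap L^oo_m). *)
Definition solution_class (m : nat) (w : R * R -> R -> R) : Prop :=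
  measurable_fun [set p : R * R * R | 0 <= p.2] (fun p => w p.1 p.2) /\
  forall T : R, 0 <= T -> exists M : R, forall t, 0 <= t <= T ->
    in_L1Linf m (w ^~ t) /\
    (wnorm 1 m (w ^~ t) + wnorm +oo m (w ^~ t) <= M%:E)%E.

Definition helical_euler_solution (m : nat) (w : R * R -> R -> R) : Prop :=
  solution_class m w /\ weak_formulation w.

End HelicalEuler.

(* Main.v *)
(** The kernel satisfies x . K(x,y) = - y . K(y,x), so the second moment of w is
    conserved.  If w(t) is non-negative, Chebyshev's inequality then gives the
    bound with C = 2 C0.

    Non-negativity is only needed against test functions psi >= 0 and is
    obtained by duality: psi at time t2 is pulled back to t1 < t2 along a smooth
    field beta that interpolates the velocity b, frozen at a well chosen time,
    on a grid of mesh 2^-N.  The function psi (x + (t2 - s) beta x) is an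
    approximate solution of the dual transport equation, with an error driven by
    b - beta.  As b is log-Lipschitz, the error per unit time is O(N 2^-N) while
    the Lipschitz constant of the test function grows like exp (C N t), which is
    beaten on a time block independent of N; the blocks are then chained. *)

Require Import Defs.
From HB Require Import structures.
From mathcomp Require Import all_boot all_order all_algebra.
From mathcomp Require Import all_classical all_reals all_analysis.
From mathcomp Require Import measurable_realfun ess_sup_inf.
From mathcomp Require Import ring lra.

Set Implicit Arguments.
Unset Strict Implicit.
Unset Printing Implicit Defensive.

Import Order.TTheory GRing.Theory Num.Theory.
Import numFieldNormedType.Exports.

Local Open Scope classical_set_scope.
Local Open Scope ring_scope.

(** * Elementary smooth functions *)

(** Positivity at time t is the delicate point: it is not part of the solution class, and the
    velocity is merely log-Lipschitz in space and measurable in time, so its flow does not carry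
    smooth test functions to smooth ones. Interpolation restores smoothness in space, and freezing
    at one time per short interval restores it in time; the nodal velocities form a finite family of
    bounded measurable functions, so for fixed N the cost of freezing tends to 0 with the length of
    the intervals. Only then does N tend to infinity: on a short block the amplification is at most
    (3/2)^(N+1), the interpolation error is of order (N+1) 2^-N <= 6 (7/12)^N, and (3/2)(7/12) = 7/8
    < 1.

    The block length depends on the box that contains the supports, and these grow backwards in time
    at a speed affine in the radius of the box; hence two levels of chaining, the outer one with a
    step independent of the radius.

    As non-negativity is known only against smooth functions, the indicator of the tail is compared
    with 2 |x|^2 / r^2: the slack leaves room to smooth the jump and is the origin of the factor
    2. *)

Section Smooth.
Variable R : realType.
Implicit Types (p : {poly R}) (x y : R).

Lemma horner_growth p : exists (C : R) n, 0 <= C /\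
  forall y, 1 <= y -> `|p.[y]| <= C * y ^+ n.
Proof.
elim/poly_ind: p => [|p c [C [n [C0 IH]]]].
  by exists 0, 0%N; split=> // y _; rewrite horner0 normr0 mul0r.
exists (C + `|c|), n.+1; split; first by rewrite addr_ge0.
move=> y y1; rewrite hornerMXaddC (le_trans (ler_normD _ _))// mulrDl lerD//.
  rewrite normrM exprSr mulrA (ger0_norm (le_trans ler01 y1)).
  by rewrite ler_pM2r ?IH// (lt_le_trans ltr01).
by rewrite ler_peMr// exprn_ege1.
Qed.

(* The polynomial factor makes the family stable under differentiation: the
   derivative of [flat_exp p] is [flat_exp ('X^2 * (p - p^`()))]. *)
Definition flat_exp p (x : R) : R :=
  if 0 < x then p.[x^-1] * expR (- x^-1) else 0.

Lemma flat_exp_le0 p x : x <= 0 -> flat_exp p x = 0.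
Proof. by rewrite /flat_exp leNgt => /negbTE ->. Qed.

(** The polynomial in 1/x grows at most like x^-n, while exp (-1/x) <= (n+2)! x^(n+2) by one term of
    the exponential series. Quadratic decay is all that differentiability at the junction 0
    requires. *)
Lemma flat_exp_quadratic p : exists C : R, 0 <= C /\
  forall x, x <= 1 -> `|flat_exp p x| <= C * x ^+ 2.
Proof.
have [C [n [C0 bp]]] := horner_growth p.
exists (C * n.+2`!%:R); split; first by rewrite mulr_ge0.
move=> x x1; rewrite /flat_exp; case: ifPn => x0; last first.
  by rewrite normr0; exact: mulr_ge0 (mulr_ge0 C0 (ler0n _ _)) (sqr_ge0 _).
have y1 : 1 <= x^-1 by rewrite invf_ge1.
have e : x^-1 ^+ n.+2 / n.+2`!%:R <= expR x^-1.
  by apply: le_trans (expR_ge1Dxn n.+1 (ltW (lt_le_trans ltr01 y1))); rewrite lerDr.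
have F0 : (0 : R) < n.+2`!%:R by rewrite ltr0n fact_gt0.
rewrite normrM expRN (@ger0_norm _ (expR _)^-1) ?invr_ge0 ?expR_ge0//.
rewrite ler_pdivrMr ?expR_gt0//; apply: (le_trans (bp _ y1)).
rewrite -!mulrA ler_wpM2l//.
move: e; rewrite ler_pdivrMr// => e.
rewrite -(@ler_pM2r _ (x^-1 ^+ 2)) ?exprn_gt0 ?invr_gt0//.
rewrite -exprD addn2 (le_trans e)// mulrC -!mulrA ler_wpM2l//.
suff -> : x * (x * (expR x^-1 * x^-1 ^+ 2)) = expR x^-1 by [].
by field; rewrite gt_eqF.
Qed.

Lemma is_derive_quadratic (f : R -> R) (C : R) : 0 <= C ->
  (forall x, x <= 1 -> `|f x| <= C * x ^+ 2) -> is_derive (0 : R) 1 f 0.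
Proof.
move=> C0 fC.
have f0 : f 0 = 0.
  by apply/eqP; rewrite -normr_le0 (le_trans (fC 0 ler01))// expr0n mulr0.
have h : (fun h => h^-1 *: ((f \o shift 0) (h *: 1) - f 0)) @ 0^' --> (0 : R).
  apply/cvgrPdist_le => e e0; near=> x.
  rewrite /= /shift/= addr0 /GRing.scale/= mulr1 f0 subr0 sub0r normrN normrM.
  have x0 : x != 0 by near: x; exact: nbhs_dnbhs_neq.
  have xd : `|x| < Num.min 1 ((C + 1)^-1 * e).
    near: x; apply: nbhs_dnbhs.
    have e1 : 0 < Num.min 1 ((C + 1)^-1 * e).
      by rewrite lt_min ltr01 mulr_gt0// invr_gt0 ltr_wpDl.
    have := (@nbhsx_ballx _ R^o 0 _ e1); apply: filterS => z.
    by rewrite /ball/= sub0r normrN.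
  move: xd; rewrite lt_min => /andP[x1 x2].
  rewrite normfV ler_pdivrMl ?normr_gt0// (le_trans (fC _ _))//.
    by rewrite (le_trans (ler_norm _))// ltW.
  rewrite -(@ger0_norm _ (x ^+ 2)) ?sqr_ge0// normrX expr2 mulrCA ler_wpM2l//.
  move: x2; rewrite ltr_pdivlMl ?ltr_wpDl// => /ltW; apply: le_trans.
  by rewrite ler_wpM2r// lerDl.
split; last exact/cvg_lim.
by apply/cvg_ex; exists 0.
Unshelve. all: by end_near.
Qed.

Lemma is_derive_flat_exp p x :
  is_derive x (1 : R) (flat_exp p) (flat_exp ('X^2 * (p - p^`())) x).
Proof.
have [x0|x0|->] := ltgtP x 0.
- rewrite flat_exp_le0; last exact: ltW.
  apply: (@near_eq_is_derive _ _ _ (cst 0)) => //; near=> y.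
  by rewrite flat_exp_le0// ltW//; near: y; exact: lt_nbhsl.
- have xn0 : x != 0 by rewrite gt_eqF.
  apply: (@near_eq_is_derive _ _ _ (fun y => (horner p \o GRing.inv) y * (expR \o -%R \o GRing.inv) y)) => //.
    near=> y; rewrite /flat_exp ifT//; near: y; exact: lt_nbhsr.
  have d1 : is_derive x (1 : R) (GRing.inv : R -> R) (- x ^- 2).
    by have := @is_deriveV R id x 1 1 xn0 (is_derive_id _ _); rewrite /GRing.scale/= mulr1.
  have d2 := is_derive1_comp (@is_derive_poly _ p x^-1) d1.
  have d4 : is_derive x (1 : R) ((expR \o -%R) \o GRing.inv) (- expR (- x^-1) * - x ^- 2).
    apply: is_derive1_comp; rewrite -mulrN1.
    by apply: is_derive1_comp; exact: is_deriveNid.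
  apply: is_derive_eq.
  rewrite /flat_exp x0 /GRing.scale/= !hornerE/= -exprVn; ring.
- rewrite flat_exp_le0//; have [C [C0 h]] := flat_exp_quadratic p.
  exact: is_derive_quadratic h.
Unshelve. all: by end_near.
Qed.

Local Notation V := (R * R * R)%type.

(* Stable under directional derivatives, so every such function is smooth and
   the cut-offs built from it are test functions. *)
Inductive elem : (V -> R) -> Prop :=
| elem_cst c : elem (fun=> c)
| elem_x1 : elem (fun u => u.1.1)
| elem_x2 : elem (fun u => u.1.2)
| elem_x3 : elem (fun u => u.2)
| elem_add f g : elem f -> elem g -> elem (fun u => f u + g u)
| elem_mul f g : elem f -> elem g -> elem (fun u => f u * g u)
| elem_inv f : elem f -> (forall u, f u != 0) -> elem (fun u => (f u)^-1)
| elem_flat p f : elem f -> elem (fun u => flat_exp p (f u)).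

Lemma elem_differentiable f : elem f -> forall u, differentiable f u.
Proof.
elim=> {f} [c|||||||].
- by move=> u; exact: differentiable_cst.
- move=> u; apply: (@differentiable_comp _ _ _ _ fst fst);
    apply: linear_differentiable => z; exact: cvg_fst.
- move=> u; apply: (@differentiable_comp _ _ _ _ fst snd);
    apply: linear_differentiable => z; [exact: cvg_fst|exact: cvg_snd].
- by move=> u; apply: linear_differentiable => z; exact: cvg_snd.
- by move=> f g _ df _ dg u; exact: differentiableD.
- by move=> f g _ df _ dg u; exact: differentiableM.
- by move=> f _ df f0 u; exact: differentiableV.
- move=> p f _ df u; apply: differentiable_comp => //.
  by apply/derivable1_diffP; have [] := is_derive_flat_exp p (f u).
Qed.

Lemma elem_derivable f : elem f -> forall u v, derivable f u v.
Proof. by move=> ef u v; apply: diff_derivable; exact: elem_differentiable. Qed.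

Lemma elem_continuous f : elem f -> continuous f.
Proof.
by move=> ef u; apply: differentiable_continuous; exact: elem_differentiable.
Qed.

Lemma derive_flat_exp p (f : V -> R) (u v : V) : differentiable f u ->
  'D_v (fun u => flat_exp p (f u)) u =
  flat_exp ('X^2 * (p - p^`())) (f u) * 'D_v f u.
Proof.
move=> df; have [dp dpE] := is_derive_flat_exp p (f u).
have dg : differentiable (flat_exp p) (f u) by exact/derivable1_diffP.
rewrite [in RHS]deriveE// -[X in 'D_v X _]/(flat_exp p \o f).
rewrite deriveE; last exact: differentiable_comp.
rewrite diff_comp//= deriv1E// derive1E dpE.
by rewrite /GRing.scale/= mulrC.
Qed.

Lemma derive_affine (f : V -> R) (u v : V) (l : R) :
  (forall h : R, f (h *: v + u) = h * l + f u) -> 'D_v f u = l.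
Proof.
move=> fl; apply: cvg_lim => //; apply: (@cvg_trans _ (cst l @ 0^')); last exact: cvg_cst.
apply: near_eq_cvg; near=> h; rewrite /= /shift/= fl addrK /GRing.scale/= mulKf//.
by near: h; exact: nbhs_dnbhs_neq.
Unshelve. all: by end_near.
Qed.

Lemma elem_derive f v : elem f -> elem ('D_v f).
Proof.
have ext f1 f2 : elem f1 -> f1 =1 f2 -> elem f2 by move=> e /funext <-.
move=> ef; elim: ef => {f} [c||||||f ef edf f0|].
- by apply: ext (elem_cst 0) _ => u; rewrite derive_cst.
- by apply: ext (elem_cst v.1.1) _ => u; rewrite (@derive_affine _ _ _ v.1.1).
- by apply: ext (elem_cst v.1.2) _ => u; rewrite (@derive_affine _ _ _ v.1.2).
- by apply: ext (elem_cst v.2) _ => u; rewrite (@derive_affine _ _ _ v.2).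
- move=> f g ef edf eg edg; apply: ext (elem_add edf edg) _ => u.
  by rewrite deriveD//; exact: elem_derivable.
- move=> f g ef edf eg edg.
  apply: ext (elem_add (elem_mul ef edg) (elem_mul eg edf)) _ => u.
  by rewrite deriveM//; exact: elem_derivable.
- apply: ext (elem_mul (elem_mul (elem_cst (-1)) (elem_mul (elem_inv ef f0) (elem_inv ef f0))) edf) _ => u.
  rewrite deriveV//; last exact: elem_derivable.
  by rewrite /GRing.scale/= expr2 invfM mulN1r.
- move=> p f ef edf.
  apply: ext (elem_mul (elem_flat ('X^2 * (p - p^`())) ef) edf) _ => u.
  by rewrite derive_flat_exp//; exact: elem_differentiable.
Qed.

Lemma elem_smooth f : elem f -> smooth f.
Proof.
move=> ef vs; have {ef} : elem (iter_deriv vs f).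
  by elim: vs => //= v vs IH; exact: elem_derive.
move=> e; split; [exact: elem_continuous|by move=> v u; exact: elem_derivable].
Qed.

(** Closure under composition keeps a test function elementary, hence smooth, after it is pulled
    back along an elementary field. *)
Lemma elem_comp f X1 X2 X3 : elem f -> elem X1 -> elem X2 -> elem X3 ->
  elem (fun u => f (X1 u, X2 u, X3 u)).
Proof.
move=> + e1 e2 e3; elim=> {f} [c||||f g _ ef _ eg|f g _ ef _ eg|f _ ef f0|p f _ ef] //=.
- exact: elem_cst.
- exact: elem_add.
- exact: elem_mul.
- by apply: elem_inv => // u; exact: f0.
- exact: elem_flat.
Qed.

End Smooth.

(** * Smooth step function and test functions *)

Section Step.
Variable R : realType.
Local Notation V := (R * R * R)%type.
Implicit Types (f : V -> R) (u v : V).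

Lemma elem_ext f g : elem f -> f =1 g -> elem g.
Proof. by move=> e /funext <-. Qed.

Lemma elem_opp f : elem f -> elem (fun u => - f u).
Proof.
by move=> ef; apply: elem_ext (elem_mul (elem_cst (-1)) ef) _ => u; rewrite mulN1r.
Qed.

Lemma elem_sub f g : elem f -> elem g -> elem (fun u => f u - g u).
Proof. by move=> ef eg; apply: elem_add => //; exact: elem_opp. Qed.

Lemma elem_sum (I : Type) (r : seq I) (F : I -> V -> R) :
  (forall i, elem (F i)) -> elem (fun u => \sum_(i <- r) F i u).
Proof.
move=> eF; elim: r => [|i r IH].
  by apply: elem_ext (elem_cst 0) _ => u; rewrite big_nil.
by apply: elem_ext (elem_add (eF i) IH) _ => u; rewrite big_cons.
Qed.

Lemma derive_elem_comp f X1 X2 X3 u v : elem f -> elem X1 -> elem X2 -> elem X3 ->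
  'D_v (fun u => f (X1 u, X2 u, X3 u)) u =
  'D_(('D_v X1 u, 'D_v X2 u), 'D_v X3 u) f (X1 u, X2 u, X3 u).
Proof.
move=> ef e1 e2 e3.
have d1 := elem_differentiable e1 u; have d2 := elem_differentiable e2 u.
have d3 := elem_differentiable e3 u.
pose X u : V := (X1 u, X2 u, X3 u).
have d12 : differentiable (fun u => (X1 u, X2 u)) u by exact: differentiable_pair.
have dX : differentiable X u by exact: differentiable_pair.
have df := elem_differentiable ef (X u).
rewrite -[X in 'D_v X _]/(f \o X) deriveE; last exact: differentiable_comp.
rewrite diff_comp// /X /= (diff_pair d12 d3)/= (diff_pair d1 d2)/=.
by rewrite !deriveE.
Qed.

Lemma derive_elem_lin f u v : elem f ->
  'D_v f u = v.1.1 * 'D_((1, 0, 0) : V) f u + v.1.2 * 'D_((0, 1, 0) : V) f u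
    + v.2 * 'D_((0, 0, 1) : V) f u.
Proof.
move=> ef; have df := elem_differentiable ef u.
rewrite !deriveE//.
have {1}-> : v = v.1.1 *: ((1, 0, 0) : V) + v.1.2 *: ((0, 1, 0) : V)
    + v.2 *: ((0, 0, 1) : V).
  case: v => -[a b] c; apply/eqP; rewrite /eq_op/= /eq_op/= /GRing.scale/=.
  by apply/andP; split; [apply/andP; split|]; apply/eqP;
    rewrite !(mulr0, mulr1, addr0, add0r).
by rewrite !linearD !linearZ.
Qed.

(** A smooth transition from 0 to 1 that is constant outside [1/4, 3/4]. As this interval is shorter
    than 1, the derivatives of its integer translates have disjoint supports. *)
Definition step (x : R) : R :=
  flat_exp 1 (2 * x - 2^-1) /
  (flat_exp 1 (2 * x - 2^-1) + flat_exp 1 (1 - (2 * x - 2^-1))).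

Lemma flat_exp1_ge0 (x : R) : 0 <= flat_exp 1 x.
Proof. by rewrite /flat_exp; case: ifP => // _; rewrite hornerE mul1r expR_ge0. Qed.

Lemma flat_exp1_gt0 (x : R) : 0 < x -> 0 < flat_exp 1 x.
Proof. by rewrite /flat_exp => ->; rewrite hornerE mul1r expR_gt0. Qed.

Lemma step_den_gt0 (x : R) : 0 < flat_exp 1 x + flat_exp 1 (1 - x).
Proof.
have [x0|x0] := ltP 0 x; first by rewrite ltr_wpDr ?flat_exp1_ge0 ?flat_exp1_gt0.
by rewrite ltr_wpDl ?flat_exp1_ge0// flat_exp1_gt0//; lra.
Qed.

Lemma step_ge0 x : 0 <= step x.
Proof. by rewrite divr_ge0 ?flat_exp1_ge0// ltW// step_den_gt0. Qed.

Lemma step_le1 x : step x <= 1.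
Proof.
by rewrite ler_pdivrMr ?step_den_gt0// mul1r lerDl flat_exp1_ge0.
Qed.

Lemma step_eq0 x : x <= 4^-1 -> step x = 0.
Proof. by move=> x0; rewrite /step flat_exp_le0 ?mul0r//; lra. Qed.

Lemma step_eq1 x : 3 / 4 <= x -> step x = 1.
Proof.
move=> x0; rewrite /step (@flat_exp_le0 _ _ (1 - _)) ?addr0 ?divff//; last by lra.
by rewrite gt_eqF// flat_exp1_gt0//; lra.
Qed.

Lemma elem_step f : elem f -> elem (fun u => step (f u)).
Proof.
move=> ef.
have e1 : elem (fun u => 2 * f u - 2^-1).
  by apply: elem_sub (elem_cst _); apply: elem_mul => //; exact: elem_cst.
have e2 : elem (fun u => 1 - (2 * f u - 2^-1)) by apply: elem_sub => //; exact: elem_cst.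
apply: elem_mul; first exact: elem_flat.
apply: elem_inv; first by apply: elem_add; exact: elem_flat.
by move=> u; rewrite gt_eqF// step_den_gt0.
Qed.

(** The derivative of [step], taken as a directional derivative on space-time, where elementary
    functions are known to be stable under differentiation; its continuity then comes for free. *)
Definition dstep (x : R) : R :=
  'D_((1, 0, 0) : V) (fun u => step u.1.1) ((x, 0, 0) : V).

Lemma derive_comp1 (g : R -> R) f u v : elem (fun u : V => g u.1.1) -> elem f ->
  'D_v (fun u => g (f u)) u =
  'D_((1, 0, 0) : V) (fun u => g u.1.1) ((f u, 0, 0) : V) * 'D_v f u.
Proof.
move=> eg ef; have e0 : elem (fun=> (0 : R)) := elem_cst _.
have d0 : 'D_v (fun=> (0 : R)) u = 0 by exact: derive_cst.
have := derive_elem_comp u v eg ef e0 e0; rewrite d0 => E.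
have L := derive_elem_lin ((f u, 0, 0) : V) (('D_v f u, 0, 0) : V) eg.
have aux (a b c d : R) : a * b + 0 * c + 0 * d = b * a by ring.
by apply: (etrans E); apply: (etrans L); exact: aux.
Qed.

Lemma derive_step f u v : elem f -> 'D_v (fun u => step (f u)) u = dstep (f u) * 'D_v f u.
Proof. by move=> ef; exact: derive_comp1 (elem_step (elem_x1 R)) ef. Qed.

Lemma dstep_eq0 x : x < 4^-1 \/ 3 / 4 < x -> dstep x = 0.
Proof.
have c (c : R) (P : set R) : open P -> P x -> (forall y, P y -> step y = c) -> dstep x = 0.
  move=> oP Px Pc; have <- : 'D_((1, 0, 0) : V) (cst c) ((x, 0, 0) : V) = 0 by exact: derive_cst.
  apply: near_eq_derive.
  have : nbhs ((x, 0, 0) : V) ((fst \o fst) @^-1` P).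
    have cf : continuous (fst \o fst : V -> R) by exact: (elem_continuous (elem_x1 R)).
    by apply: cf; exact: open_nbhs_nbhs.
  by apply: filterS => -[[a b] d] /= /Pc ->.
case=> [h|h].
- apply: (c 0 [set y | y < 4^-1]); [exact: open_lt|exact: h|].
  by move=> y /= /ltW; exact: step_eq0.
- apply: (c 1 [set y | 3 / 4 < y]); [exact: open_gt|exact: h|].
  by move=> y /= /ltW; exact: step_eq1.
Qed.

Lemma dstep_bounded : exists C : R, 0 < C /\ forall x, `|dstep x| <= C.
Proof.
have cd : continuous (fun x => `|dstep x|).
  move=> x; apply: (@continuous_comp _ _ _ _ (@Num.norm _ R)); last exact: norm_continuous.
  apply: (@continuous_comp _ _ _ (fun x : R => (x, 0, 0) : V)
    ('D_((1, 0, 0) : V) (fun u => step u.1.1))).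
    by apply: differentiable_continuous; do 2 apply: differentiable_pair => //.
  by apply: elem_continuous; apply: elem_derive; exact: elem_step (elem_x1 R).
have [|c _ hc] := @EVT_max R (fun x => `|dstep x|) 0 1 ler01.
  by apply: continuous_subspaceT.
exists (`|dstep c| + 1); split; first by rewrite ltr_wpDl.
move=> x; have [x1|x1] := ltP x 0.
  by rewrite dstep_eq0 ?normr0 ?addr_ge0//; left; lra.
have [x2|x2] := ltP 1 x.
  by rewrite dstep_eq0 ?normr0 ?addr_ge0//; right; lra.
by rewrite (le_trans (hc x _)) ?lerDl// in_itv/= x1 x2.
Qed.

Lemma elem_test f (B : R) : elem f ->
  (forall u, f u != 0 -> [/\ `|u.1.1| <= B, `|u.1.2| <= B & `|u.2| <= B]) ->
  test_function f.
Proof.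
move=> ef fB; split; first exact: elem_smooth.
have h : compact ((`[-B, B] `*` `[-B, B]) `*` `[-B, B] : set V).
  by do 2 (apply: compact_setX; last exact: segment_compact); exact: segment_compact.
apply: (subclosed_compact _ h); first exact: closed_closure.
rewrite [X in _ `<=` X](closure_id _).1; last first.
  by apply: compact_closed => //; exact: norm_hausdorff.
apply: closure_subset => u /= /fB[]; rewrite !ler_norml => h1 h2 h3.
by split; [split|]; rewrite /= in_itv.
Qed.

End Step.

(** * Integral estimates *)

Section IntegralTools.
Context d (T : measurableType d) (R : realType).
Variable mu : {measure set T -> \bar R}.
Implicit Types (f g : T -> R).

(** Pointwise f <= sum_k c_k 1_(S_k), since one term of the series already dominates. With dyadic
    sets this turns the integral of a singular or slowly decaying kernel into a geometric series. *)
Lemma integral_le_cover f (S : nat -> set T) (c m : nat -> R) (B : R) :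
  measurable_fun setT f -> (forall x, 0 <= f x) ->
  (forall k, measurable (S k)) -> (forall k, 0 <= c k) ->
  (forall k, mu (S k) <= (m k)%:E)%E ->
  (forall x, f x = 0 \/ exists k, S k x /\ f x <= c k) ->
  (forall n, \sum_(0 <= k < n) c k * m k <= B) ->
  (\int[mu]_x (f x)%:E <= B%:E)%E.
Proof.
move=> mf f0 mS c0 muS cov sB.
pose F k := EFin \o (fun x => c k * \1_(S k) x).
have F0 k x : (0 <= F k x)%E by rewrite lee_fin mulr_ge0.
have mF k : measurable_fun setT (F k).
  apply/measurable_EFinP; apply: measurable_funM; first exact: measurable_cst.
  exact: measurable_indic.
apply: (@le_trans _ _ (\int[mu]_x (\sum_(0 <= k <oo) F k x))%E).
  apply: ge0_le_integral => //.
  - by move=> x _; rewrite lee_fin.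
  - exact/measurable_EFinP.
  - exact: ge0_emeasurable_sum.
  move=> x _; have [->|[k [Skx fc]]] := cov x; first exact: nneseries_ge0.
  apply: (@le_trans _ _ (F k x)).
    by rewrite /F/= indicE mem_set//= mulr1 lee_fin.
  rewrite (@nneseriesD1 _ _ k)//=.
    by rewrite leeDl// nneseries_ge0.
rewrite integral_nneseries//.
apply: lime_le; first by apply: is_cvg_nneseries => k _ _; apply: integral_ge0 => x _; exact: F0.
apply: nearW => n.
apply: (@le_trans _ _ (\sum_(0 <= k < n) (c k * m k)%:E)%E); last first.
  by rewrite sumEFin lee_fin.
apply: lee_sum => k _.
under eq_integral do rewrite /F/= EFinM.
rewrite ge0_integralZl//; last 2 first.
- by apply/measurable_EFinP; exact: measurable_indic.
- by rewrite lee_fin.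
by rewrite integral_indic// setIT EFinM lee_wpmul2l// lee_fin.
Qed.

Lemma integral_bound f g (D : set T) (C : R) : measurable D ->
  measurable_fun D f -> measurable_fun D g -> (forall x, D x -> `|f x| <= g x) ->
  (\int[mu]_(x in D) (g x)%:E <= C%:E)%E ->
  mu.-integrable D (EFin \o f) /\ `|\int[mu]_(x in D) f x| <= C.
Proof.
move=> mD mf mg fg gC.
have h : (\int[mu]_(x in D) `|(EFin \o f) x| <= C%:E)%E.
  apply: le_trans gC; apply: ge0_le_integral => //.
  - by apply: (measurableT_comp (f := abse)) => //; exact/measurable_EFinP.
  - exact/measurable_EFinP.
have i : mu.-integrable D (EFin \o f).
  apply/integrableP; split; first exact/measurable_EFinP.
  by apply: le_lt_trans h _; rewrite ltry.
split=> //; rewrite -lee_fin EFin_normr_Rintegral//; apply: le_trans h.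
exact: (le_abse_integral mu mD (measurable_int mu i)).
Qed.

Lemma ge0_integral_scale_le f g (D : set T) (c C : R) : measurable D ->
  measurable_fun D f -> measurable_fun D g -> 0 <= c ->
  (forall x, D x -> 0 <= f x <= c * g x) -> (forall x, D x -> 0 <= g x) ->
  (\int[mu]_(x in D) (g x)%:E <= C%:E)%E ->
  (\int[mu]_(x in D) (f x)%:E <= (c * C)%:E)%E.
Proof.
move=> mD mf mg c0 fg g0 gC.
apply: (@le_trans _ _ (\int[mu]_(x in D) (c%:E * (g x)%:E))%E).
  apply: ge0_le_integral => //.
  - by move=> x /fg /andP[]; rewrite lee_fin.
  - exact/measurable_EFinP.
  - by apply/measurable_EFinP; apply: measurable_funM => //; exact: measurable_cst.
  - by move=> x /fg /andP[_]; rewrite -EFinM lee_fin.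
rewrite ge0_integralZl//; first by rewrite EFinM lee_wpmul2l// lee_fin.
exact/measurable_EFinP.
Qed.

End IntegralTools.

(** The identity 1/x = x (x^2)^(-1) also holds at x = 0, which reduces the claim to real powers. *)
Lemma measurable_inv (R : realType) : measurable_fun setT (GRing.inv : R -> R).
Proof.
have -> : (GRing.inv : R -> R) = (fun x => x * (x ^+ 2) `^ (-1)).
  apply/funext => x; rewrite powR_inv1 ?sqr_ge0//.
  by have [->|x0] := eqVneq x 0; [rewrite invr0 mul0r|field].
apply: measurable_funM => //.
apply: (measurableT_comp (f := fun x : R => x `^ (-1))).
  exact: measurable_powR.
exact: measurable_funX.
Qed.

Lemma measurable_sqrt (R : realType) : measurable_fun setT (@Num.sqrt R).
Proof. by apply: continuous_measurable_fun; exact: sqrt_continuous. Qed.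

(** * Dyadic decompositions *)

Section Dyadic.
Variable R : realType.

Lemma dyadic_small (x : R) : 0 < x -> x <= 1 ->
  exists k, 2^-1 ^+ k.+1 < x /\ x <= 2^-1 ^+ k.
Proof.
move=> x0 x1.
have ex : exists n, (2^-1 : R) ^+ n < x.
  have h : (fun n => (2^-1 : R) ^+ n) @ \oo --> (0 : R).
    by apply: cvg_expr; rewrite ger0_norm// invf_lt1// ltr1n.
  have /cvgrPdist_lt/(_ _ x0)[n _ hn] := h; exists n.
  by have := hn n (leqnn n); rewrite /= sub0r normrN ger0_norm// exprn_ge0.
case: (ex_minnP ex) => -[|k] hk mk; first by move: hk; rewrite expr0 ltNge x1.
exists k; split=> //; rewrite leNgt; apply/negP => /mk; by rewrite ltnn.
Qed.

Lemma sum_half n : \sum_(0 <= k < n) (2^-1 : R) ^+ k <= 2.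
Proof.
suff -> : \sum_(0 <= k < n) (2^-1 : R) ^+ k = 2 - 2 * 2^-1 ^+ n.
  by rewrite gerBl mulr_ge0// exprn_ge0.
elim: n => [|n IH]; first by rewrite big_nil expr0 mulr1 subrr.
by rewrite big_nat_recr//= IH exprS; field.
Qed.

(** The k-th interval, of half-length 2^k rho, has measure 2^(k+1) rho and carries the bound 4 *
    4^-k / rho^2, so it contributes 8 * 2^-k / rho and the sum is at most 16 / rho. *)
Lemma integral_inverse_square (rho : R) (f : R -> R) : 0 < rho ->
  measurable_fun setT f -> (forall a, 0 <= f a) ->
  (forall a, f a * rho ^+ 2 <= 1) -> (forall a, f a * a ^+ 2 <= 1) ->
  (\int[lebesgue_measure]_a (f a)%:E <= (16 / rho)%:E)%E.
Proof.
move=> r0 mf f0 f1 f2.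
have cov (a : R) : exists k : nat, `[- (2 ^+ k * rho), 2 ^+ k * rho]%classic a /\
    f a <= 4 * 2^-1 ^+ k ^+ 2 / rho ^+ 2.
  have [ar|ar] := leP `|a| rho.
    exists 0%N; rewrite expr0 mul1r; split; first by rewrite /= in_itv/= -ler_norml.
    rewrite expr0 expr1n mulr1 ler_pdivlMr ?exprn_gt0//.
    by apply: le_trans (f1 a) _; rewrite ler1n.
  have a0 : 0 < `|a| by apply: lt_trans ar.
  have [|k [k1 k2]] := @dyadic_small (rho / `|a|) (divr_gt0 r0 a0).
    by rewrite ler_pdivrMr// mul1r ltW.
  have P2 : (0 : R) < 2 ^+ k by rewrite exprn_gt0.
  (* The point a lies beyond 2^k rho and within 2^(k+1) rho; the factor 4 in the bound compensates
     for this shift of the index. *)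
  exists k.+1; split.
    rewrite /= in_itv/= -ler_norml.
    move: k1; rewrite ltr_pdivlMr// exprVn mulrC ltr_pdivrMr ?exprn_gt0// => /ltW.
    by rewrite mulrC.
  rewrite ler_pdivlMr ?exprn_gt0//.
  have h : rho <= 2^-1 ^+ k * `|a| by rewrite -ler_pdivrMr.
  apply: (@le_trans _ _ (f a * (2^-1 ^+ k * `|a|) ^+ 2)).
    by rewrite ler_wpM2l// ler_pXn2r// nnegrE ?mulr_ge0 ?exprn_ge0// ltW.
  have -> : f a * (2^-1 ^+ k * `|a|) ^+ 2 = (f a * `|a| ^+ 2) * (2^-1 ^+ k) ^+ 2 by ring.
  rewrite real_normK ?num_real// (_ : 4 * _ = 1 * (2^-1 ^+ k) ^+ 2); last first.
    by rewrite (exprS _ k); field.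
  by rewrite ler_wpM2r ?sqr_ge0.
apply: (@integral_le_cover _ (measurableTypeR R) R lebesgue_measure f (fun k => `[- (2 ^+ k * rho), 2 ^+ k * rho]%classic)
  (fun k => 4 * 2^-1 ^+ k ^+ 2 / rho ^+ 2) (fun k => 2 * (2 ^+ k * rho))) => //.
- by move=> k; rewrite divr_ge0 ?sqr_ge0// mulr_ge0// sqr_ge0.
- move=> k; have := @lebesgue_measure_itv R `[- (2 ^+ k * rho), 2 ^+ k * rho].
  rewrite /= lte_fin => ->; have p : 0 < 2 ^+ k * rho by rewrite mulr_gt0// exprn_gt0.
  by rewrite gtrN// opprK -EFinD lee_fin; lra.
- by move=> a; right; exact: cov.
- move=> n; rewrite (eq_bigr (fun k => 8 / rho * 2^-1 ^+ k)) => [|k _].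
  rewrite -mulr_sumr (_ : 16 / rho = 8 / rho * 2); last by field; rewrite gt_eqF.
    by rewrite ler_wpM2l ?sum_half// divr_ge0// ltW.
  have e : (2^-1 : R) ^+ k * 2 ^+ k = 1 by rewrite -exprMn mulVf// expr1n.
  rewrite -[RHS]mulr1 -[X in _ = _ * X]e.
  by set s := _^-1 ^+ k; set t := _ ^+ k; field; rewrite gt_eqF.
Qed.

End Dyadic.



Section SigmaFinite.
Variable R : realType.

Lemma sigma_finite_leb2 : sigma_finite setT (leb2 R).
Proof.
have /sigma_finiteP[F [TF ndF Foo]] := sigma_finiteT (leb1 R).
exists (fun n => F n `*` F n).
  rewrite -setXTT TF predeqE => -[x y]; split.
    move=> [/= [n _ Fnx] [k _ Gky]]; exists (maxn n k) => //; split.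
    - by move: x Fnx; exact/subsetPset/ndF/leq_maxl.
    - by move: y Gky; exact/subsetPset/ndF/leq_maxr.
  by move=> [n _ []/= ? ?]; split; exists n.
move=> k; have [? ?] := Foo k; split; first exact: measurableX.
by rewrite product_measure1E// lte_mul_pinfty// ge0_fin_numE.
Qed.

(* Measurability of parametric integrals requires a bundled sigma-finite
   measure, which the product of Lebesgue measures is not. *)
Definition plane : {sigma_finite_measure set (measurableTypeR R * measurableTypeR R)%type -> \bar R} :=
  HB.pack (leb2 R) (Measure_isSigmaFinite.Build _ _ _ (leb2 R) sigma_finite_leb2).

End SigmaFinite.

(** * Newton-type kernels on the plane *)

Section Newton.
Variable R : realType.
Local Notation P := (R * R)%type.
Implicit Types x y : P.

(** Balls of the max norm are squares, so the measure is that of a product of intervals. *)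
Lemma leb2_ball x (r : R) : 0 <= r ->
  measurable [set y : P | `|x - y| <= r] /\
  (leb2 R [set y : P | (`|x - y| <= r)%R] <= (4 * r ^+ 2)%:E)%E.
Proof.
move=> r0.
have -> : [set y : P | `|x - y| <= r] =
    `[x.1 - r, x.1 + r]%classic `*` `[x.2 - r, x.2 + r]%classic.
  apply/seteqP; split=> -[a b] /=.
    by rewrite /Num.norm/= ge_max/= !ler_distlC !in_itv/= => /andP[].
  by rewrite /Num.norm/= ge_max/= !ler_distlC !in_itv/= => -[-> ->].
split; first by apply: measurableX.
rewrite product_measure1E//.
have h (c : R) : lebesgue_measure (`[c - r, c + r]%classic : set R) = (2 * r)%:E.
  have := @lebesgue_measure_itv R `[c - r, c + r]; rewrite /= lte_fin => ->.
  move: r0; rewrite le_eqVlt => /predU1P[<-|r0].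
    by rewrite subr0 addr0 ltxx mulr0.
  rewrite ifT; last lra.
  by rewrite -EFinD; congr EFin; ring.
by rewrite [X in (X * _)%E]h [X in (_ * X)%E]h -EFinM lee_fin; lra.
Qed.

Lemma measurable_invdist x : measurable_fun setT (fun y : P => `|x - y|^-1).
Proof.
apply: (measurableT_comp (@measurable_inv R)).
rewrite (_ : (fun y => _) = (fun y => Num.max `|x.1 - y.1| `|x.2 - y.2|))//.
by apply: measurable_maxr; apply: (measurableT_comp (@normr_measurable R setT));
  apply: measurable_funB => //; exact: measurable_cst.
Qed.

(** Up to constants, the size of the difference of a kernel of order -1 between two points at
    distance delta = 2^-N: the gradient bound delta / |x-y|^2 away from the singularity, the kernel
    itself close to it. *)
Definition nker (N : nat) x y : R :=
  Num.min (2^-1 ^+ N * `|x - y|^-1 ^+ 2) `|x - y|^-1.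

Lemma nker_ge0 N x y : 0 <= nker N x y.
Proof.
rewrite /nker le_min; apply/andP; split; last by rewrite invr_ge0.
by apply: mulr_ge0; rewrite exprn_ge0// invr_ge0.
Qed.

Lemma measurable_nker N x : measurable_fun setT (nker N x).
Proof.
apply: measurable_minr; last exact: measurable_invdist.
apply: measurable_funM; first exact: measurable_cst.
by apply: measurable_funX; exact: measurable_invdist.
Qed.

(** The k-th dyadic ball contributes at most 16 * 2^-N by the first argument of the minimum and 8 *
    2^-k by the second. The first bound is used for k < N, the second from N on, where it sums to
    another 16 * 2^-N. The N scales of equal weight are the logarithm in the log-Lipschitz bound. *)
Lemma integral_nker N x :
  (\int[leb2 R]_y (nker N x y * \1_[set y : P | (`|x - y| <= 1)%R] y)%:E
    <= (16 * N.+1%:R * 2^-1 ^+ N)%:E)%E.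
Proof.
have h0 k : (0 : R) <= 2^-1 ^+ k by rewrite exprn_ge0.
pose c k : R := Num.min (2^-1 ^+ N * (2 ^+ k.+1) ^+ 2) (2 ^+ k.+1).
have [m1 _] := leb2_ball x ler01.
have cov y : nker N x y * \1_[set y : P | `|x - y| <= 1] y = 0 \/
   exists k, [set y : P | `|x - y| <= 2^-1 ^+ k] y /\
     nker N x y * \1_[set y : P | `|x - y| <= 1] y <= c k.
  have [d1|d1] := leP `|x - y| 1; last first.
    left; rewrite indicE memNset ?mulr0//=; apply/negP; by rewrite -ltNge.
  rewrite indicE mem_set//= mulr1.
  have [d0|d0] := ltP 0 `|x - y|; last first.
    have e0 : `|x - y| = 0 by apply/eqP; rewrite eq_le d0 normr_ge0.
    by left; rewrite /nker e0 invr0 expr0n/= mulr0 minxx.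
  right; have [k [k1 k2]] := dyadic_small d0 d1; exists k; split=> //.
  have i : `|x - y|^-1 <= 2 ^+ k.+1.
    by rewrite -[leRHS]invrK lef_pV2 ?posrE ?invr_gt0 ?exprn_gt0// -exprVn ltW.
  rewrite /c/nker le_min ge_min; apply/andP; split.
    by apply/orP; left; rewrite ler_wpM2l// ler_pXn2r ?nnegrE ?invr_ge0 ?exprn_ge0.
  by rewrite ge_min i orbT.
apply: (@integral_le_cover _ _ _ (leb2 R) _ (fun k => [set y : P | `|x - y| <= 2^-1 ^+ k])
  c (fun k => 4 * (2^-1 ^+ k) ^+ 2)) => //.
- apply: measurable_funM; first exact: measurable_nker.
  exact: measurable_indic.
- by move=> y; rewrite mulr_ge0// nker_ge0.
- by move=> k; have [] := leb2_ball x (h0 k).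
- by move=> k; rewrite le_min mulr_ge0 ?exprn_ge0.
- by move=> k; have [] := leb2_ball x (h0 k).
move=> n.
have e k : (2 : R) ^+ k.+1 * 2^-1 ^+ k = 2.
  by rewrite exprS -mulrA -exprMn divff// expr1n mulr1.
have t1 k : c k * (4 * (2^-1 ^+ k) ^+ 2) <= 16 * 2^-1 ^+ N.
  apply: (@le_trans _ _ (2^-1 ^+ N * (2 ^+ k.+1) ^+ 2 * (4 * (2^-1 ^+ k) ^+ 2))).
    by rewrite ler_wpM2r ?mulr_ge0 ?exprn_ge0// ge_min lexx.
  rewrite (_ : _ * _ = 4 * 2^-1 ^+ N * (2 ^+ k.+1 * 2^-1 ^+ k) ^+ 2); last ring.
  by rewrite e; lra.
have t2 k : c k * (4 * (2^-1 ^+ k) ^+ 2) <= 8 * 2^-1 ^+ k.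
  apply: (@le_trans _ _ (2 ^+ k.+1 * (4 * (2^-1 ^+ k) ^+ 2))).
    by rewrite ler_wpM2r ?mulr_ge0 ?exprn_ge0// ge_min lexx orbT.
  rewrite (_ : _ * _ = 4 * 2^-1 ^+ k * (2 ^+ k.+1 * 2^-1 ^+ k)); last ring.
  by rewrite e; lra.
have p1 m : \sum_(0 <= k < m) c k * (4 * (2^-1 ^+ k) ^+ 2) <= 16 * m%:R * 2^-1 ^+ N.
  elim: m => [|m IH]; first by rewrite big_nil mulr0 mul0r.
  rewrite big_nat_recr//= -(natr1 m) mulrDr mulrDl lerD// mulr1; exact: t1.
have c0 k : 0 <= c k * (4 * (2^-1 ^+ k) ^+ 2).
  by rewrite !mulr_ge0 ?exprn_ge0// le_min mulr_ge0 ?exprn_ge0.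
have [nN|Nn] := leqP n N.
  apply: le_trans (p1 n) _; rewrite ler_wpM2r// ler_wpM2l// ler_nat; exact: leqW.
rewrite (big_cat_nat (n := N))//=; last exact: ltnW.
rewrite -(natr1 N) mulrDr mulrDl lerD// mulr1.
rewrite -{1}(add0n N) big_addn.
apply: (@le_trans _ _ (\sum_(0 <= i < n - N) 8 * 2^-1 ^+ N * 2^-1 ^+ i)).
  by apply: ler_sum => i _; apply: le_trans (t2 _) _; rewrite exprD; lra.
rewrite -mulr_sumr; have := sum_half R (n - N); have := h0 N.
set a := _ ^+ N; set b := \sum_(_ <= _ < _) _; nra.
Qed.

End Newton.

(** * The helical kernel *)

Section Kernel.
Variable R : realType.
Local Notation P := (R * R)%type.
Local Notation rot := Defs.rot.
Implicit Types (x y : P) (a : R).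

Lemma one_minus_cos_le a : 1 - cos a <= a ^+ 2 / 2.
Proof.
have h : forall a : R, 0 <= a -> sin a <= a.
  move=> b b0; pose f (t : R) := t - sin t.
  have df t : is_derive t (1 : R) f (1 - cos t) by apply: is_deriveB.
  have : f 0 <= f b.
    apply: (@ger0_derive1_le_cc _ f 0 b) => //.
    - by move=> t _; rewrite derive1E; have [_ ->] := df t; rewrite subr_ge0 cos_le1.
    - by apply: derivable_within_continuous => t _; have [] := df t.
    - by rewrite in_itv/= lexx.
    - by rewrite in_itv/= lexx b0.
  by rewrite /f sin0 subr0 subr_ge0.
wlog a0 : a / 0 <= a.
  move=> W; have [a0|/ltW a0] := leP 0 a; first exact: W.
  by rewrite -cosN -sqrrN W// oppr_ge0.
pose f (t : R) := t ^+ 2 / 2 + cos t.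
have df t : is_derive t (1 : R) f (t - sin t).
  apply: is_deriveD; rewrite (_ : (fun x : R => _) = (2^-1 \*: (fun x : R => x ^+ 2))); last first.
    by apply/funext => z; rewrite /= /GRing.scale/= mulrC.
  apply: is_derive_eq.
  rewrite /GRing.scale/= !mulr1; lra.
have : f 0 <= f a.
  apply: (@ger0_derive1_le_cc _ f 0 a) => //.
  - move=> t; rewrite in_itv/= => /andP[/ltW t0 _].
    by rewrite derive1E; have [_ ->] := df t; rewrite subr_ge0 h.
  - by apply: derivable_within_continuous => t _; have [] := df t.
  - by rewrite in_itv/= lexx.
  - by rewrite in_itv/= lexx a0.
by rewrite /f cos0 expr0n/= mul0r add0r; lra.
Qed.

Definition n2 x : R := x.1 ^+ 2 + x.2 ^+ 2.

Lemma n2_ge0 x : 0 <= n2 x.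
Proof. by rewrite addr_ge0 ?sqr_ge0. Qed.

Lemma enorm2_sqr x : enorm2 x ^+ 2 = n2 x.
Proof. by rewrite sqr_sqrtr// n2_ge0. Qed.

Lemma jbracket_sqr x : jbracket x ^+ 2 = 1 + n2 x.
Proof. by rewrite sqr_sqrtr enorm2_sqr// addr_ge0// n2_ge0. Qed.

Lemma jbracket_ge1 x : 1 <= jbracket x.
Proof.
rewrite -[leLHS]sqrtr1 ler_wsqrtr// enorm2_sqr lerDl; exact: n2_ge0.
Qed.

Lemma jbracket_gt0 x : 0 < jbracket x.
Proof. exact: lt_le_trans (jbracket_ge1 x). Qed.

Lemma n2_rot a x : n2 (rot a x) = n2 x.
Proof. by rewrite /n2/= -[in RHS](mulr1 (x.1 ^+ 2)) -[in RHS](mulr1 (x.2 ^+ 2)) -(cos2Dsin2 a); ring. Qed.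

Lemma rotK a x : rot (- a) (rot a x) = x.
Proof.
case: x => u v; rewrite /rot/= cosN sinN; congr (_, _).
  rewrite -[RHS]mulr1 -(cos2Dsin2 a); ring.
rewrite -[RHS]mulr1 -(cos2Dsin2 a); ring.
Qed.

(* |d|^2 for the difference vector d in the integrand of the kernel. *)
Definition hdist2 x y a : R := n2 (x - rot a y) + a ^+ 2.

Lemma hdist2_ge0 x y a : 0 <= hdist2 x y a.
Proof. by rewrite addr_ge0 ?n2_ge0 ?sqr_ge0. Qed.

Lemma hdist2C x y a : hdist2 x y a = hdist2 y x (- a).
Proof.
rewrite /hdist2 sqrrN; congr (_ + _).
rewrite -(n2_rot (- a)) -[in RHS](opprB _ y) /n2/= !sqrrN /=.
have := rotK a y; case: y => y1 y2; case: x => x1 x2; rewrite /rot/= => -[e1 e2].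
rewrite -[in RHS]e1 -[in RHS]e2 cosN sinN; ring.
Qed.

Lemma n2_rot_sub a y : n2 (rot a y - y) <= a ^+ 2 * n2 y.
Proof.
have := one_minus_cos_le a; have := n2_ge0 y => h1 h2.
have -> : n2 (rot a y - y) = 2 * (1 - cos a) * n2 y.
  rewrite /n2/rot/=; have e := cos2Dsin2 a.
  have -> : (y.1 * cos a + y.2 * sin a - y.1) ^+ 2 + (- y.1 * sin a + y.2 * cos a - y.2) ^+ 2 =
    (cos a ^+ 2 + sin a ^+ 2 + 1 - 2 * cos a) * (y.1 ^+ 2 + y.2 ^+ 2) by ring.
  by rewrite e; ring.
by rewrite ler_wpM2r//; lra.
Qed.

(** Cauchy-Schwarz bounds the square of u.v by (b |u|^2) a^2, and the arithmetic-geometric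
    inequality gives 2 u.v <= b |u|^2 + a^2. It is applied to v = R_a y - y with b = |y|^2. *)
Lemma n2_add_le u v a b : 0 <= b -> n2 v <= a ^+ 2 * b ->
  n2 (u + v) <= (1 + b) * (n2 u + a ^+ 2).
Proof.
move=> b0 hv.
have cs : (u.1 * v.1 + u.2 * v.2) ^+ 2 <= n2 u * n2 v.
  rewrite -subr_ge0 (_ : _ - _ = (u.1 * v.2 - u.2 * v.1) ^+ 2) ?sqr_ge0//.
  by rewrite /n2; ring.
have -> : n2 (u + v) = n2 u + n2 v + 2 * (u.1 * v.1 + u.2 * v.2).
  by rewrite /n2/=; ring.
set s := u.1 * v.1 + _ in cs *.
suff : 2 * s <= b * n2 u + a ^+ 2 by have := n2_ge0 v; nra.
have c1 : s ^+ 2 <= (b * n2 u) * a ^+ 2.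
  apply: le_trans cs _; rewrite mulrAC mulrC.
  by rewrite [leRHS](_ : _ = a ^+ 2 * b * n2 u) ?ler_wpM2r ?n2_ge0//; ring.
have g : 0 <= b * n2 u by rewrite mulr_ge0 ?n2_ge0.
have : (2 * s) ^+ 2 <= (b * n2 u + a ^+ 2) ^+ 2.
  have := sqr_ge0 (b * n2 u - a ^+ 2); nra.
have g2 : 0 <= b * n2 u + a ^+ 2 by rewrite addr_ge0// sqr_ge0.
have [s0|s0] := leP 0 (2 * s); first by rewrite ler_pXn2r.
by move=> _; apply: le_trans (ltW s0) g2.
Qed.

Lemma n2_le_hdist2_r x y a : n2 (x - y) <= (1 + n2 y) * hdist2 x y a.
Proof.
have -> : x - y = (x - rot a y) + (rot a y - y) by rewrite addrA subrK.
apply: n2_add_le; [exact: n2_ge0|exact: n2_rot_sub].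
Qed.

Lemma n2_le_hdist2_l x y a : n2 (x - y) <= (1 + n2 x) * hdist2 x y a.
Proof.
rewrite hdist2C (_ : n2 (x - y) = n2 (y - x)) ?n2_le_hdist2_r//.
by rewrite /n2/=; ring.
Qed.

Lemma norm_le_n2 x : `|x| ^+ 2 <= n2 x.
Proof.
have -> : `|x| = Num.max `|x.1| `|x.2| by []; have [_|_] := leP `|x.1| `|x.2|;
  by rewrite real_normK ?num_real// /n2 ?lerDl ?lerDr sqr_ge0.
Qed.

Definition hdist x y a : R := Num.sqrt (hdist2 x y a).

Lemma hdist_ge0 x y a : 0 <= hdist x y a. Proof. exact: sqrtr_ge0. Qed.

Lemma hdist_sqr x y a : hdist x y a ^+ 2 = hdist2 x y a.
Proof. by rewrite sqr_sqrtr// hdist2_ge0. Qed.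

Lemma enorm3_hdist x y a : enorm3 (((x, 0) : R * R * R) - (rot a y, a)) = hdist x y a.
Proof. by rewrite /enorm3/hdist/hdist2/n2/= sub0r sqrrN. Qed.

(** Undoing the rotation costs at most |a| times the modulus of the rotated point, and either point
    may be chosen. Both choices matter: the bracket of y is absorbed by the weight of the vorticity,
    while in the difference estimate, where the factor is squared, only a bounded bracket of x is
    affordable. *)
Lemma dist_le_hdist x y a :
  `|x - y| <= Num.min (jbracket x) (jbracket y) * hdist x y a.
Proof.
have main (b : P) : n2 (x - y) <= (1 + n2 b) * hdist2 x y a -> `|x - y| <= jbracket b * hdist x y a.
  move=> h; rewrite -(@ler_pXn2r _ 2) ?nnegrE//; last first.
    by rewrite mulr_ge0 ?hdist_ge0// ltW// jbracket_gt0.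
  rewrite exprMn jbracket_sqr hdist_sqr; apply: le_trans h; exact: norm_le_n2.
rewrite /Num.min; case: ifP => _; apply: main; [exact: n2_le_hdist2_l|exact: n2_le_hdist2_r].
Qed.

(** The difference splits into (d - d') / n^3 and d' (n^-3 - n'^-3). In the second part n' - n
    factors out, |d'| / n' <= 1 absorbs one power, and the mixed terms are controlled by A B^2 + A^2
    B <= A^3 + B^3 with A = 1/n and B = 1/n'. *)
Lemma inv_cube_diff (d d' n n' E : R) : 0 < n -> 0 < n' -> `|d'| <= n' ->
  `|d - d'| <= E -> `|n - n'| <= 2 * E ->
  `|(n ^+ 3)^-1 * d - (n' ^+ 3)^-1 * d'| <= 5 * E * (n^-1 ^+ 3 + n'^-1 ^+ 3).
Proof.
move=> n0 n'0 dn dE nE.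
have E0 : 0 <= E by apply: le_trans dE.
have nn : n != 0 by rewrite gt_eqF.
have nn' : n' != 0 by rewrite gt_eqF.
have -> : (n ^+ 3)^-1 * d - (n' ^+ 3)^-1 * d' =
  (d - d') * n^-1 ^+ 3 + (n' - n) * (d' * n'^-1) *
   (n^-1 * n'^-1 ^+ 2 + n^-1 ^+ 2 * n'^-1 + n^-1 ^+ 3) by field; rewrite nn nn'.
set A := n^-1; set B := n'^-1.
have A0 : 0 < A by rewrite invr_gt0.
have B0 : 0 < B by rewrite invr_gt0.
have q : `|d' * B| <= 1 by rewrite normrM (gtr0_norm B0) ler_pdivrMr ?mul1r.
have S0 : 0 <= A * B ^+ 2 + A ^+ 2 * B + A ^+ 3.
  by rewrite !addr_ge0 ?mulr_ge0 ?exprn_ge0// ltW.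
have S1 : A * B ^+ 2 + A ^+ 2 * B <= A ^+ 3 + B ^+ 3.
  rewrite -subr_ge0 (_ : _ - _ = (A + B) * (A - B) ^+ 2); last ring.
  by rewrite mulr_ge0 ?sqr_ge0// addr_ge0// ltW.
have A3 : 0 < A ^+ 3 by rewrite exprn_gt0.
have B3 : 0 < B ^+ 3 by rewrite exprn_gt0.
apply: le_trans (ler_normD _ _) _.
rewrite (normrM (d - d')) (normrM ((n' - n) * _)) (normrM (n' - n)) (ger0_norm S0) (gtr0_norm A3).
have h1 : `|d - d'| * A ^+ 3 <= E * A ^+ 3 by rewrite ler_wpM2r// ltW.
have h2 : `|n' - n| * `|d' * B| * (A * B ^+ 2 + A ^+ 2 * B + A ^+ 3) <=
    (2 * E) * (2 * A ^+ 3 + B ^+ 3).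
  rewrite ler_pM ?mulr_ge0//; last by lra.
  by rewrite -[leRHS]mulr1 ler_pM// distrC.
by nra.
Qed.

Lemma abs_le_hdist x y a : [/\ `|(x - rot a y).1| <= hdist x y a,
  `|(x - rot a y).2| <= hdist x y a & `|a| <= hdist x y a].
Proof.
have g (z : R) : z ^+ 2 <= hdist2 x y a -> `|z| <= hdist x y a.
  move=> h; rewrite -(@ler_pXn2r _ 2) ?nnegrE ?hdist_ge0//.
  by rewrite real_normK ?num_real// hdist_sqr.
have := sqr_ge0 (x - rot a y).1; have := sqr_ge0 (x - rot a y).2; have := sqr_ge0 a.
by split; apply: g; rewrite /hdist2/n2; lra.
Qed.

(** The difference of squares is divided by the sum of the distances, which avoids differentiating
    the square root at 0. The factor 2 is the price of the max norm: one term per coordinate. *)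
Lemma hdist_lipschitz x x' y a : `|hdist x y a - hdist x' y a| <= 2 * `|x - x'|.
Proof.
set n := hdist x y a; set n' := hdist x' y a.
have := hdist_ge0 x y a; have := hdist_ge0 x' y a; rewrite -/n -/n' => n'0 n0.
have [s0|s0] := leP (n + n') 0.
  have -> : n = 0 by lra.
  by have -> : n' = 0; [lra|rewrite subrr normr0 mulr_ge0].
rewrite -(ler_pM2r s0) -[X in _ * X <= _](gtr0_norm s0) -normrM.
have -> : (n - n') * (n + n') = n ^+ 2 - n' ^+ 2 by ring.
rewrite !hdist_sqr /hdist2.
have [p1 p2 _] := abs_le_hdist x y a; have [q1 q2 _] := abs_le_hdist x' y a.
rewrite -/n -/n' in p1 p2 q1 q2.
have -> : n2 (x - rot a y) + a ^+ 2 - (n2 (x' - rot a y) + a ^+ 2) =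
   (x - x').1 * ((x - rot a y).1 + (x' - rot a y).1) +
   (x - x').2 * ((x - rot a y).2 + (x' - rot a y).2) by rewrite /n2/=; ring.
have e1 : `|(x - x').1| <= `|x - x'| by rewrite [leRHS]/Num.norm/= le_max lexx.
have e2 : `|(x - x').2| <= `|x - x'| by rewrite [leRHS]/Num.norm/= le_max lexx orbT.
apply: le_trans (ler_normD _ _) _; rewrite !normrM.
rewrite [leRHS](_ : _ = `|x - x'| * (n + n') + `|x - x'| * (n + n')); last ring.
by apply: lerD; apply: ler_pM => //; apply: le_trans (ler_normD _ _) _; apply: lerD.
Qed.

Lemma abs_le_jbracket y : `|y.1| <= jbracket y /\ `|y.2| <= jbracket y.
Proof.
have g (z : R) : z ^+ 2 <= n2 y -> `|z| <= jbracket y.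
  move=> h; rewrite -(@ler_pXn2r _ 2) ?nnegrE//; last by rewrite ltW// jbracket_gt0.
  by rewrite real_normK ?num_real// jbracket_sqr; lra.
have := sqr_ge0 y.1; have := sqr_ge0 y.2.
by split; apply: g; rewrite /n2; lra.
Qed.

Lemma jbracket_rot a y : jbracket (rot a y) = jbracket y.
Proof. by rewrite /jbracket !enorm2_sqr n2_rot. Qed.

(** Indexing the components lets each kernel estimate be stated once for all three. *)
Definition comp (i : 'I_3) (u : R * R * R) : R :=
  if i == 0 :> nat then u.1.1 else if i == 1 :> nat then u.1.2 else u.2.

Lemma ord3_ind (Q : 'I_3 -> Prop) : Q 0 -> Q 1 -> Q 2%:R -> forall i, Q i.
Proof.
move=> q0 q1 q2 [[|[|[|//]]] hi].
- by rewrite (_ : Ordinal hi = 0)//; exact/val_inj.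
- by rewrite (_ : Ordinal hi = 1)//; exact/val_inj.
- by rewrite (_ : Ordinal hi = 2%:R)//; exact/val_inj.
Qed.

Definition kint (i : 'I_3) x y a : R := comp i (helK_integrand x y a).

(** Every component of the cross product is a difference of two products of an entry of d, at most
    |d|, with an entry of xi, at most <y>. *)
Lemma kint_bound i x y a : `|kint i x y a| <= 2 * jbracket y * (hdist x y a)^-1 ^+ 2.
Proof.
have [p1 p2 p3] := abs_le_hdist x y a; have [q1 q2] := abs_le_jbracket (rot a y).
rewrite jbracket_rot in q1 q2; have j1 := jbracket_ge1 y; have n0 := hdist_ge0 x y a.
have e (z v : R) : `|z| <= hdist x y a -> `|v| <= jbracket y ->
    `|(hdist x y a ^+ 3)^-1 * z * v| <= jbracket y * (hdist x y a)^-1 ^+ 2.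
  move=> hz hv; rewrite !normrM mulrC ler_pM ?mulr_ge0//.
  rewrite (@ger0_norm _ _^-1) ?invr_ge0 ?exprn_ge0// -exprVn.
  have [->|nn] := eqVneq (hdist x y a) 0; first by rewrite invr0 !expr0n/= mul0r.
  rewrite [leRHS](_ : _ = (hdist x y a)^-1 ^+ 3 * hdist x y a); last by field.
  by rewrite ler_wpM2l// exprn_ge0// invr_ge0.
have tri (u v c : R) : `|u| <= c -> `|v| <= c -> `|u - v| <= 2 * c.
  by move=> h1 h2; apply: le_trans (ler_normB _ _) _; lra.
have a3 : `|0 - a| <= hdist x y a by rewrite sub0r normrN.
have o1 : `|1| <= jbracket y by rewrite normr1.
have q1' : `|- (rot a y).1| <= jbracket y by rewrite normrN.
rewrite -mulrA; elim/ord3_ind: i; rewrite /kint/comp/= /helK_integrand enorm3_hdist /cross/xi;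
  by apply: tri; apply: e.
Qed.

(** The factor xi depends on y and a only, so each of the two products falls under [inv_cube_diff]
    with E = |x - x'|. *)
Lemma kint_lipschitz i x x' y a : 0 < hdist x y a -> 0 < hdist x' y a ->
  `|kint i x y a - kint i x' y a| <=
  10 * jbracket y * `|x - x'| * ((hdist x y a)^-1 ^+ 3 + (hdist x' y a)^-1 ^+ 3).
Proof.
move=> n0 n0'.
have [p1 p2 p3] := abs_le_hdist x' y a; have [q1 q2] := abs_le_jbracket (rot a y).
rewrite jbracket_rot in q1 q2; have j1 := jbracket_ge1 y.
have hl := hdist_lipschitz x x' y a.
have e1 : `|(x - rot a y).1 - (x' - rot a y).1| <= `|x - x'|.
  by rewrite /= opprB addrA subrK [leRHS]/Num.norm/= le_max lexx.
have e2 : `|(x - rot a y).2 - (x' - rot a y).2| <= `|x - x'|.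
  by rewrite /= opprB addrA subrK [leRHS]/Num.norm/= le_max lexx orbT.
have e3 : `|(0 - a) - (0 - a)| <= `|x - x'| by rewrite subrr normr0.
have a3 : `|0 - a| <= hdist x' y a by rewrite sub0r normrN.
have h (z z' v : R) : `|z'| <= hdist x' y a -> `|z - z'| <= `|x - x'| ->
    `|v| <= jbracket y ->
    `|(hdist x y a ^+ 3)^-1 * z * v - (hdist x' y a ^+ 3)^-1 * z' * v| <=
    5 * jbracket y * `|x - x'| * ((hdist x y a)^-1 ^+ 3 + (hdist x' y a)^-1 ^+ 3).
  move=> h1 h2 h3; rewrite -mulrBl normrM.
  have := inv_cube_diff n0 n0' h1 h2 hl => h4.
  apply: le_trans (ler_pM _ _ h4 h3) _ => //.
  by rewrite le_eqVlt; apply/orP; left; apply/eqP; ring.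
have tri (u v u' v' c : R) : `|u - u'| <= 5 * c -> `|v - v'| <= 5 * c ->
    `|(u - v) - (u' - v')| <= 10 * c.
  move=> h1 h2; rewrite (_ : _ - _ = (u - u') - (v - v')); last ring.
  by apply: le_trans (ler_normB _ _) _; lra.
have o1 : `|1| <= jbracket y by rewrite normr1.
have q1' : `|- (rot a y).1| <= jbracket y by rewrite normrN.
rewrite -!mulrA; elim/ord3_ind: i; rewrite /kint/comp/= /helK_integrand !enorm3_hdist /cross/xi;
  by apply: tri; rewrite !mulrA; apply: h.
Qed.

End Kernel.

(** No integrability is assumed: Tonelli applies to the positive and negative parts separately, and
    [fine] is measurable. *)
Lemma measurable_Rintegral d1 d2 (T1 : measurableType d1) (T2 : measurableType d2)
    (R : realType) (m2 : {sigma_finite_measure set T2 -> \bar R}) (f : T1 * T2 -> R) :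
  measurable_fun setT f ->
  measurable_fun setT (fun x => \int[m2]_y f (x, y)).
Proof.
move=> mf.
have mef : measurable_fun setT (EFin \o f) by exact/measurable_EFinP.
apply: (measurableT_comp (f := @fine R)); first exact: fine_measurable.
under eq_fun do rewrite integralE.
have mp : measurable_fun setT (EFin \o f)^\+%E by exact: measurable_funepos.
have mn : measurable_fun setT (EFin \o f)^\-%E by exact: measurable_funeneg.
apply: emeasurable_funB.
- have Hp : measurable_fun setT (fubini_F m2 (EFin \o f)^\+%E).
    exact: measurable_fun_fubini_tonelli_F.
  rewrite (_ : (fun x : T1 => _) = fubini_F m2 (EFin \o f)^\+%E)//.
  by apply/funext => x; apply: eq_integral => y _; rewrite ?funeposE ?funenegE.
- have Hn : measurable_fun setT (fubini_F m2 (EFin \o f)^\-%E).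
    exact: measurable_fun_fubini_tonelli_F.
  rewrite (_ : (fun x : T1 => _) = fubini_F m2 (EFin \o f)^\-%E)//.
  by apply/funext => x; apply: eq_integral => y _; rewrite ?funeposE ?funenegE.
Qed.

(** * Measurability of the helical kernel *)

Section Measurability.
Variable R : realType.
Local Notation P := (R * R)%type.
Context d (T : measurableType d).
Implicit Types f g : T -> R.

Lemma measurable_funV f : measurable_fun setT f -> measurable_fun setT (fun x => (f x)^-1).
Proof. by move=> mf; apply: (measurableT_comp (@measurable_inv R)). Qed.

Lemma measurable_fun_sqrt f : measurable_fun setT f -> measurable_fun setT (fun x => Num.sqrt (f x)).
Proof. by move=> mf; apply: (measurableT_comp (@measurable_sqrt R)). Qed.

Lemma measurable_fun_cos f : measurable_fun setT f -> measurable_fun setT (fun x => cos (f x)).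
Proof.
move=> mf; apply: (measurableT_comp (f := @cos R)) => //.
by apply: continuous_measurable_fun; exact: continuous_cos.
Qed.

Lemma measurable_fun_sin f : measurable_fun setT f -> measurable_fun setT (fun x => sin (f x)).
Proof.
move=> mf; apply: (measurableT_comp (f := @sin R)) => //.
by apply: continuous_measurable_fun; exact: continuous_sin.
Qed.

Lemma measurable_hdist (X Y : T -> P) (A : T -> R) : measurable_fun setT X ->
  measurable_fun setT Y -> measurable_fun setT A ->
  measurable_fun setT (fun t => hdist (X t) (Y t) (A t)).
Proof.
move=> mX mY mA.
have m11 : measurable_fun setT (fun t => (X t).1) by exact: (measurableT_comp measurable_fst).
have m12 : measurable_fun setT (fun t => (X t).2) by exact: (measurableT_comp measurable_snd).
have m21 : measurable_fun setT (fun t => (Y t).1) by exact: (measurableT_comp measurable_fst).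
have m22 : measurable_fun setT (fun t => (Y t).2) by exact: (measurableT_comp measurable_snd).
have mc := measurable_fun_cos mA; have ms := measurable_fun_sin mA.
have mr1 : measurable_fun setT (fun t => (Defs.rot (A t) (Y t)).1).
  by apply: measurable_funD; apply: measurable_funM.
have mr2 : measurable_fun setT (fun t => (Defs.rot (A t) (Y t)).2).
  by apply: measurable_funD; apply: measurable_funM => //; exact: measurableT_comp.
apply: measurable_fun_sqrt.
by apply: measurable_funD; [apply: measurable_funD|]; apply: measurable_funX => //;
  exact: measurable_funB.
Qed.

Lemma measurable_kint i (X Y : T -> P) (A : T -> R) : measurable_fun setT X ->
  measurable_fun setT Y -> measurable_fun setT A ->
  measurable_fun setT (fun t => kint i (X t) (Y t) (A t)).
Proof.
move=> mX mY mA.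
have m11 : measurable_fun setT (fun t => (X t).1) by exact: (measurableT_comp measurable_fst).
have m12 : measurable_fun setT (fun t => (X t).2) by exact: (measurableT_comp measurable_snd).
have m21 : measurable_fun setT (fun t => (Y t).1) by exact: (measurableT_comp measurable_fst).
have m22 : measurable_fun setT (fun t => (Y t).2) by exact: (measurableT_comp measurable_snd).
have mc := measurable_fun_cos mA; have ms := measurable_fun_sin mA.
have mr1 : measurable_fun setT (fun t => (Defs.rot (A t) (Y t)).1).
  by apply: measurable_funD; apply: measurable_funM.
have mr2 : measurable_fun setT (fun t => (Defs.rot (A t) (Y t)).2).
  by apply: measurable_funD; apply: measurable_funM => //; exact: measurableT_comp.
have md1 : measurable_fun setT (fun t => (X t - Defs.rot (A t) (Y t)).1).
  exact: measurable_funB.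
have md2 : measurable_fun setT (fun t => (X t - Defs.rot (A t) (Y t)).2).
  exact: measurable_funB.
have md3 : measurable_fun setT (fun t => 0 - A t).
  by apply: measurable_funB => //; exact: measurable_cst.
have mn : measurable_fun setT (fun t => (hdist (X t) (Y t) (A t) ^+ 3)^-1).
  apply: measurable_funV; apply: measurable_funX; exact: measurable_hdist.
have m1 : measurable_fun setT (cst (1 : R) : T -> R) by exact: measurable_cst.
have mr1' : measurable_fun setT (fun t => - (Defs.rot (A t) (Y t)).1).
  exact: measurableT_comp.
elim/ord3_ind: i; rewrite /kint/comp/= /helK_integrand;
  under eq_fun do rewrite enorm3_hdist;
  by apply: measurable_funB; apply: measurable_funM => //; apply: measurable_funM.
Qed.

End Measurability.

(** * Size and modulus of the kernel after vertical integration *)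

Section HelK.
Variable R : realType.
Local Notation P := (R * R)%type.
Implicit Types (x y : P) (a : R).

Definition kcomp (i : 'I_3) x y : R := - (4 * pi)^-1 * \int[leb1 R]_a kint i x y a.

Lemma kcompE i x y : comp i (helK x y) = kcomp i x y.
Proof. by elim/ord3_ind: i. Qed.

Lemma measurable_kcomp i : measurable_fun setT (fun z : P * P => kcomp i z.1 z.2).
Proof.
apply: measurable_funM; first exact: measurable_cst.
apply: (@measurable_Rintegral _ _ (P * P)%type (measurableTypeR R) R (leb1 R)
  (fun z => kint i z.1.1 z.1.2 z.2)).
apply: measurable_kint => //.
- exact: (measurableT_comp measurable_fst).
- exact: (measurableT_comp measurable_snd).
Qed.

Lemma pi_cst_le1 : `|- (4 * pi)^-1| <= 1 :> R.
Proof.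
have := @pi_ge2 R => p2.
rewrite normrN ger0_norm; last by rewrite invr_ge0; lra.
by rewrite invf_le1; lra.
Qed.

Definition jmin x y : R := Num.min (jbracket x) (jbracket y).

Lemma jmin_gt0 x y : 0 < jmin x y.
Proof. by rewrite lt_min !jbracket_gt0. Qed.

Lemma hdist_gt0 x y a : x != y -> 0 < hdist x y a.
Proof.
move=> xy; have := dist_le_hdist x y a.
have : 0 < `|x - y| by rewrite normr_gt0 subr_eq0.
have := jmin_gt0 x y; rewrite /jmin; have := hdist_ge0 x y a; nra.
Qed.

Lemma measurable_hdistV x y n : measurable_fun setT (fun a : R => (hdist x y a)^-1 ^+ n).
Proof.
apply: measurable_funX; apply: measurable_funV; apply: measurable_hdist => //;
  exact: measurable_cst.
Qed.

Lemma dist_jmin x y a : `|x - y| / jmin x y <= hdist x y a.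
Proof. by rewrite ler_pdivrMr ?jmin_gt0// mulrC dist_le_hdist. Qed.

(** The helical distance dominates both |a| and rho = |x-y| / [jmin x y], which are the two
    hypotheses of [integral_inverse_square]. *)
Lemma integral_hdist2 x y : x != y ->
  (\int[leb1 R]_a ((hdist x y a)^-1 ^+ 2)%:E <= (16 * (jmin x y * `|x - y|^-1))%:E)%E.
Proof.
move=> xy; have d0 : 0 < `|x - y| by rewrite normr_gt0 subr_eq0.
have j0 := jmin_gt0 x y.
have r0 : 0 < `|x - y| / jmin x y by rewrite divr_gt0.
rewrite -[_ * _^-1]invrK invfM invrK [_^-1 * _]mulrC.
have h (z : R) a : 0 <= z -> z <= hdist x y a -> (hdist x y a)^-1 ^+ 2 * z ^+ 2 <= 1.
  move=> z0 zh; rewrite exprVn mulrC ler_pdivrMr ?exprn_gt0 ?hdist_gt0// mul1r.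
  by rewrite ler_pXn2r// nnegrE hdist_ge0.
apply: integral_inverse_square => //.
- exact: measurable_hdistV.
- by move=> a; rewrite exprn_ge0// invr_ge0 hdist_ge0.
- by move=> a; apply: h; [exact: ltW|exact: dist_jmin].
- move=> a; rewrite -(@real_normK _ a) ?num_real//; apply: h => //.
  by have [] := abs_le_hdist x y a.
Qed.

(** One factor is bounded by its supremum [jmin x y] / |x-y|; the other two are integrated. *)
Lemma integral_hdist3 x y : x != y ->
  (\int[leb1 R]_a ((hdist x y a)^-1 ^+ 3)%:E <= (16 * (jmin x y * `|x - y|^-1) ^+ 2)%:E)%E.
Proof.
move=> xy; have d0 : 0 < `|x - y| by rewrite normr_gt0 subr_eq0.
have j0 := jmin_gt0 x y.
have r0 : 0 < `|x - y| / jmin x y by rewrite divr_gt0.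
have c0 : 0 <= jmin x y * `|x - y|^-1 by rewrite mulr_ge0 ?invr_ge0// ltW.
rewrite expr2 mulrCA.
apply: (ge0_integral_scale_le _ _ _ c0) (integral_hdist2 xy) => //.
- exact: measurable_hdistV.
- exact: measurable_hdistV.
- move=> a _; have n0 := hdist_gt0 a xy.
  have i0 : 0 <= (hdist x y a)^-1 by rewrite invr_ge0 ltW.
  rewrite exprn_ge0//= exprS ler_wpM2r ?exprn_ge0//.
  rewrite -[leRHS]invrK invfM invrK mulrC lef_pV2 ?posrE//; exact: dist_jmin.
- by move=> a _; rewrite exprn_ge0// invr_ge0 hdist_ge0.
Qed.

Lemma measurable_kint1 i x y : measurable_fun setT (kint i x y).
Proof. by apply: measurable_kint => //; exact: measurable_cst. Qed.

Lemma kint_integral_bound i x y : x != y ->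
  (leb1 R).-integrable setT (EFin \o kint i x y) /\
  `|\int[leb1 R]_a kint i x y a| <= 2 * jbracket y * (16 * (jmin x y * `|x - y|^-1)).
Proof.
move=> xy; have j0 := jbracket_gt0 y.
apply: (@integral_bound _ (measurableTypeR R) R (leb1 R) _
  (fun a => 2 * jbracket y * (hdist x y a)^-1 ^+ 2)) => //.
- exact: measurable_kint1.
- by apply: measurable_funM; [exact: measurable_cst|exact: measurable_hdistV].
- by move=> a _; exact: kint_bound.
apply: (ge0_integral_scale_le _ _ _ _ _ _ (integral_hdist2 xy)) => //.
- by apply: measurable_funM; [exact: measurable_cst|exact: measurable_hdistV].
- exact: measurable_hdistV.
- by rewrite mulr_ge0// ltW.
- by move=> a _; rewrite lexx andbT !mulr_ge0// ?exprn_ge0 ?invr_ge0 ?hdist_ge0// ltW.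
- by move=> a _; rewrite exprn_ge0// invr_ge0 hdist_ge0.
Qed.

(** Integration along the vertical axis lowers the singularity of the three-dimensional Biot-Savart
    kernel from order -2 to order -1, which is locally integrable on the plane. *)
Lemma kcomp_bound i x y : x != y ->
  `|kcomp i x y| <= 32 * jbracket y * jmin x y * `|x - y|^-1.
Proof.
move=> xy; have [_ h] := kint_integral_bound i xy.
rewrite /kcomp normrM; apply: (@le_trans _ _ (1 * `|\int[leb1 R]_a kint i x y a|)).
  by rewrite ler_wpM2r// pi_cst_le1.
by rewrite mul1r; apply: le_trans h _; lra.
Qed.

Lemma integrable_kint i x y : x != y -> (leb1 R).-integrable setT (EFin \o kint i x y).
Proof. by move=> /(kint_integral_bound i)[]. Qed.

Lemma kcomp_lipschitz i x x' y : x != y -> x' != y ->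
  `|kcomp i x y - kcomp i x' y| <= 160 * jbracket y * `|x - x'| *
    ((jmin x y * `|x - y|^-1) ^+ 2 + (jmin x' y * `|x' - y|^-1) ^+ 2).
Proof.
move=> xy x'y; have j0 := jbracket_gt0 y.
rewrite /kcomp -mulrBr normrM.
rewrite -RintegralB//; [|exact: integrable_kint|exact: integrable_kint].
set I := \int[_]_(_ in _) _.
apply: (@le_trans _ _ (1 * `|I|)); first by rewrite ler_wpM2r// pi_cst_le1.
rewrite mul1r /I {I}.
pose g a := (hdist x y a)^-1 ^+ 3 + (hdist x' y a)^-1 ^+ 3.
have g0 a : 0 <= g a by rewrite addr_ge0// exprn_ge0// invr_ge0 hdist_ge0.
have mg : measurable_fun setT g by apply: measurable_funD; exact: measurable_hdistV.
have c0 : 0 <= 10 * jbracket y * `|x - x'| by rewrite !mulr_ge0// ltW.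
rewrite [leRHS](_ : _ = 10 * jbracket y * `|x - x'| * (16 * (jmin x y * `|x - y|^-1) ^+ 2 +
    16 * (jmin x' y * `|x' - y|^-1) ^+ 2)); last by ring.
refine (proj2 (@integral_bound _ (measurableTypeR R) R (leb1 R) _
  (fun a => 10 * jbracket y * `|x - x'| * g a) setT _ _ _ _ _ _)) => //.
- by apply: measurable_funB; exact: measurable_kint1.
- by apply: measurable_funM => //; exact: measurable_cst.
- by move=> a _; apply: kint_lipschitz; exact: hdist_gt0.
apply: (@ge0_integral_scale_le _ (measurableTypeR R) R (leb1 R) _ g setT _ _ measurableT _ mg c0) => //.
- by apply: measurable_funM => //; exact: measurable_cst.
- by move=> a _; rewrite lexx andbT mulr_ge0.
under eq_integral do rewrite EFinD.
rewrite ge0_integralD//; first by rewrite EFinD leeD// integral_hdist3.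
- by move=> a _; rewrite lee_fin exprn_ge0// invr_ge0 hdist_ge0.
- by apply/measurable_EFinP; exact: measurable_hdistV.
- by move=> a _; rewrite lee_fin exprn_ge0// invr_ge0 hdist_ge0.
- by apply/measurable_EFinP; exact: measurable_hdistV.
Qed.

End HelK.

(* Locked because unfolding these unary numerals is costly. *)
HB.lock Definition cU (R : realType) : R := 544.
HB.lock Definition cL (R : realType) : R := 10880.

(** * Log-Lipschitz bound for the potential *)

Section Field.
Variable R : realType.
Local Notation P := (R * R)%type.
Implicit Types (x y : P) (g : P -> R).

Lemma ge0_scale_leb2 (f g : P -> R) (c C : R) : measurable_fun setT f ->
  measurable_fun setT g -> 0 <= c -> (forall x, 0 <= f x <= c * g x) ->
  (forall x, 0 <= g x) -> (\int[leb2 R]_x (g x)%:E <= C%:E)%E ->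
  (\int[leb2 R]_x (f x)%:E <= (c * C)%:E)%E.
Proof.
by move=> mf mg c0 fg g0; apply: (@ge0_integral_scale_le _ _ R (leb2 R) f g setT c C) => // x _.
Qed.

Lemma integral_bound_leb2 (f g : P -> R) (C : R) : measurable_fun setT f ->
  measurable_fun setT g -> (forall x, `|f x| <= g x) ->
  (\int[leb2 R]_x (g x)%:E <= C%:E)%E ->
  (leb2 R).-integrable setT (EFin \o f) /\ `|\int[leb2 R]_x f x| <= C.
Proof.
by move=> mf mg fg; apply: (@integral_bound _ _ R (leb2 R) f g setT C) => // x _.
Qed.

Lemma leb2_set1 x : leb2 R [set x] = 0%E.
Proof.
rewrite (_ : [set x] = [set x.1] `*` [set x.2]); last first.
  by apply/seteqP; split=> [z /= ->//|[a b] /= [-> ->]]; case: x.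
rewrite product_measure1E//.
by rewrite [X in (X * _)%E](lebesgue_measure_set1 x.1) mul0e.
Qed.

Lemma ae_neq x : {ae leb2 R, forall y, x != y}.
Proof.
exists [set x]; split; last 1 first.
- by move=> y /= /negP/negPn/eqP ->.
- rewrite (_ : [set x] = [set x.1] `*` [set x.2]); last first.
    by apply/seteqP; split=> [z /= ->//|[a b] /= [-> ->]]; case: x.
  exact: measurableX.
- exact: leb2_set1.
Qed.

Global Instance ae_leb2_filter : Filter (nbhs (almost_everywhere (leb2 R))).
Proof. exact: (@ae_filter_ringOfSetsType _ _ R (leb2 R)). Qed.

Definition weight g y : R := jbracket y ^+ 2 * `|g y|.

(** Membership in the class for m = 2, unpacked: one constant bounds both weighted norms, the second
    one only almost everywhere because it is an essential supremum. *)
Definition good (M : R) g : Prop := [/\ measurable_fun setT g,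
  (\int[leb2 R]_y (weight g y)%:E <= M%:E)%E &
  {ae leb2 R, forall y, weight g y <= M}].

Lemma measurable_n2 : measurable_fun setT (@n2 R).
Proof.
by apply: measurable_funD; apply: measurable_funX;
  [exact: measurable_fst|exact: measurable_snd].
Qed.

Lemma measurable_enorm2 : measurable_fun setT (@enorm2 R).
Proof. by apply: measurable_fun_sqrt; exact: measurable_n2. Qed.

Lemma measurable_jbracket : measurable_fun setT (@jbracket R).
Proof.
apply: measurable_fun_sqrt; apply: measurable_funD; first exact: measurable_cst.
by apply: measurable_funX; exact: measurable_enorm2.
Qed.

Lemma measurable_weight g : measurable_fun setT g -> measurable_fun setT (weight g).
Proof.
move=> mg; apply: measurable_funM; first by apply: measurable_funX; exact: measurable_jbracket.
exact: measurableT_comp.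
Qed.

Lemma weight_ge0 g y : 0 <= weight g y.
Proof. by rewrite mulr_ge0// exprn_ge0// ltW// jbracket_gt0. Qed.

Lemma good_ge0 M g : good M g -> 0 <= M.
Proof.
move=> [_ h _]; rewrite -lee_fin; apply: le_trans h.
by apply: integral_ge0 => y _; rewrite lee_fin weight_ge0.
Qed.

Lemma in_L1Linf_good M g : measurable_fun setT g ->
  (wnorm 1 2 g + wnorm +oo 2 g <= M%:E)%E -> good M g.
Proof.
move=> mg; rewrite /wnorm.
set f := fun y => (jbracket y ^+ 2 * g y)%:E.
have fE y : `|f y|%E = (weight g y)%:E.
  rewrite /f /= normrM ger0_norm// exprn_ge0// ltW//; exact: jbracket_gt0.
move=> h.
have n1 : (0 <= Lnorm (leb2 R) 1 f)%E by exact: Lnorm_ge0.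
have n2 : (0 <= Lnorm (leb2 R) +oo f)%E by exact: Lnorm_ge0.
have h1 : (Lnorm (leb2 R) 1 f <= M%:E)%E by apply: le_trans h; rewrite leeDl.
have h2 : (Lnorm (leb2 R) +oo f <= M%:E)%E by apply: le_trans h; rewrite leeDr.
split=> //.
  move: h1; rewrite Lnorm1; under eq_integral do rewrite fE; by [].
move: h2; rewrite unlock /Lnorm; case: ifPn => [_|].
  by move=> /ess_supP; apply: filterS => y /=; rewrite -lee_fin -fE.
(* This branch of the definition of [Lnorm] assumes that the whole space is null, and then
   everything holds almost everywhere. *)
rewrite -leNgt => m0 _; exists setT; split=> //.
by apply/eqP; rewrite eq_le m0/=.
Qed.

(** Off S the kernel is bounded and the weighted L^1 norm of g is used; on S the kernel is
    integrable and the weighted L^oo norm is used. *)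
Lemma weight_integral_bound M g (c : R) (k : P -> R) (S : set P) (B : R) : good M g ->
  measurable_fun setT k -> 0 <= c -> measurable S ->
  (forall y, 0 <= k y) -> (forall y, ~ S y -> k y <= c) ->
  (\int[leb2 R]_y (k y * \1_S y)%:E <= B%:E)%E ->
  (\int[leb2 R]_y (k y * weight g y)%:E <= (M * (c + B))%:E)%E.
Proof.
move=> gg mk c0 mS k0 kS kB; have M0 := good_ge0 gg; have [mg h1 h2] := gg.
have mw := measurable_weight mg.
have m1 : measurable_fun setT (fun y => c * weight g y).
  by apply: measurable_funM => //; exact: measurable_cst.
have mkS : measurable_fun setT (fun y => k y * \1_S y).
  by apply: measurable_funM => //; exact: measurable_indic.
have m2 : measurable_fun setT (fun y => M * (k y * \1_S y)).
  by apply: measurable_funM => //; exact: measurable_cst.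
apply: (@le_trans _ _ (\int[leb2 R]_y ((c * weight g y)%:E + (M * (k y * \1_S y))%:E))%E).
  apply: ae_ge0_le_integral => //.
  - by move=> y _; rewrite lee_fin mulr_ge0// weight_ge0.
  - by apply/measurable_EFinP; apply: measurable_funM.
  - move=> y _; rewrite -EFinD lee_fin; apply: addr_ge0; apply: mulr_ge0 => //.
      exact: weight_ge0.
    exact: mulr_ge0.
  - by apply: emeasurable_funD; exact/measurable_EFinP.
  apply: filterS h2 => y wM _; rewrite -EFinD lee_fin indicE.
  have [yS|yS] := boolP (y \in S); last first.
    rewrite !mulr0 addr0 ler_wpM2r ?weight_ge0// kS//; by move: yS; rewrite notin_setE.
  rewrite mulr1 [leLHS]mulrC; apply: (@le_trans _ _ (M * k y)); first by rewrite ler_wpM2r.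
  by rewrite lerDr mulr_ge0// weight_ge0.
rewrite ge0_integralD//; last 4 first.
- by move=> y _; rewrite lee_fin mulr_ge0// weight_ge0.
- exact/measurable_EFinP.
- by move=> y _; rewrite lee_fin !mulr_ge0.
- exact/measurable_EFinP.
rewrite mulrDr EFinD mulrC; apply: leeD.
  apply: (ge0_scale_leb2 m1 mw c0 _ _ h1) => y; last exact: weight_ge0.
  by rewrite lexx andbT mulr_ge0// weight_ge0.
apply: (ge0_scale_leb2 m2 mkS M0 _ _ kB) => y; last by rewrite mulr_ge0.
by rewrite lexx andbT !mulr_ge0.
Qed.

Lemma integral_nker_weight M g N x : good M g ->
  (\int[leb2 R]_y (nker N x y * weight g y)%:E <= (M * (17 * N.+1%:R * 2^-1 ^+ N))%:E)%E.
Proof.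
move=> gg; have h0 : (0 : R) <= 2^-1 ^+ N by rewrite exprn_ge0.
have [m1 _] := leb2_ball x ler01.
have d y : ~ [set y | `|x - y| <= 1] y -> `|x - y|^-1 <= 1.
  by move=> /= /negP; rewrite -ltNge => h; rewrite invf_le1 ?ltW// (lt_trans ltr01).
have := weight_integral_bound gg (measurable_nker N x) h0 m1 (nker_ge0 N x) _ (integral_nker N x).
move=> H; apply: le_trans (H _) _.
  move=> y /d yd; rewrite /nker ge_min; apply/orP; left.
  rewrite ler_piMr// exprn_ile1 ?invr_ge0//.
rewrite lee_fin ler_wpM2l ?(good_ge0 gg)//.
have : 1 <= N.+1%:R :> R by rewrite ler1n.
by nra.
Qed.

Lemma integral_newton_weight M g x : good M g ->
  (\int[leb2 R]_y (`|x - y|^-1 * weight g y)%:E <= (M * 17)%:E)%E.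
Proof.
move=> gg.
have [m1 _] := leb2_ball x ler01.
have d y : ~ [set y | `|x - y| <= 1] y -> `|x - y|^-1 <= 1.
  by move=> /= /negP; rewrite -ltNge => h; rewrite invf_le1 ?ltW// (lt_trans ltr01).
(* At N = 0 and inside the unit ball the minimum in [nker] is the Newton kernel itself, as 1/|x-y|
   <= 1/|x-y|^2 there. *)
have i := integral_nker 0 x; rewrite expr0 mulr1 mulr1 in i.
rewrite (_ : 17 = 1 + 16); last by ring.
have mi := measurable_invdist x.
apply: (weight_integral_bound gg mi ler01 m1) => //.
apply: le_trans i; apply: ge0_le_integral => //.
- by apply/measurable_EFinP; apply: measurable_funM => //; exact: measurable_indic.
- apply/measurable_EFinP; apply: measurable_funM; first exact: measurable_nker.
  exact: measurable_indic.
move=> y _; rewrite lee_fin indicE.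
have [|] := boolP (y \in _); last by rewrite !mulr0.
rewrite inE/= => yx; rewrite !mulr1 /nker expr0 mul1r.
have [->|d0] := eqVneq `|x - y| 0; first by rewrite invr0 expr0n/= minxx.
have i1 : 1 <= `|x - y|^-1 by rewrite invf_ge1// lt0r d0/=.
by rewrite le_min lexx andbT expr2 ler_peMl// (le_trans ler01).
Qed.


Lemma measurable_kcomp_r i x : measurable_fun setT (kcomp i x).
Proof.
apply: measurable_funM; first exact: measurable_cst.
apply: (@measurable_Rintegral _ _ P (measurableTypeR R) R (leb1 R)
  (fun z => kint i x z.1 z.2)).
by apply: measurable_kint => //; exact: measurable_cst.
Qed.

Lemma ae_ge0_scale_leb2 (f h : P -> R) (c C : R) : measurable_fun setT f ->
  measurable_fun setT h -> (forall y, 0 <= f y) -> (forall y, 0 <= h y) -> 0 <= c ->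
  {ae leb2 R, forall y, f y <= c * h y} ->
  (\int[leb2 R]_y (h y)%:E <= C%:E)%E ->
  (\int[leb2 R]_y (f y)%:E <= (c * C)%:E)%E.
Proof.
move=> mf mh f0 h0 c0 fh hC.
have mch : measurable_fun setT (fun y => c * h y).
  by apply: measurable_funM => //; exact: measurable_cst.
have ch0 y : 0 <= c * h y by rewrite mulr_ge0.
apply: (@le_trans _ _ (\int[leb2 R]_y (c * h y)%:E)%E).
  apply: ae_ge0_le_integral => //.
  - by move=> y _; rewrite lee_fin.
  - exact/measurable_EFinP.
  - by move=> y _; rewrite lee_fin.
  - exact/measurable_EFinP.
  - by apply: filterS fh => y ? _; rewrite lee_fin.
by apply: (ge0_scale_leb2 mch mh c0 _ h0 hC) => y; rewrite lexx ch0.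
Qed.

Lemma ae_integral_bound (f h : P -> R) (C : R) : measurable_fun setT f -> measurable_fun setT h ->
  {ae leb2 R, forall y, `|f y| <= h y} -> (forall y, 0 <= h y) ->
  (\int[leb2 R]_y (h y)%:E <= C%:E)%E ->
  (leb2 R).-integrable setT (EFin \o f) /\ `|\int[leb2 R]_y f y| <= C.
Proof.
move=> mf mh fh h0 hC.
have b : (\int[leb2 R]_y (`|f y|)%:E <= C%:E)%E.
  apply: le_trans hC; apply: ae_ge0_le_integral => //.
  - by apply/measurable_EFinP; exact: measurableT_comp.
  - by move=> y _; rewrite lee_fin.
  - exact/measurable_EFinP.
  - by apply: filterS fh => y ? _; rewrite lee_fin.
apply: (integral_bound_leb2 mf _ _ b) => //.
exact: measurableT_comp.
Qed.

Definition ucomp i g x : R := \int[leb2 R]_y (kcomp i x y * g y).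

Lemma ucompE i g x : comp i (helU g x) = ucomp i g x.
Proof.
by elim/ord3_ind: i; rewrite /comp /=; apply: eq_Rintegral => y _; rewrite -kcompE.
Qed.

Lemma weightE g y : weight g y = jbracket y * jbracket y * `|g y|.
Proof. by rewrite /weight expr2. Qed.

Lemma cU_ge0 : 0 <= cU R.
Proof. by rewrite unlock ler0n. Qed.

Lemma cL_ge0 : 0 <= cL R.
Proof. by rewrite unlock ler0n. Qed.

(** The growth <y> [jmin x y] of the kernel is at most <y>^2, exactly the weight available for m =
    2, so the bound is uniform in x. *)
Lemma ucomp_bound M g i x : good M g ->
  (leb2 R).-integrable setT (fun y => (kcomp i x y * g y)%:E) /\
  `|ucomp i g x| <= cU R * M.
Proof.
move=> gg; have [mg _ _] := gg; have mw := measurable_weight mg.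
have mA := measurable_invdist x.
have mAw : measurable_fun setT (fun y => `|x - y|^-1 * weight g y) by exact: measurable_funM.
apply: (@ae_integral_bound _ (fun y => 32 * (`|x - y|^-1 * weight g y))) => //.
- by apply: measurable_funM => //; exact: measurable_kcomp_r.
- by apply: measurable_funM => //; exact: measurable_cst.
- apply: filterS (ae_neq x) => y xy; rewrite normrM.
  apply: (le_trans (ler_wpM2r (normr_ge0 _) (kcomp_bound i xy))).
  have jm : jmin x y <= jbracket y by rewrite ge_min lexx orbT.
  rewrite weightE.
  have -> : 32 * (`|x - y|^-1 * (jbracket y * jbracket y * `|g y|)) =
    32 * jbracket y * jbracket y * `|x - y|^-1 * `|g y| by ring.
  rewrite ler_wpM2r// ler_wpM2r ?invr_ge0// ler_wpM2l// mulr_ge0// ltW//.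
  exact: jbracket_gt0.
- by move=> y; apply: mulr_ge0 => //; apply: mulr_ge0; [rewrite invr_ge0|exact: weight_ge0].
(* The 32 comes from the kernel bound; 17 is 16 for the unit ball plus 1 for its complement. *)
have -> : cU R * M = 32 * (M * 17) by rewrite unlock; ring.
have w0 y : 0 <= `|x - y|^-1 * weight g y.
  by apply: mulr_ge0; [rewrite invr_ge0|exact: weight_ge0].
apply: (ge0_scale_leb2 _ mAw _ _ _ (integral_newton_weight x gg)) => //.
- by apply: measurable_funM => //; exact: measurable_cst.
- by move=> y; rewrite lexx andbT mulr_ge0.
Qed.

(** Separates the singularities at the two points: a minimum of sums is controlled by a sum of two
    [nker] profiles. The larger of the two inverse distances suffices. *)
Lemma min_sum_le (d al be : R) : 0 <= d -> 0 <= al -> 0 <= be ->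
  Num.min (al + be) (d * (al ^+ 2 + be ^+ 2)) <=
  2 * (Num.min (d * al ^+ 2) al + Num.min (d * be ^+ 2) be).
Proof.
move=> d0.
wlog ab : al be / be <= al.
  move=> W a0 b0; have [ba|/ltW ab] := leP be al; first exact: W.
  by rewrite [al + be]addrC [al ^+ 2 + _]addrC [X in 2 * X]addrC W.
move=> a0 b0.
have m0 : 0 <= Num.min (d * be ^+ 2) be.
  by rewrite le_min b0 mulr_ge0// sqr_ge0.
apply: (@le_trans _ _ (2 * Num.min (d * al ^+ 2) al)); last by rewrite ler_wpM2l// lerDl.
have b2 : be ^+ 2 <= al ^+ 2 by rewrite ler_pXn2r.
have [h|h] := leP (d * al ^+ 2) al; rewrite ge_min.
  apply/orP; right; have := ler_wpM2l d0 b2; lra.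
by apply/orP; left; lra.
Qed.

(** The difference of the kernels obeys both the size bound and the Lipschitz bound; the smaller of
    the two is a sum of [nker] at x and at x', whose integrals produce (N+1) 2^-N. Replacing [jmin]
    by J keeps the weight at <y>^2 and makes the bound local in x. *)
Lemma ucomp_log_lipschitz M g i x x' N (J : R) : good M g -> 1 <= J ->
  jbracket x <= J -> jbracket x' <= J -> `|x - x'| <= 2^-1 ^+ N ->
  `|ucomp i g x - ucomp i g x'| <= cL R * J ^+ 2 * M * (N.+1%:R * 2^-1 ^+ N).
Proof.
move=> gg J1 xJ x'J xx'; have [mg _ _] := gg; have mw := measurable_weight mg.
have d0 : (0 : R) <= 2^-1 ^+ N by rewrite exprn_ge0.
have [i1 _] := ucomp_bound i x gg; have [i2 _] := ucomp_bound i x' gg.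
rewrite /ucomp -(RintegralB _ i1 i2)//; clear i1 i2.
have J0 : 0 <= J by apply: le_trans J1.
have [c cE] : exists c : R, c = 160 * J ^+ 2 by eexists.
have c0 : 0 <= c by rewrite cE mulr_ge0 ?ler0n ?exprn_ge0.
have c20 : 0 <= 2 * c by rewrite mulr_ge0.
have mn z : measurable_fun setT (fun y => nker N z y * weight g y).
  by apply: measurable_funM => //; exact: measurable_nker.
have n0 z y : 0 <= nker N z y * weight g y.
  by apply: mulr_ge0; [exact: nker_ge0|exact: weight_ge0].
pose h y := nker N x y * weight g y + nker N x' y * weight g y.
have mh : measurable_fun setT h by exact: measurable_funD.
have h0 y : 0 <= h y by rewrite addr_ge0.
refine (proj2 (@ae_integral_bound _ (fun y => 2 * c * h y) _ _ _ _ _ _)) => //.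
- by apply: measurable_funB; apply: measurable_funM => //; exact: measurable_kcomp_r.
- by apply: measurable_funM => //; exact: measurable_cst.
- apply: filterS2 (ae_neq x) (ae_neq x') => y xy x'y; rewrite -mulrBl normrM.
  have j0 := jbracket_gt0 y; have j1 := jbracket_ge1 y.
  have p z : z != y -> jbracket z <= J ->
      0 <= jmin z y * `|z - y|^-1 /\ jmin z y * `|z - y|^-1 <= J * `|z - y|^-1.
    move=> zy zJ; have jm0 := jmin_gt0 z y.
    have i0 : 0 <= `|z - y|^-1 by rewrite invr_ge0.
    split; first by rewrite mulr_ge0// ltW.
    by rewrite ler_wpM2r// (le_trans _ zJ)// /jmin ge_min lexx.
  have [p0 p1] := p x xy xJ; have [q0 q1] := p x' x'y x'J.
  set al := `|x - y|^-1; set be := `|x' - y|^-1.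
  have al0 : 0 <= al by rewrite invr_ge0.
  have be0 : 0 <= be by rewrite invr_ge0.
  have JJ : J <= J ^+ 2 by rewrite expr2 ler_peMl.
  (* The size bound fits the constant c of the Lipschitz bound because 32 J <= 160 J^2. *)
  have b1 : `|kcomp i x y - kcomp i x' y| <= c * jbracket y * (al + be).
    rewrite cE; apply: (le_trans (ler_normB _ _)); rewrite mulrDr; apply: lerD.
      apply: (le_trans (kcomp_bound i xy)); rewrite -mulrA.
      apply: (@le_trans _ _ (32 * jbracket y * (J * al))); first by rewrite ler_wpM2l ?mulr_ge0// ltW.
      have := ler_wpM2r al0 JJ => JJa; have := mulr_ge0 J0 al0 => Ja0.
      have := ler_wpM2l (ltW j0) JJa; have := mulr_ge0 (ltW j0) Ja0; lra.
    apply: (le_trans (kcomp_bound i x'y)); rewrite -mulrA.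
    apply: (@le_trans _ _ (32 * jbracket y * (J * be))); first by rewrite ler_wpM2l ?mulr_ge0// ltW.
    have := ler_wpM2r be0 JJ => JJa; have := mulr_ge0 J0 be0 => Ja0.
    have := ler_wpM2l (ltW j0) JJa; have := mulr_ge0 (ltW j0) Ja0; lra.
  have b2 : `|kcomp i x y - kcomp i x' y| <=
      c * jbracket y * (2^-1 ^+ N * (al ^+ 2 + be ^+ 2)).
    rewrite cE; apply: (le_trans (kcomp_lipschitz i xy x'y)).
    have s1 : (jmin x y * al) ^+ 2 <= (J * al) ^+ 2 by rewrite ler_pXn2r// nnegrE mulr_ge0.
    have s2 : (jmin x' y * be) ^+ 2 <= (J * be) ^+ 2 by rewrite ler_pXn2r// nnegrE mulr_ge0.
    rewrite [leRHS](_ : _ = (160 * jbracket y * 2^-1 ^+ N) * ((J * al) ^+ 2 + (J * be) ^+ 2)); last by ring.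
    apply: ler_pM; [by rewrite !mulr_ge0// ltW|by rewrite addr_ge0// sqr_ge0| |exact: lerD].
    by rewrite ler_wpM2l// mulr_ge0// ltW.
  have c1 : 0 <= c * jbracket y by rewrite mulr_ge0// ltW.
  have b3 : `|kcomp i x y - kcomp i x' y| <=
      c * jbracket y * Num.min (al + be) (2^-1 ^+ N * (al ^+ 2 + be ^+ 2)).
    by rewrite /Num.min; case: ifP.
  have b4 := le_trans b3 (ler_wpM2l c1 (min_sum_le d0 al0 be0)).
  apply: (le_trans (ler_wpM2r (normr_ge0 (g y)) b4)).
  rewrite /h -mulrDl -/(nker N x y) -/(nker N x' y) weightE.
  have nn : 0 <= nker N x y + nker N x' y by apply: addr_ge0; exact: nker_ge0.
  rewrite [leLHS](_ : _ = 2 * c * ((nker N x y + nker N x' y) * (jbracket y * `|g y|))); last by ring.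
  rewrite ler_wpM2l// ler_wpM2l// ler_wpM2r// ler_peMl// ltW//.
- by move=> y; exact: mulr_ge0.
rewrite (_ : cL R * _ * _ * _ = 2 * c * (M * (17 * N.+1%:R * 2^-1 ^+ N) + M * (17 * N.+1%:R * 2^-1 ^+ N))); last by rewrite cE unlock; ring.
apply: (ge0_scale_leb2 _ mh c20) => //.
- by apply: measurable_funM => //; exact: measurable_cst.
- by move=> y; rewrite lexx andbT mulr_ge0.
under eq_integral do rewrite EFinD.
rewrite ge0_integralD//; first by rewrite EFinD leeD// integral_nker_weight.
- by move=> y _; rewrite lee_fin.
- by apply/measurable_EFinP; exact: mn.
- by move=> y _; rewrite lee_fin.
- by apply/measurable_EFinP; exact: mn.
Qed.

End Field.

(** * The velocity field *)

Section Velocity.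
Variable R : realType.
Local Notation P := (R * R)%type.
Implicit Types (x y : P) (g : P -> R) (M : R).

Lemma norm_fst x : `|x.1| <= `|x|.
Proof. by rewrite [leRHS]/Num.norm/= le_max lexx. Qed.

Lemma norm_snd x : `|x.2| <= `|x|.
Proof. by rewrite [leRHS]/Num.norm/= le_max lexx orbT. Qed.

Lemma norm_le_jbracket x : `|x| <= jbracket x.
Proof.
have [h1 h2] := abs_le_jbracket x.
have -> : `|x| = Num.max `|x.1| `|x.2| by [].
by rewrite ge_max h1.
Qed.

Lemma jbracket_le_norm x : jbracket x <= 1 + 2 * `|x|.
Proof.
rewrite -(@ler_pXn2r _ 2) ?nnegrE ?addr_ge0 ?mulr_ge0//; last by rewrite ltW// jbracket_gt0.
rewrite jbracket_sqr /n2.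
have := norm_fst x; have := norm_snd x.
rewrite -(@real_normK _ x.1) ?num_real// -(@real_normK _ x.2) ?num_real//.
have := normr_ge0 x.1; have := normr_ge0 x.2; nra.
Qed.

Lemma helH1E g x : (helH g x).1 = ucomp 0 g x - x.2 * ucomp 2%:R g x.
Proof. rewrite -!ucompE /helH; move: (helU g x) => [[u1 u2] u3].
by rewrite /comp/= /GRing.scale/=; ring. Qed.

Lemma helH2E g x : (helH g x).2 = ucomp 1 g x + x.1 * ucomp 2%:R g x.
Proof. rewrite -!ucompE /helH; move: (helU g x) => [[u1 u2] u3].
by rewrite /comp/= /GRing.scale/=; ring. Qed.

Lemma helH_bound M g x : good M g -> `|helH g x| <= cU R * M * (1 + `|x|).
Proof.
move=> gg; have b i := proj2 (ucomp_bound i x gg); have M0 := good_ge0 gg.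
have -> : `|helH g x| = Num.max `|(helH g x).1| `|(helH g x).2| by [].
rewrite ge_max helH1E helH2E mulrDr mulr1; apply/andP; split.
  apply: (le_trans (ler_normB _ _)); rewrite lerD// normrM mulrC.
  by apply: ler_pM => //; exact: norm_snd.
apply: (le_trans (ler_normD _ _)); rewrite lerD// normrM mulrC.
by apply: ler_pM => //; exact: norm_fst.
Qed.

Lemma helH_log_lipschitz M g x x' N (B : R) : good M g -> `|x| <= B -> `|x'| <= B ->
  `|x - x'| <= 2^-1 ^+ N ->
  `|helH g x - helH g x'| <=
    (cL R * (1 + 2 * B) ^+ 2 * (1 + B) + cU R) * M * (N.+1%:R * 2^-1 ^+ N).
Proof.
move=> gg xB x'B xx'; have M0 := good_ge0 gg.
have B0 : 0 <= B by apply: le_trans xB.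
have J1 : 1 <= 1 + 2 * B by rewrite lerDl mulr_ge0.
have xJ z : `|z| <= B -> jbracket z <= 1 + 2 * B.
  by move=> zB; apply: le_trans (jbracket_le_norm z) _; rewrite lerD2l ler_wpM2l.
have l i := ucomp_log_lipschitz i gg J1 (xJ x xB) (xJ x' x'B) xx'.
have b i := proj2 (ucomp_bound i x' gg).
set d := 2^-1 ^+ N in xx' l *; have d0 : 0 <= d by rewrite exprn_ge0.
have n1 : 1 <= N.+1%:R :> R by rewrite ler1n.
have c1 := cU_ge0 R; have c2 := cL_ge0 R.
set D := cL R * (1 + 2 * B) ^+ 2 * M * (N.+1%:R * d) in l *.
have D0 : 0 <= D by apply: mulr_ge0; apply: mulr_ge0 => //; apply: mulr_ge0 => //; exact: sqr_ge0.
have key (p p' u0 u0' u2 u2' : R) : `|p| <= B -> `|p - p'| <= d -> `|u0 - u0'| <= D ->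
    `|u2 - u2'| <= D -> `|u2'| <= cU R * M ->
    `|(u0 + p * u2) - (u0' + p' * u2')| <=
     (cL R * (1 + 2 * B) ^+ 2 * (1 + B) + cU R) * M * (N.+1%:R * d).
  move=> pB pd h0 h2 hb.
  have -> : (u0 + p * u2) - (u0' + p' * u2') =
     (u0 - u0') + p * (u2 - u2') + (p - p') * u2' by ring.
  have -> : (cL R * (1 + 2 * B) ^+ 2 * (1 + B) + cU R) * M * (N.+1%:R * d) =
    D + B * D + N.+1%:R * d * (cU R * M) by rewrite /D; ring.
  apply: (le_trans (ler_normD _ _)); apply: lerD.
    by apply: (le_trans (ler_normD _ _)); apply: lerD => //; rewrite normrM; apply: ler_pM.
  rewrite normrM; apply: ler_pM => //; apply: le_trans pd _.
  by rewrite ler_peMl.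
have -> : `|helH g x - helH g x'| =
  Num.max `|(helH g x).1 - (helH g x').1| `|(helH g x).2 - (helH g x').2| by [].
have p1 : `|- x.2| <= B by rewrite normrN; apply: le_trans xB; exact: norm_snd.
have p2 : `|- x.2 - - x'.2| <= d.
  by rewrite -opprD normrN; apply: le_trans xx'; exact: (norm_snd (x - x')).
have q1 : `|x.1| <= B by apply: le_trans xB; exact: norm_fst.
have q2 : `|x.1 - x'.1| <= d by apply: le_trans xx'; exact: (norm_fst (x - x')).
have K1 := key _ _ _ _ _ _ p1 p2 (l 0) (l 2%:R) (b 2%:R).
have K2 := key _ _ _ _ _ _ q1 q2 (l 1) (l 2%:R) (b 2%:R).
rewrite ge_max !helH1E !helH2E; apply/andP; split; last exact: K2.
by rewrite !mulNr in K1.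
Qed.

(** The part of the field along (-x_2, x_1) is orthogonal to x, so only the horizontal velocity
    moves |x|^2. *)
Lemma dot_helH g x : dot2 x (helH g x) = x.1 * ucomp 0 g x + x.2 * ucomp 1 g x.
Proof.
rewrite /dot2 helH1E helH2E.
by move: (ucomp 0 g x) (ucomp 1 g x) (ucomp 2%:R g x) => a b c; ring.
Qed.

Definition radial_int x y (a : R) : R := x.1 * kint 0 x y a + x.2 * kint 1 x y a.

(** The distance is invariant under (x, y, a) -> (y, x, -a), and the numerator is odd under the same
    exchange. *)
Lemma radial_int_antisym x y a : radial_int x y a = - radial_int y x (- a).
Proof.
have e : hdist y x (- a) = hdist x y a by rewrite /hdist (hdist2C x y a).
rewrite /radial_int/kint/comp/= /helK_integrand !enorm3_hdist e /cross/xi/=.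
rewrite cosN sinN; rewrite /GRing.scale/=; ring.
Qed.

Lemma integral_reflect (f : R -> R) : measurable_fun setT f ->
  (leb1 R).-integrable setT (EFin \o f) ->
  \int[leb1 R]_a f (- a) = \int[leb1 R]_a f a.
Proof.
move=> mf fi; pose phi : measurableTypeR R -> measurableTypeR R := -%R.
have mphi : measurable_fun setT phi by exact: oppr_measurable.
pose F : measurableTypeR R -> \bar R := fun a => (f (- a))%:E.
have Fphi : F \o phi = EFin \o f by apply/funext => a; rewrite /F /phi /= opprK.
have mF : measurable_fun setT F.
  by apply/measurable_EFinP; apply: (measurableT_comp mf); exact: oppr_measurable.
have H : (\int[pushforward (leb1 R) phi]_(y in setT) F y =
    \int[leb1 R]_(x in phi @^-1` setT) (F \o phi) x)%E.
  by apply: integral_pushforward => //; rewrite Fphi preimage_setT.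
rewrite Fphi preimage_setT in H; congr fine; rewrite -[RHS]H.
apply: eq_measure_integral => A mA _; exact/esym/lebesgue_measureN.
Qed.

Definition radial x y : R := x.1 * kcomp 0 x y + x.2 * kcomp 1 x y.

Lemma radial_antisym x y : x != y -> radial x y = - radial y x.
Proof.
move=> xy; have yx : y != x by rewrite eq_sym.
have E u v : u != v -> radial u v = - (4 * pi)^-1 * \int[leb1 R]_a radial_int u v a.
  move=> uv; have i i := integrable_kint i uv.
  have z (c : R) k : (leb1 R).-integrable setT (EFin \o (fun a => c * kint k u v a)).
    by have := integrableZl measurableT c (i k).
  rewrite /radial_int RintegralD// RintegralZl// RintegralZl// /radial /kcomp; ring.
rewrite !E// -mulrN; congr (_ * _).
transitivity (\int[leb1 R]_a (- radial_int y x (- a))).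
  by apply: eq_Rintegral => a _; exact: radial_int_antisym.
have m : measurable_fun setT (radial_int y x).
  by apply: measurable_funD; apply: measurable_funM => //; first [exact: measurable_cst|exact: measurable_kint1].
have i : (leb1 R).-integrable setT (EFin \o radial_int y x).
  have z (c : R) k : (leb1 R).-integrable setT (EFin \o (fun a => c * kint k y x a)).
    by have := integrableZl measurableT c (integrable_kint k yx).
  have := integrableD measurableT (z y.1 0) (z y.2 1).
  by apply: eq_integrable => // a _; rewrite /= -EFinD.
rewrite (@integral_reflect (fun a => - radial_int y x a))//.
- under eq_Rintegral do rewrite -mulN1r.
  by rewrite RintegralZl// mulN1r.
- exact: measurableT_comp.
- exact: (integrableN i).
Qed.

Lemma radial_bound x y : x != y ->
  `|radial x y| <= 64 * `|x| * jbracket y ^+ 2 * `|x - y|^-1.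
Proof.
move=> xy; have k i := kcomp_bound i xy.
have j0 := jbracket_gt0 y; have i0 : 0 <= `|x - y|^-1 by rewrite invr_ge0.
have jm : jmin x y <= jbracket y by rewrite ge_min lexx orbT.
have b i : `|kcomp i x y| <= 32 * (jbracket y ^+ 2 * `|x - y|^-1).
  apply: (le_trans (k i)); rewrite expr2 !mulrA ler_wpM2r// ler_wpM2l//.
  by rewrite mulr_ge0 ?ler0n// ltW.
apply: (le_trans (ler_normD _ _)); rewrite (normrM x.1) (normrM x.2).
have -> : 64 * `|x| * jbracket y ^+ 2 * `|x - y|^-1 =
  `|x| * (32 * (jbracket y ^+ 2 * `|x - y|^-1)) + `|x| * (32 * (jbracket y ^+ 2 * `|x - y|^-1)) by ring.
by apply: lerD; apply: ler_pM => //; [exact: norm_fst|exact: norm_snd].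
Qed.

Lemma measurable_radial : measurable_fun setT (fun z : P * P => radial z.1 z.2).
Proof.
have m1 : measurable_fun setT (fun z : P * P => z.1.1) by exact: (measurableT_comp measurable_fst).
have m2 : measurable_fun setT (fun z : P * P => z.1.2) by exact: (measurableT_comp measurable_snd).
by apply: measurable_funD; apply: measurable_funM => //; exact: measurable_kcomp.
Qed.

(* Symmetrized so that the antisymmetry also holds on the diagonal, where the
   kernel is not integrable. *)
Definition aradial x y : R := (radial x y - radial y x) / 2.

Lemma aradialE x y : x != y -> aradial x y = radial x y.
Proof. by move=> xy; rewrite /aradial (radial_antisym xy); lra. Qed.

(** The integral is that of g(x) g(y) x.K(x,y), antisymmetric in (x, y), so Fubini shows that it
    equals its opposite. Absolute integrability holds since the inner integral is at most a multiple
    of M |x|, and |x| |g(x)| is at most the weighted density. *)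
Lemma radial_cancel M g : good M g ->
  \int[leb2 R]_x (g x * dot2 x (helH g x)) = 0.
Proof.
move=> gg; have [mg wM _] := gg; have M0 := good_ge0 gg.
pose f (z : P * P) : R := g z.1 * g z.2 * aradial z.1 z.2.
have mf : measurable_fun setT f.
  apply: measurable_funM.
    by apply: measurable_funM; [apply: (measurableT_comp mg)|apply: (measurableT_comp mg)].
  apply: measurable_funM; last exact: measurable_cst.
  apply: measurable_funB; first exact: measurable_radial.
  apply: (measurableT_comp (f := fun z : P * P => radial z.1 z.2) (g := fun z : P * P => (z.2, z.1))).
    exact: measurable_radial.
  by apply: measurable_fun_pair.
have mr x : measurable_fun setT (radial x).
  by apply: measurable_funD; apply: measurable_funM => //; first [exact: measurable_cst|exact: measurable_kcomp_r].
have inner x : (leb2 R).-integrable setT (EFin \o (fun y => radial x y * g y)) /\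
    dot2 x (helH g x) = \int[leb2 R]_y (radial x y * g y).
  have u i := proj1 (ucomp_bound i x gg).
  have z (c : R) i : (leb2 R).-integrable setT (EFin \o (fun y => c * (kcomp i x y * g y))).
    by have := integrableZl measurableT c (u i).
  split.
    have -> : EFin \o (fun y => radial x y * g y) = (fun y =>
        (x.1 * (kcomp 0 x y * g y))%:E + (x.2 * (kcomp 1 x y * g y))%:E)%E.
      by apply/funext => y; rewrite /= -EFinD /radial; congr EFin; ring.
    exact: (integrableD measurableT (z x.1 0) (z x.2 1)).
  rewrite dot_helH /ucomp -(RintegralZl x.1 measurableT (u 0)).
  rewrite -(RintegralZl x.2 measurableT (u 1)) -(RintegralD measurableT (z x.1 0) (z x.2 1)).
  by apply: eq_Rintegral => y _; rewrite /radial; ring.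
have mar x : measurable_fun setT (aradial x).
  apply: measurable_funM; last exact: measurable_cst.
  apply: measurable_funB => //.
  apply: (measurableT_comp (f := fun z : P * P => radial z.1 z.2) (g := fun y : P => (y, x))).
    exact: measurable_radial.
  by apply: measurable_fun_pair => //; exact: measurable_cst.
have mag x : measurable_fun setT (fun y => aradial x y * g y) by exact: measurable_funM.
have aex x : ae_eq (leb2 R) setT (EFin \o (fun y => radial x y * g y))
    (EFin \o (fun y => aradial x y * g y)).
  by apply: filterS (ae_neq x) => y xy _; rewrite /= aradialE.
have mrg x : measurable_fun setT (fun y => radial x y * g y) by exact: measurable_funM.
have innerE x : dot2 x (helH g x) = \int[leb2 R]_y (aradial x y * g y).
  have [_ ->] := inner x; congr fine; apply: ae_eq_integral => //.
  - by apply/measurable_EFinP; exact: mrg.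
  - by apply/measurable_EFinP; exact: mag.
  - exact: aex.
have w0 x y : 0 <= `|x - y|^-1 * weight g y.
  by apply: mulr_ge0; [rewrite invr_ge0|exact: weight_ge0].
have mw := measurable_weight mg.
have mAw x : measurable_fun setT (fun y => `|x - y|^-1 * weight g y).
  by apply: measurable_funM => //; exact: measurable_invdist.
have agb x : {ae leb2 R, forall y, `|aradial x y * g y| <= 64 * `|x| * (`|x - y|^-1 * weight g y)}.
  apply: filterS (ae_neq x) => y xy; rewrite normrM aradialE//.
  apply: (le_trans (ler_wpM2r (normr_ge0 _) (radial_bound xy))).
  by rewrite /weight le_eqVlt; apply/orP; left; apply/eqP; ring.
have x64 x : 0 <= 64 * `|x| by rewrite mulr_ge0.
have iag x : (leb2 R).-integrable setT (EFin \o (fun y => aradial x y * g y)).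
  apply: (proj1 (@ae_integral_bound _ _ (fun y => 64 * `|x| * (`|x - y|^-1 * weight g y))
    (64 * `|x| * (M * 17)) _ _ _ _ _)) => //.
  - by apply: measurable_funM => //; exact: measurable_cst.
  - by move=> y; rewrite mulr_ge0.
  apply: (ge0_scale_leb2 _ (mAw x) (x64 x) _ (w0 x) (integral_newton_weight x gg)).
  - by apply: measurable_funM => //; exact: measurable_cst.
  - by move=> y; rewrite lexx mulr_ge0.
pose r x := g x * dot2 x (helH g x).
have Fx x : (\int[leb2 R]_y (f (x, y))%:E = (r x)%:E)%E.
  rewrite /r innerE -RintegralZl// /Rintegral fineK; last first.
    apply: integrable_fin_num => //.
    exact: (integrableZl measurableT (g x) (iag x)).
  by apply: eq_integral => y _; rewrite /f /=; congr EFin; ring.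
have fanti x y : f (x, y) = - f (y, x).
  have -> : f (x, y) = g x * g y * aradial x y by [].
  have -> : f (y, x) = g y * g x * aradial y x by [].
  rewrite /aradial; move: (radial x y) (radial y x) => a b; ring.
have mfx x : measurable_fun setT (fun y => f (x, y)).
  have -> : (fun y => f (x, y)) = (fun y => g x * g y * aradial x y) by [].
  by apply: measurable_funM => //; apply: measurable_funM => //; exact: measurable_cst.
have Gy y : (\int[leb2 R]_x (f (x, y))%:E = (- r y)%:E)%E.
  have i : (leb2 R).-integrable setT (EFin \o (fun x => f (y, x))).
    apply: eq_integrable (integrableZl measurableT (g y) (iag y)) => //.
    by move=> x _; rewrite /f /= -EFinM; congr EFin; ring.
  rewrite EFinN -Fx -integralN; last by apply: integrable_add_def.
  by apply: eq_integral => x _; rewrite fanti.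
have inn x : (\int[leb2 R]_y (`|f (x, y)|)%:E <= (64 * (`|x| * `|g x|) * (M * 17))%:E)%E.
  apply: (@ae_ge0_scale_leb2 _ _ (fun y => `|x - y|^-1 * weight g y)) => //.
  - exact: (measurableT_comp (@normr_measurable R setT) (mfx x)).
  - apply: filterS (agb x) => y; rewrite normrM => h.
    rewrite /f/= normrM normrM -mulrA.
    have -> : 64 * (`|x| * `|g x|) * (`|x - y|^-1 * weight g y) =
       `|g x| * (64 * `|x| * (`|x - y|^-1 * weight g y)) by ring.
    by rewrite ler_wpM2l// mulrC.
  - exact: integral_newton_weight.
(* Here 1088 = 64 * 17. *)
have m64 x : 64 * (`|x| * `|g x|) * (M * 17) <= 1088 * M * weight g x.
  have -> : 64 * (`|x| * `|g x|) * (M * 17) = 1088 * M * (`|x| * `|g x|) by ring.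
  rewrite ler_wpM2l ?mulr_ge0 ?ler0n// /weight ler_wpM2r//.
  apply: (le_trans (norm_le_jbracket x)); rewrite expr2 ler_peMl//.
    by rewrite ltW// jbracket_gt0.
  exact: jbracket_ge1.
have fint : (plane R \x plane R)%E.-integrable setT (EFin \o f).
  have mef : measurable_fun setT (EFin \o f) by exact/measurable_EFinP.
  apply/(integrable12ltyP (plane R) (plane R) mef).
  apply: (@le_lt_trans _ _ (1088 * M * M)%:E); last exact: ltry.
  apply: (@le_trans _ _ (\int[leb2 R]_x (1088 * M * weight g x)%:E)%E).
    apply: ge0_le_integral => //.
    - by move=> x _; exact: integral_ge0.
    - have mab : measurable_fun setT (abse \o (EFin \o f)) by exact: (measurableT_comp _ mef).
      exact: (@measurable_fun_fubini_tonelli_F _ _ _ _ R (plane R) _ mab (fun z => abse_ge0 _)).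
    - by apply/measurable_EFinP; apply: measurable_funM => //; exact: measurable_cst.
    - move=> x _; apply: (le_trans (inn x)); rewrite lee_fin; exact: m64.
  apply: (ge0_scale_leb2 _ mw _ _ _ wM).
  - by apply: measurable_funM => //; exact: measurable_cst.
  - by rewrite mulr_ge0 ?ler0n.
  - move=> x; rewrite lexx andbT; apply: mulr_ge0; last exact: weight_ge0.
    by rewrite mulr_ge0 ?ler0n.
  - by move=> x; exact: weight_ge0.
have rint : (leb2 R).-integrable setT (EFin \o r).
  have := integrable_fubini_F fint.
  by apply: eq_integrable => // x _; rewrite /fubini_F Fx.
have e1 : (\int[leb2 R]_x (r x)%:E = \int[leb2 R]_x (- r x)%:E)%E.
  transitivity (\int[leb2 R]_x \int[leb2 R]_y (f (x, y))%:E)%E.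
    by apply: eq_integral => x _; rewrite Fx.
  apply: etrans (Fubini fint) _.
  by apply: eq_integral => y _; rewrite /= Gy.
have : \int[leb2 R]_x r x = - \int[leb2 R]_x r x.
  rewrite {1}/Rintegral e1 -[fine _]/(Rintegral _ _ _).
  by under eq_Rintegral do rewrite -mulN1r; rewrite RintegralZl// mulN1r.
rewrite /r; lra.
Qed.

End Velocity.

(** * Supports and bounds of elementary functions *)

Section Support.
Variable R : realType.
Local Notation P := (R * R)%type.
Local Notation V := (R * R * R)%type.
Implicit Types (f : V -> R) (u v : V) (B : R).

Definition box B u : Prop := [/\ `|u.1.1| <= B, `|u.1.2| <= B & `|u.2| <= B].

Lemma box_compact B : compact [set u | box B u].
Proof.
have -> : [set u | box B u] = ((`[-B, B] `*` `[-B, B]) `*` `[-B, B] : set V).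
  apply/seteqP; split=> [[[a b] c]|[[a b] c]]; rewrite /box/= !in_itv/= -!ler_norml.
    by move=> [? ? ?]; split; [split|].
  by move=> [[? ?] ?]; split.
by do 2 (apply: compact_setX; last exact: segment_compact); exact: segment_compact.
Qed.

Lemma elem_bounded_box f B : elem f -> exists K : R, 0 <= K /\ forall u, box B u -> `|f u| <= K.
Proof.
move=> ef; have [[u0 hu0]|ne] := pselect (exists u, box B u); last first.
  by exists 0; split=> // u bu; case: ne; exists u.
have cf : {within [set u | box B u], continuous (fun u => `|f u|)}.
  apply: continuous_subspaceT => u; apply: (@continuous_comp _ _ _ f (@Num.norm _ R)).
    exact: elem_continuous.
  exact: norm_continuous.
have [|c _ hc] := compact_EVT_max _ (box_compact (B := B)) cf; first by exists u0.
exists `|f c|; split=> // u bu; apply: hc; exact/mem_set.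
Qed.

Definition supported f B := forall u, f u != 0 -> box B u.

Lemma elem_bounded f B : elem f -> supported f B -> exists K : R, 0 <= K /\ forall u, `|f u| <= K.
Proof.
move=> ef sf; have [K [K0 hK]] := elem_bounded_box B ef; exists K; split=> // u.
by have [->|/sf/hK//] := eqVneq (f u) 0; rewrite normr0.
Qed.

Lemma derive_closed_support f (C : set V) v : closed C -> (forall u, f u != 0 -> C u) ->
  forall u, 'D_v f u != 0 -> C u.
Proof.
move=> cC sf u Du; have [//|nC] := pselect (C u); case/eqP: Du.
rewrite -(@derive_cst _ V R 0 u v); apply: near_eq_derive.
have : nbhs u (~` C) by apply: open_nbhs_nbhs; split => //; rewrite openC.
apply: filterS => z nz; apply/eqP; apply: contra_notT nz; exact: sf.
Qed.

Lemma derive_supported f B v : supported f B -> supported ('D_v f) B.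
Proof.
by apply: derive_closed_support; apply: compact_closed; [exact: norm_hausdorff|exact: box_compact].
Qed.

Lemma flat_exp_continuous (p : {poly R}) : continuous (flat_exp p).
Proof.
move=> x; apply: differentiable_continuous; apply/derivable1_diffP.
by have [] := is_derive_flat_exp p x.
Qed.

Lemma elem_measurable f : elem f -> measurable_fun setT f.
Proof.
elim=> {f} [c||||f g _ mf _ mg|f g _ mf _ mg|f _ mf _|p f _ mf].
- exact: measurable_cst.
- exact: (measurableT_comp measurable_fst measurable_fst).
- exact: (measurableT_comp measurable_snd measurable_fst).
- exact: measurable_snd.
- exact: measurable_funD.
- exact: measurable_funM.
- exact: measurable_funV.
- apply: (measurableT_comp (f := flat_exp p)) mf => //.
  by apply: continuous_measurable_fun; exact: flat_exp_continuous.
Qed.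

End Support.

Section WeightedIntegral.
Variable R : realType.
Local Notation P := (R * R)%type.

Lemma good_integral M (g G : P -> R) (K : R) : good M g -> measurable_fun setT G ->
  0 <= K -> (forall x, `|G x| <= K * jbracket x ^+ 2) ->
  (leb2 R).-integrable setT (EFin \o (fun x => g x * G x)) /\
  `|\int[leb2 R]_x (g x * G x)| <= K * M.
Proof.
move=> [mg wM _] mG K0 GK; have mw := measurable_weight mg.
have mKw : measurable_fun setT (fun x => K * weight g x).
  by apply: measurable_funM => //; exact: measurable_cst.
apply: (integral_bound_leb2 _ mKw).
- exact: measurable_funM.
- move=> x; rewrite normrM /weight mulrA mulrC; apply: ler_wpM2r => //; exact: GK.
apply: (ge0_scale_leb2 mKw mw K0 _ _ wM) => x; last exact: weight_ge0.
by rewrite lexx andbT; apply: mulr_ge0 => //; exact: weight_ge0.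
Qed.

Lemma jbracket2_ge1 (x : P) : 1 <= jbracket x ^+ 2.
Proof. by rewrite exprn_ege1// jbracket_ge1. Qed.

Lemma good_integral_bounded M (g G : P -> R) (K : R) : good M g -> measurable_fun setT G ->
  0 <= K -> (forall x, `|G x| <= K) ->
  (leb2 R).-integrable setT (EFin \o (fun x => g x * G x)) /\
  `|\int[leb2 R]_x (g x * G x)| <= K * M.
Proof.
move=> gg mG K0 GK; apply: good_integral => // x; apply: (le_trans (GK x)).
by rewrite ler_peMr// jbracket2_ge1.
Qed.

End WeightedIntegral.

(** * Increments of the weak formulation *)

Section Time.
Variable R : realType.
Local Notation P := (R * R)%type.
Local Notation V := (R * R * R)%type.
Variables (w : P -> R -> R) (T M : R).
Hypothesis mw : measurable_fun [set p : V | 0 <= p.2] (fun p => w p.1 p.2).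
Hypothesis gw : forall s, 0 <= s <= T -> good M (w ^~ s).
Hypothesis weakw : weak_formulation w.

(* Nothing is known of the measurability of w for t < 0. *)
Definition wext (p : V) : R := if 0 <= p.2 then w p.1 p.2 else 0.

Lemma measurable_wext : measurable_fun setT wext.
Proof.
have mD : measurable [set p : V | 0 <= p.2].
  rewrite (_ : [set p : V | _] = snd @^-1` `[0, +oo[%classic); last first.
    by apply/seteqP; split=> p /=; rewrite in_itv/= andbT.
  rewrite -[X in measurable X]setTI; exact: measurable_snd.
have -> : wext = (fun p => w p.1 p.2) \_ [set p : V | 0 <= p.2].
  by apply/funext => p; rewrite patchE /wext mem_setE; case: ifP.
exact/(measurable_restrictT _ mD).
Qed.

Definition wx (s : R) (x : P) : R := wext (x, s).

Lemma wxE s : 0 <= s -> wx s = w ^~ s.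
Proof. by move=> s0; apply/funext => x; rewrite /wx /wext /= s0. Qed.

Lemma measurable_ucomp i : measurable_fun setT (fun p : V => ucomp i (wx p.2) p.1).
Proof.
apply: (@measurable_Rintegral _ _ V _ R (plane R)
  (fun z => kcomp i z.1.1 z.2 * wext (z.2, z.1.2))).
apply: measurable_funM.
  apply: (measurableT_comp (f := fun z : P * P => kcomp i z.1 z.2)
    (g := fun z : V * P => (z.1.1, z.2))); first exact: measurable_kcomp.
  apply: measurable_fun_pair; last exact: measurable_snd.
  exact: (measurableT_comp measurable_fst measurable_fst).
apply: (measurableT_comp (f := wext) (g := fun z : V * P => (z.2, z.1.2))).
  exact: measurable_wext.
apply: measurable_fun_pair; first exact: measurable_snd.
exact: (measurableT_comp measurable_snd measurable_fst).
Qed.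

Lemma measurable_helH : measurable_fun setT (fun p : V => (helH (wx p.2) p.1).1) /\
  measurable_fun setT (fun p : V => (helH (wx p.2) p.1).2).
Proof.
have m11 : measurable_fun setT (fun p : V => p.1.1).
  exact: (measurableT_comp measurable_fst measurable_fst).
have m12 : measurable_fun setT (fun p : V => p.1.2).
  exact: (measurableT_comp measurable_snd measurable_fst).
have mu := measurable_ucomp.
split; [under eq_fun do rewrite helH1E|under eq_fun do rewrite helH2E].
  by apply: measurable_funB; [exact: mu|apply: measurable_funM => //; exact: mu].
by apply: measurable_funD; [exact: mu|apply: measurable_funM => //; exact: mu].
Qed.

(** The material derivative of phi along the velocity generated by w. *)
Definition transport (phi : V -> R) (p : V) : R :=
  dt phi p + dot2 (helH (wx p.2) p.1) (gradx phi p).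

Lemma measurable_transport phi : elem phi -> measurable_fun setT (transport phi).
Proof.
move=> ep; have [h1 h2] := measurable_helH.
have d v : measurable_fun setT ('D_v phi) by apply: elem_measurable; exact: elem_derive.
apply: measurable_funD; first exact: d.
by apply: measurable_funD; apply: measurable_funM => //; exact: d.
Qed.

Lemma measurable_slice (G : V -> R) s : measurable_fun setT G ->
  measurable_fun setT (fun x : P => G (x, s)).
Proof.
move=> mG; apply: (measurableT_comp (f := G) (g := fun x : P => (x, s))) => //.
Qed.

Lemma transport_bounded phi B : elem phi -> supported phi B ->
  exists K : R, 0 <= K /\ forall p, 0 <= p.2 <= T -> `|transport phi p| <= K.
Proof.
move=> ep sp.
have k v : exists K : R, 0 <= K /\ forall u, `|'D_v phi u| <= K.
  by apply: (elem_bounded (elem_derive v ep)); exact: derive_supported sp.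
have [K1 [K10 k1]] := k (0, 0, 1); have [K2 [K20 k2]] := k (1, 0, 0).
have [K3 [K30 k3]] := k (0, 1, 0).
have B0 : 0 <= `|B| by [].
have [M0|M0] := leP 0 M; last first.
  exists 0; split=> // p pT; have := good_ge0 (gw pT); lra.
set b := cU R * M * (1 + `|B|).
have b0 : 0 <= b by rewrite !mulr_ge0 ?cU_ge0// addr_ge0.
exists (K1 + b * (K2 + K3)); split; first by rewrite addr_ge0// mulr_ge0// addr_ge0.
move=> p pT; apply: (le_trans (ler_normD _ _)); apply: lerD; first exact: k1.
have g : good M (wx p.2) by rewrite wxE; [exact: gw|case/andP: pT].
have [nb|nb] := pselect (box B p).
  have pB : `|p.1| <= `|B|.
    case: nb => h1 h2 _; have -> : `|p.1| = Num.max `|p.1.1| `|p.1.2| by [].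
    by rewrite ge_max (le_trans h1 (ler_norm _)) (le_trans h2 (ler_norm _)).
  have hb : `|helH (wx p.2) p.1| <= b.
    apply: (le_trans (helH_bound p.1 g)); rewrite /b ler_wpM2l ?lerD2l//.
    by rewrite mulr_ge0 ?cU_ge0.
  have aux (a1 a2 c1 c2 : R) : `|a1| <= b -> `|a2| <= b -> `|c1| <= K2 -> `|c2| <= K3 ->
      `|a1 * c1 + a2 * c2| <= b * (K2 + K3).
    move=> h1 h2 h3 h4; apply: (le_trans (ler_normD _ _)); rewrite mulrDr !normrM.
    by apply: lerD; apply: ler_pM.
  apply: aux; [|  |exact: k2|exact: k3].
    by apply: le_trans hb; exact: norm_fst.
  by apply: le_trans hb; exact: norm_snd.
have z v : 'D_v phi p = 0.
  by apply/eqP; apply: contra_notT nb; exact: derive_supported sp p.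
by rewrite /dot2 /gradx/= !z !mulr0 addr0 normr0 mulr_ge0// addr_ge0.
Qed.

(** By the weak formulation, the rate of change of the integral of w phi at time s. *)
Definition flux phi (s : R) : R := \int[leb2 R]_x (wx s x * transport phi (x, s)).

Lemma measurable_flux phi : elem phi -> measurable_fun setT (flux phi).
Proof.
move=> ep; apply: (@measurable_Rintegral _ _ (measurableTypeR R) _ R (plane R)
  (fun z => wext (z.2, z.1) * transport phi (z.2, z.1))).
have sw : measurable_fun setT (fun z : measurableTypeR R * P => (z.2, z.1) : V).
  by apply: measurable_fun_pair; [exact: measurable_snd|exact: measurable_fst].
apply: measurable_funM.
  exact: (measurableT_comp (f := wext) measurable_wext sw).
exact: (measurableT_comp (f := transport phi) (measurable_transport ep) sw).
Qed.

Lemma flux_bound phi K s : elem phi -> 0 <= s <= T -> 0 <= K ->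
  (forall x, `|transport phi (x, s)| <= K) -> `|flux phi s| <= K * M.
Proof.
move=> ep sT K0 hK; have g : good M (wx s) by rewrite wxE; [exact: gw|case/andP: sT].
apply: (proj2 (good_integral_bounded g _ K0 hK)).
by apply: measurable_slice; exact: measurable_transport.
Qed.

(** The weak identities at t2 and t1 are subtracted; the flux is bounded, hence integrable, so the
    time integral splits. The bound e may vary with time because the cost of freezing the velocity
    is small only on average. *)
Lemma weak_increment phi B (e : R -> R) (E t1 t2 : R) : elem phi -> supported phi B ->
  0 <= t1 -> t1 <= t2 -> t2 <= T ->
  measurable_fun setT e -> (forall s, t1 < s <= t2 -> `|flux phi s| <= e s) ->
  (\int[leb1 R]_(s in `]t1, t2]) (e s)%:E <= E%:E)%E ->
  `|\int[leb2 R]_x (w x t2 * phi (x, t2)) - \int[leb2 R]_x (w x t1 * phi (x, t1))| <= E.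
Proof.
move=> ep sp t10 t12 t2T me fe eE.
have tp : test_function phi by apply: (elem_test ep sp).
have fE t : 0 <= t -> t <= T -> \int[leb2 R]_x (w x t * phi (x, t)) -
    \int[leb2 R]_x (w x 0 * phi (x, 0)) = \int[leb1 R]_(s in `[0, t]) flux phi s.
  move=> t0 tT; apply: (etrans (weakw t0 tp)); apply: eq_Rintegral => s.
  rewrite inE/= in_itv/= => /andP[s0 _]; rewrite /flux (wxE s0).
  by apply: eq_Rintegral => x _; rewrite /transport (wxE s0).
have [K [K0 hK]] := transport_bounded ep sp.
have fi : (leb1 R).-integrable `[0, t2] (EFin \o flux phi).
  apply: (proj1 (@integral_bound _ (measurableTypeR R) R (leb1 R) _ (fun=> K * M) _ (K * M * t2) _ _ _ _ _)) => //.
  - by apply: measurable_funTS; exact: measurable_flux.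
  - move=> s /=; rewrite in_itv/= => /andP[s0 st]; apply: flux_bound => //.
      by rewrite s0 (le_trans st).
    by move=> x; apply: hK; rewrite /= s0 (le_trans st).
  rewrite integral_cst//; have := @lebesgue_measure_itv R `[0, t2]; rewrite /= lte_fin => ->.
  have M0 : 0 <= M.
    by apply: (good_ge0 (gw (s := 0) _)); rewrite lexx (le_trans t10 (le_trans t12 t2T)).
  have t20 : 0 <= t2 by apply: le_trans t12.
  case: ifP => _; first by rewrite -EFinD oppr0 addr0 -EFinM.
  by rewrite mule0 lee_fin; apply: mulr_ge0 => //; exact: mulr_ge0.
have -> : \int[leb2 R]_x (w x t2 * phi (x, t2)) - \int[leb2 R]_x (w x t1 * phi (x, t1)) =
   \int[leb1 R]_(s in `]t1, t2]) flux phi s.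
  have := fE t2 (le_trans t10 t12) t2T; have := fE t1 t10 (le_trans t12 t2T).
  rewrite -(@Rintegral_itvB _ _ (BLeft 0) (BRight t2) t1)//; lra.
apply: (proj2 (@integral_bound _ (measurableTypeR R) R (leb1 R) _ e _ _ _ _ _ _ _)) => //.
- by apply: measurable_funTS; exact: measurable_flux.
- exact: measurable_funTS.
Qed.

End Time.

(** * The second moment *)

Section Cutoff.
Variable R : realType.
Local Notation P := (R * R)%type.
Local Notation V := (R * R * R)%type.
Implicit Types (f g : V -> R) (u v p : V).

Lemma derive_x1 p v : 'D_v (fun u : V => u.1.1) p = v.1.1.
Proof. exact: derive_affine. Qed.

Lemma derive_x2 p v : 'D_v (fun u : V => u.1.2) p = v.1.2.
Proof. exact: derive_affine. Qed.

Lemma derive_x3 p v : 'D_v (fun u : V => u.2) p = v.2.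
Proof. exact: derive_affine. Qed.

Lemma derive_elemD f g p v : elem f -> elem g ->
  'D_v (fun u => f u + g u) p = 'D_v f p + 'D_v g p.
Proof. by move=> ef eg; apply: deriveD; exact: elem_derivable. Qed.

Lemma derive_elemB f g p v : elem f -> elem g ->
  'D_v (fun u => f u - g u) p = 'D_v f p - 'D_v g p.
Proof. by move=> ef eg; apply: deriveB; exact: elem_derivable. Qed.

Lemma derive_elemM f g p v : elem f -> elem g ->
  'D_v (fun u => f u * g u) p = f p * 'D_v g p + g p * 'D_v f p.
Proof. by move=> ef eg; apply: deriveM; exact: elem_derivable. Qed.

Lemma derive_elemC (c : R) p v : 'D_v (fun=> c) p = 0.
Proof. exact: derive_cst. Qed.

(** Gives space-time functions compact support in time. It equals 1 with vanishing derivative for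
    |s| <= T, so that neither values nor material derivatives change there; squaring s avoids the
    corner of |s|. *)
Definition cut (T : R) p : R := 1 - step (p.2 * p.2 / (T + 1) ^+ 2 - 1).

Lemma elem_cutarg T : elem (fun p : V => p.2 * p.2 / (T + 1) ^+ 2 - 1).
Proof.
by apply: elem_sub (elem_cst _); apply: elem_mul (elem_cst _); apply: elem_mul; exact: elem_x3.
Qed.

Lemma elem_cut T : elem (cut T).
Proof. by apply: elem_sub; [exact: elem_cst|apply: elem_step; exact: elem_cutarg]. Qed.

Lemma cutarg_le T p : 0 <= T -> `|p.2| <= T -> p.2 * p.2 / (T + 1) ^+ 2 - 1 <= 0.
Proof.
move=> T0 pT; rewrite subr_le0 ler_pdivrMr ?exprn_gt0//; last by lra.
rewrite mul1r -expr2 -(@real_normK _ p.2) ?num_real// ler_pXn2r// ?nnegrE; lra.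
Qed.

Lemma cut_eq1 T p : 0 <= T -> `|p.2| <= T -> cut T p = 1.
Proof.
by move=> T0 /(cutarg_le T0) h; rewrite /cut step_eq0 ?subr0//; lra.
Qed.

Lemma derive_cut_eq0 T p v : 0 <= T -> `|p.2| <= T -> 'D_v (cut T) p = 0.
Proof.
move=> T0 /(cutarg_le T0) h.
rewrite derive_elemB; [|exact: elem_cst|by apply: elem_step; exact: elem_cutarg].
rewrite derive_elemC derive_step; last exact: elem_cutarg.
by rewrite dstep_eq0 ?mul0r ?subrr//; left; lra.
Qed.

Lemma cut_support T p : 0 <= T -> cut T p != 0 -> `|p.2| <= 2 * (T + 1).
Proof.
move=> T0; apply: contraNT; rewrite -ltNge => h.
have T1 : 0 < T + 1 by lra.
rewrite /cut step_eq1 ?subrr//.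
suff : 2 <= p.2 * p.2 / (T + 1) ^+ 2 by lra.
rewrite ler_pdivlMr ?exprn_gt0// -expr2 -(@real_normK _ p.2) ?num_real//.
have : (2 * (T + 1)) ^+ 2 <= `|p.2| ^+ 2.
  by rewrite ler_pXn2r ?nnegrE// ?mulr_ge0//; exact: ltW.
have := sqr_ge0 (T + 1); rewrite exprMn; lra.
Qed.

(** The identity up to u = 5/4, zero from 7/4 on; [dprof] is its derivative. *)
Definition mprof (u : R) : R := u * (1 - step (u - 1)).
Definition dprof (u : R) : R := 1 - step (u - 1) - u * dstep (u - 1).

Lemma dprof_eq1 (u : R) : u <= 1 -> dprof u = 1.
Proof.
by move=> u1; rewrite /dprof step_eq0 ?dstep_eq0; [lra|left; lra|lra].
Qed.

Lemma mprof_eq0 (u : R) : 2 <= u -> mprof u = 0.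
Proof. by move=> u2; rewrite /mprof step_eq1 ?subrr ?mulr0//; lra. Qed.

Lemma mprof_bounds (u : R) : 0 <= u -> 0 <= mprof u <= u.
Proof.
move=> u0; have s0 := step_ge0 (u - 1); have s1 := step_le1 (u - 1).
apply/andP; split; first by rewrite mulr_ge0// subr_ge0.
by rewrite ler_piMr//; lra.
Qed.

Lemma dprof_bounded : exists C : R, 0 < C /\ forall u : R, `|dprof u - 1| <= C.
Proof.
have [C [C0 hC]] := dstep_bounded R.
exists (1 + 2 * C); split; first lra.
move=> u; have [u1|u1] := leP u 1; first by rewrite dprof_eq1// subrr normr0; lra.
have s0 := step_ge0 (u - 1); have s1 := step_le1 (u - 1).
have -> : dprof u - 1 = - (step (u - 1) + u * dstep (u - 1)) by rewrite /dprof; ring.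
rewrite normrN; apply: (le_trans (ler_normD _ _)); apply: lerD; first by rewrite ger0_norm.
have [u2|u2] := leP u 2.
  by rewrite normrM; apply: ler_pM => //; rewrite ger0_norm//; lra.
by rewrite dstep_eq0 ?mulr0 ?normr0 ?mulr_ge0//; [exact: ltW|right; lra].
Qed.

Lemma elem_mprof f : elem f -> elem (fun u => mprof (f u)).
Proof.
move=> ef; apply: elem_mul => //; apply: elem_sub; first exact: elem_cst.
by apply: elem_step; apply: elem_sub => //; exact: elem_cst.
Qed.

Lemma derive_mprof f p v : elem f -> 'D_v (fun u => mprof (f u)) p = dprof (f p) * 'D_v f p.
Proof.
move=> ef; have e1 : elem (fun u => f u - 1) by apply: elem_sub => //; exact: elem_cst.
have e2 : elem (fun u => 1 - step (f u - 1)).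
  by apply: elem_sub; [exact: elem_cst|exact: elem_step].
rewrite /mprof derive_elemM//.
have -> : 'D_v (fun u => 1 - step (f u - 1)) p = - (dstep (f p - 1) * 'D_v f p).
  rewrite derive_elemB; [|exact: elem_cst|exact: elem_step].
  rewrite derive_elemC (derive_step _ _ e1) derive_elemB//; last exact: elem_cst.
  by rewrite derive_elemC subr0 sub0r.
by rewrite /dprof; move: ('D_v f p) (dstep _) (step _) => a b c; ring.
Qed.

Definition qn (rho : R) p : R := (p.1.1 * p.1.1 + p.1.2 * p.1.2) / rho ^+ 2.

Lemma elem_qn rho : elem (qn rho).
Proof.
apply: elem_mul (elem_cst _); apply: elem_add; apply: elem_mul;
  by first [exact: elem_x1|exact: elem_x2].
Qed.

Lemma qnE rho (x : P) s : qn rho (x, s) = n2 x / rho ^+ 2.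
Proof. by rewrite /qn/n2 !expr2. Qed.

Lemma derive_qn rho p v :
  'D_v (qn rho) p = 2 * (p.1.1 * v.1.1 + p.1.2 * v.1.2) / rho ^+ 2.
Proof.
have e1 := elem_mul (elem_x1 R) (elem_x1 R); have e2 := elem_mul (elem_x2 R) (elem_x2 R).
rewrite (derive_elemM _ _ (elem_add e1 e2) (elem_cst _)) derive_elemC mulr0 add0r.
rewrite (derive_elemD _ _ e1 e2) (derive_elemM _ _ (elem_x1 R) (elem_x1 R)).
rewrite (derive_elemM _ _ (elem_x2 R) (elem_x2 R)) derive_x1 derive_x2; ring.
Qed.

Lemma qn_support rho (p : V) : 0 < rho -> qn rho p < 2 -> `|p.1.1| <= 2 * rho /\ `|p.1.2| <= 2 * rho.
Proof.
move=> r0; rewrite /qn ltr_pdivrMr ?exprn_gt0// -!expr2 => h.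
have k (z : R) : z ^+ 2 <= p.1.1 ^+ 2 + p.1.2 ^+ 2 -> `|z| <= 2 * rho.
  move=> hz; rewrite -(@ler_pXn2r _ 2) ?nnegrE//; last by rewrite mulr_ge0// ltW.
  rewrite real_normK ?num_real// exprMn.
  by have := sqr_ge0 rho; lra.
by split; apply: k; have := sqr_ge0 p.1.1; have := sqr_ge0 p.1.2; lra.
Qed.

Lemma elem_dstep f : elem f -> elem (fun u => dstep (f u)).
Proof.
move=> ef; have e0 : elem (fun=> (0 : R)) := elem_cst _.
exact: (elem_comp (elem_derive ((1, 0, 0) : V) (elem_step (elem_x1 R))) ef e0 e0).
Qed.

End Cutoff.

(** * Conservation of the second moment *)

Section SecondMoment.
Variable R : realType.
Local Notation P := (R * R)%type.
Local Notation V := (R * R * R)%type.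
Variables (w : P -> R -> R) (T M : R).
Hypothesis mw : measurable_fun [set p : V | 0 <= p.2] (fun p => w p.1 p.2).
Hypothesis gw : forall s, 0 <= s <= T -> good M (w ^~ s).
Hypothesis weakw : weak_formulation w.
Hypothesis T0 : 0 <= T.

(** Dominated convergence: the weight <x>^2 of the class makes functions of quadratic growth
    admissible, which is what |x|^2 needs. *)
Lemma good_dct (g : P -> R) (G : nat -> P -> R) (Gl : P -> R) (K : R) : good M g -> 0 <= K ->
  (forall n, measurable_fun setT (G n)) -> measurable_fun setT Gl ->
  (forall n x, `|G n x| <= K * jbracket x ^+ 2) ->
  (forall x, G n x @[n --> \oo] --> Gl x) ->
  (\int[leb2 R]_x (g x * G n x)) @[n --> \oo] --> \int[leb2 R]_x (g x * Gl x).
Proof.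
move=> gg K0 mG mGl GK cG; have [mg wM _] := gg; have mwt := measurable_weight mg.
have mKw : measurable_fun setT (fun x => K * weight g x).
  by apply: measurable_funM => //; exact: measurable_cst.
have iK : (leb2 R).-integrable setT (EFin \o (fun x => K * weight g x)).
  apply: (proj1 (integral_bound_leb2 mKw mKw (C := K * M) _ _)).
    by move=> x; rewrite ger0_norm//; apply: mulr_ge0 => //; exact: weight_ge0.
  apply: (ge0_scale_leb2 mKw mwt K0 _ _ wM) => x; last exact: weight_ge0.
  by rewrite lexx andbT; apply: mulr_ge0 => //; exact: weight_ge0.
have b n x : `|g x * G n x| <= K * weight g x.
  by rewrite normrM /weight mulrA mulrC; apply: ler_wpM2r.
have m1 n : measurable_fun setT (fun x => (g x * G n x)%:E).
  by apply/measurable_EFinP; exact: measurable_funM.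
have m2 : measurable_fun setT (fun x => (g x * Gl x)%:E).
  by apply/measurable_EFinP; exact: measurable_funM.
have c1 : {ae leb2 R, forall x, setT x -> (g x * G n x)%:E @[n --> \oo] --> (g x * Gl x)%:E}.
  apply: aeW => x _; apply: cvg_EFin; first exact: nearW.
  by apply: cvgMr; exact: cG.
have c2 : {ae leb2 R, forall x n, setT x -> (`|(g x * G n x)%:E| <= (K * weight g x)%:E)%E}.
  by apply: aeW => x n _; rewrite /= lee_fin.
have [il _ D] := @dominated_convergence _ _ R (leb2 R) setT measurableT _ _ _ m1 m2 c1 iK c2.
have E : (\int[leb2 R]_x (g x * Gl x)%:E)%E = (\int[leb2 R]_x (g x * Gl x))%:E.
  by rewrite fineK//; exact: integrable_fin_num.
by move: D; rewrite E => /fine_cvgP[].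
Qed.

(* The test function is |x|^2 truncated at radius rho.  By antisymmetry only the
   region rho <= |x| contributes to the flux, and there 1 <= <x> / rho. *)
Lemma second_moment_increment (C1 rho t : R) : 0 < C1 -> (forall u, `|dprof u - 1| <= C1) ->
  0 < rho -> 0 <= t <= T ->
  `|\int[leb2 R]_x (w x t * (rho ^+ 2 * mprof (n2 x / rho ^+ 2))) -
    \int[leb2 R]_x (w x 0 * (rho ^+ 2 * mprof (n2 x / rho ^+ 2)))| <=
  t * (2 * C1 * (2 * cU R * M) * M) / rho.
Proof.
move=> C10 hC1 r0 /andP[t0 tT].
pose A (p : V) := rho ^+ 2 * mprof (qn rho p).
pose phi p := A p * cut T p.
have eA : elem A by apply: elem_mul (elem_cst _) _; apply: elem_mprof; exact: elem_qn.
have ephi : elem phi by apply: elem_mul => //; exact: elem_cut.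
have sphi : supported phi (2 * rho + 2 * (T + 1)).
  move=> p hp.
  have c0 : cut T p != 0 by apply: contra_neq hp; rewrite /phi => ->; rewrite mulr0.
  have m0 : mprof (qn rho p) != 0.
    by apply: contra_neq hp; rewrite /phi /A => ->; rewrite mulr0 mul0r.
  have q2 : qn rho p < 2.
    by rewrite ltNge; apply/negP => /mprof_eq0 m1; rewrite m1 eqxx in m0.
  have [h1 h2] := qn_support r0 q2; have h3 := cut_support T0 c0.
  by split; lra.
have phiE x s : 0 <= s <= T -> phi (x, s) = rho ^+ 2 * mprof (n2 x / rho ^+ 2).
  by move=> /andP[s0 sT]; rewrite /phi cut_eq1 ?mulr1 /A ?qnE// /= ger0_norm.
have dphi x s v : 0 <= s <= T ->
    'D_v phi (x, s) = 2 * dprof (n2 x / rho ^+ 2) * (x.1 * v.1.1 + x.2 * v.1.2).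
  move=> /andP[s0 sT]; have sT' : `|(x, s).2| <= T by rewrite /= ger0_norm.
  rewrite (derive_elemM _ _ eA (elem_cut T)) derive_cut_eq0// mulr0 add0r cut_eq1// mul1r.
  rewrite (derive_elemM _ _ (elem_cst _) (elem_mprof (elem_qn rho))) derive_elemC mulr0 addr0.
  rewrite derive_mprof; last exact: elem_qn.
  by rewrite derive_qn qnE/=; field; rewrite gt_eqF.
have M0 : 0 <= M by apply: (good_ge0 (gw (s := 0) _)); rewrite lexx.
have fl s : 0 < s <= t -> `|flux w phi s| <= (2 * C1 * (2 * cU R * M) / rho) * M.
  move=> /andP[s0 st]; have sT : 0 <= s <= T by rewrite ltW//= (le_trans st).
  have g1 : good M (wx w s) by rewrite wxE ?ltW//; exact: gw.
  pose D x := dot2 x (helH (wx w s) x).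
  have mD : measurable_fun setT D.
    have [h1 h2] := measurable_helH mw.
    by apply: measurable_funD; apply: measurable_funM => //;
      [exact: (measurable_slice s h1)|exact: (measurable_slice s h2)].
  have cUM : 0 <= cU R * M by rewrite mulr_ge0// cU_ge0.
  have Db x : `|D x| <= 2 * cU R * M * jbracket x.
    have b i := proj2 (ucomp_bound i x g1); have [j1 j2] := abs_le_jbracket x.
    rewrite /D dot_helH.
    move: (ucomp 0 _ _) (b 0) (ucomp 1 _ _) (b 1) => u0 hu0 u1 hu1.
    apply: (le_trans (ler_normD _ _)); rewrite (normrM x.1) (normrM x.2).
    have -> : 2 * cU R * M * jbracket x = jbracket x * (cU R * M) + jbracket x * (cU R * M) by ring.
    by apply: lerD; apply: ler_pM.
  have Db2 x : `|D x| <= 2 * cU R * M * jbracket x ^+ 2.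
    apply: (le_trans (Db x)); rewrite ler_wpM2l//; first by rewrite -mulrA mulr_ge0.
    by rewrite expr2 ler_peMl ?jbracket_ge1// ltW// jbracket_gt0.
  have mn2 : measurable_fun setT (fun x : P => dprof (n2 x / rho ^+ 2) - 1).
    apply: measurable_funB; last exact: measurable_cst.
    have eq1 : elem (fun p : V => qn rho p - 1) by apply: elem_sub (elem_cst _); exact: elem_qn.
    have ed : elem (fun p : V => 1 - step (qn rho p - 1) - qn rho p * dstep (qn rho p - 1)).
      apply: elem_sub; first by apply: elem_sub; [exact: elem_cst|exact: elem_step].
      by apply: elem_mul; [exact: elem_qn|exact: elem_dstep].
    have := measurable_slice 0 (elem_measurable ed).
    by under eq_fun do rewrite !qnE.
  (* Subtracting 2 x.Hw, whose integral against w is zero, replaces [dprof] by [dprof] - 1. *)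
  pose G x := 2 * (dprof (n2 x / rho ^+ 2) - 1) * D x.
  have mG : measurable_fun setT G.
    by apply: measurable_funM => //; apply: measurable_funM => //; exact: measurable_cst.
  have K0 : 0 <= 2 * C1 * (2 * cU R * M) / rho.
    rewrite divr_ge0// ?(ltW r0)// -(mulrA 2 (cU R)); apply: mulr_ge0; apply: mulr_ge0 => //; exact: ltW.
  have Gb x : `|G x| <= 2 * C1 * (2 * cU R * M) / rho * jbracket x ^+ 2.
    have [n1|n1] := leP (n2 x / rho ^+ 2) 1.
      rewrite /G dprof_eq1// subrr mulr0 mul0r normr0.
      by apply: mulr_ge0 => //; exact: sqr_ge0.
    have jr : rho <= jbracket x.
      rewrite -(@ler_pXn2r _ 2) ?nnegrE ?(ltW r0) ?(ltW (jbracket_gt0 x))//.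
      by move: n1; rewrite ltr_pdivlMr ?exprn_gt0// mul1r jbracket_sqr; lra.
    rewrite /G (normrM (2 * _)) (normrM 2) (ger0_norm (ler0n _ 2)).
    have -> : 2 * C1 * (2 * cU R * M) / rho * jbracket x ^+ 2 =
      2 * C1 * (2 * cU R * M * (jbracket x * (jbracket x / rho))) by ring.
    apply: ler_pM => //; first by rewrite ler_wpM2l// hC1.
    apply: (le_trans (Db x)); rewrite ler_wpM2l//; first by rewrite -mulrA mulr_ge0.
    by rewrite ler_peMr ?ler_pdivlMr ?mul1r// ltW// jbracket_gt0.
  have cUM2 : 0 <= 2 * cU R * M by rewrite -mulrA mulr_ge0.
  have [iG bG] := good_integral g1 mG K0 Gb.
  have [iD _] := good_integral g1 mD cUM2 Db2.
  suff -> : flux w phi s = \int[leb2 R]_x (wx w s x * G x) by [].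
  have e0 : \int[leb2 R]_x (wx w s x * D x) = 0 by exact: (radial_cancel g1).
  rewrite -[RHS]addr0 -(mulr0 2) -{}e0 -(RintegralZl 2 measurableT iD).
  have iD2 : (leb2 R).-integrable setT (EFin \o (fun x => 2 * (wx w s x * D x))).
    by have := integrableZl measurableT 2 iD.
  rewrite -(RintegralD measurableT iG iD2); apply: eq_Rintegral => x _.
  have -> : transport w phi (x, s) =
    dt phi (x, s) + dot2 (helH (wx w s) x) (gradx phi (x, s)) by [].
  rewrite /G /D; move: (helH (wx w s) x) (wx w s x) => b z.
  rewrite /dt /gradx !dphi// /dot2 /=.
  by move: (dprof _) => d; ring.
pose e (s : R) := (2 * C1 * (2 * cU R * M) / rho) * M.
have K0 : 0 <= 2 * C1 * (2 * cU R * M) / rho * M.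
  rewrite mulr_ge0// divr_ge0// ?(ltW r0)// -(mulrA 2 (cU R)).
  apply: mulr_ge0; first by rewrite mulr_ge0// ltW.
  by rewrite mulr_ge0// mulr_ge0// cU_ge0.
have := @weak_increment R w T M mw gw weakw phi _ e (t * (2 * C1 * (2 * cU R * M) * M) / rho) 0 t
  ephi sphi (lexx _) t0 tT (measurable_cst _) fl.
have -> : \int[leb2 R]_x (w x t * phi (x, t)) = \int[leb2 R]_x (w x t * (rho ^+ 2 * mprof (n2 x / rho ^+ 2))).
  by apply: eq_Rintegral => x _; rewrite phiE// t0.
have -> : \int[leb2 R]_x (w x 0 * phi (x, 0)) = \int[leb2 R]_x (w x 0 * (rho ^+ 2 * mprof (n2 x / rho ^+ 2))).
  by apply: eq_Rintegral => x _; rewrite phiE// lexx.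
apply; rewrite /e integral_cst//; have := @lebesgue_measure_itv R `]0, t]; rewrite /= lte_fin => ->.
have -> : t * (2 * C1 * (2 * cU R * M) * M) / rho = 2 * C1 * (2 * cU R * M) / rho * M * t by ring.
case: ifP => _; first by rewrite -EFinD oppr0 addr0 -EFinM.
by rewrite mule0 lee_fin; apply: mulr_ge0.
Qed.

(** The truncated moments change by O(1/rho). With rho = n + 1 the truncations are dominated by
    <x>^2 and eventually equal to |x|^2 at each point. *)
Lemma second_moment_conserved t : 0 <= t <= T ->
  \int[leb2 R]_x (w x t * n2 x) = \int[leb2 R]_x (w x 0 * n2 x).
Proof.
move=> tT; have [C1 [C10 hC1]] := dprof_bounded R.
have M0 : 0 <= M by apply: (good_ge0 (gw (s := 0) _)); rewrite lexx.
pose G (n : nat) (x : P) := n.+1%:R ^+ 2 * mprof (n2 x / n.+1%:R ^+ 2).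
have n0 n : 0 < n.+1%:R :> R by rewrite ltr0n.
have n20 n : 0 < n.+1%:R ^+ 2 :> R by rewrite exprn_gt0.
have mG n : measurable_fun setT (G n).
  have em : elem (fun p : V => n.+1%:R ^+ 2 * mprof (qn n.+1%:R p)).
    by apply: elem_mul (elem_cst _) _; apply: elem_mprof; exact: elem_qn.
  have := measurable_slice 0 (elem_measurable em).
  by under eq_fun do rewrite !qnE.
have Gb n x : `|G n x| <= 1 * jbracket x ^+ 2.
  have h : 0 <= n2 x / n.+1%:R ^+ 2 by rewrite divr_ge0 ?n2_ge0// ltW.
  have /andP[h1 h2] := mprof_bounds h.
  rewrite /G ger0_norm; last by rewrite mulr_ge0// ltW.
  rewrite mul1r jbracket_sqr; apply: (@le_trans _ _ (n2 x)); last by rewrite lerDr.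
  by rewrite mulrC -ler_pdivlMr.
have Gc x : G n x @[n --> \oo] --> n2 x.
  apply: cvg_near_cst; have [k hk] : exists k : nat, n2 x < k%:R.
    exists (Num.bound (n2 x)); have := @archi_boundP _ (n2 x) (n2_ge0 x); exact.
  near=> n.
  have kn : n2 x <= n.+1%:R ^+ 2.
    apply: (le_trans (ltW hk)); apply: (@le_trans _ _ n.+1%:R).
      by rewrite ler_nat; apply: leqW; near: n; exact: nbhs_infty_ge.
    by rewrite expr2 ler_peMl ?ler1n// ltW.
  rewrite /G /mprof step_eq0 ?subr0 ?mulr1; last first.
    have : n2 x / n.+1%:R ^+ 2 <= 1 by rewrite ler_pdivrMr// mul1r.
    by move: (_ / _) => z hz; lra.
  by rewrite mulrC divfK// gt_eqF.
have g0 : good M (w ^~ 0) by apply: gw; rewrite lexx.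
have L1 := good_dct (gw tT) ler01 mG (@measurable_n2 R) Gb Gc.
have L2 := good_dct g0 ler01 mG (@measurable_n2 R) Gb Gc.
apply/eqP; rewrite -subr_eq0; apply/eqP.
have L3 : \int[leb2 R]_x (w x t * G n x) - \int[leb2 R]_x (w x 0 * G n x) @[n --> \oo] -->
    \int[leb2 R]_x (w x t * n2 x) - \int[leb2 R]_x (w x 0 * n2 x) by exact: cvgB L1 L2.
apply: (cvg_unique _ L3) => //.
pose c := t * (2 * C1 * (2 * cU R * M) * M).
apply: (@squeeze_cvgr _ _ _ _ (fun n => - (c * n.+1%:R^-1)) (fun n => c * n.+1%:R^-1)).
- apply: nearW => n; rewrite -ler_norml; exact: (second_moment_increment C10 hC1 (n0 n) tT).
- rewrite -oppr0; apply: cvgN; rewrite -(mulr0 c); apply: cvgMr; exact: cvg_harmonic.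
- rewrite -(mulr0 c); apply: cvgMr; exact: cvg_harmonic.
Unshelve. all: by end_near.
Qed.

End SecondMoment.

(** * Positivity by duality *)

Section Interpolation.
Variable R : realType.
Local Notation P := (R * R)%type.
Local Notation V := (R * R * R)%type.
Implicit Types (f g : V -> R) (u v p : V).

Lemma derive_elem_sum n (F : nat -> V -> R) p v : (forall i, elem (F i)) ->
  'D_v (fun u => \sum_(i < n) F i u) p = \sum_(i < n) 'D_v (F i) p.
Proof.
move=> eF; elim: n => [|n IH].
  rewrite big_ord0; have -> : (fun u => \sum_(i < 0) F i u) = fun=> 0.
    by apply/funext => u; rewrite big_ord0.
  exact: derive_elemC.
rewrite big_ord_recr /= -IH -derive_elemD//; last exact: elem_sum.
by congr ('D_v _ p); apply/funext => u; rewrite big_ord_recr.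
Qed.

Lemma telescope_sum n (F : nat -> R) y : (forall z : nat, F z = y z - y z.+1) ->
  \sum_(i < n) F i = y 0%N - y n.
Proof.
move=> h; elim: n => [|n IH]; first by rewrite big_ord0 subrr.
by rewrite big_ord_recr/= IH h; ring.
Qed.

(** At most one term is non-zero, the supports being of length 1/2 and spaced by 1; the bound
    therefore does not depend on n. *)
Lemma sum_separated n (f : R -> R) (C z : R) : 0 <= C -> (forall x, `|f x| <= C) ->
  (forall x, x < 4^-1 \/ 3 / 4 < x -> f x = 0) ->
  \sum_(i < n) `|f (z - i%:R)| <= C.
Proof.
move=> C0 fC f0; elim: n => [|n IH]; first by rewrite big_ord0.
rewrite big_ord_recr/=; have [h|h] := pselect (z - n%:R < 4^-1 \/ 3 / 4 < z - n%:R).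
  by rewrite (f0 _ h) normr0 addr0.
rewrite big1 ?add0r// => i _; rewrite f0 ?normr0//; right.
have : (i.+1%:R : R) <= n%:R by rewrite ler_nat.
have : 4^-1 <= z - n%:R by rewrite leNgt; apply/negP => h'; apply: h; left.
by rewrite -(natr1 i) => h1 h2; lra.
Qed.

Variables (A B : R) (K : nat).
Hypothesis A0 : 0 < A.
Hypothesis KE : K%:R = A * B.

(* The bumps are consecutive differences of translates of a step function, so
   they telescope to a partition of unity on [-B, B] of mesh 1/A. *)
Definition bumparg (i : nat) (z : R) : R := A * z + K%:R - i%:R.
Definition bump i z := step (bumparg i z + 1) - step (bumparg i z).
Definition dbump i z := A * (dstep (bumparg i z + 1) - dstep (bumparg i z)).
Definition node (i : nat) : R := (i%:R - K%:R) / A.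
Local Notation m := (2 * K).+1.

Lemma bump_ge0 i z : 0 <= bump i z.
Proof.
rewrite /bump; move: (bumparg i z) => y; have := step_ge0 (y + 1); have := step_le1 y.
have [y0|y0] := leP y 0; first by rewrite (@step_eq0 _ y); lra.
by rewrite (@step_eq1 _ (y + 1)); lra.
Qed.

Lemma bump_local i z : bump i z != 0 \/ dbump i z != 0 -> `|node i - z| <= A^-1.
Proof.
move=> h; suff : `|bumparg i z| <= 1.
  have -> : node i - z = - (bumparg i z / A).
    by rewrite /node /bumparg; field; rewrite gt_eqF.
  by rewrite normrN normrM (@ger0_norm _ A^-1) ?invr_ge0 ?(ltW A0)// => ?; rewrite ler_piMl// invr_ge0 ltW.
move: h; rewrite /bump /dbump; move: (bumparg i z) => y.
rewrite ler_norml leNgt => h; apply/andP; split; last first.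
  rewrite leNgt; apply/negP => y1; case: h.
    by rewrite !step_eq1 ?subrr ?eqxx//; lra.
  by rewrite !dstep_eq0 ?subrr ?mulr0 ?eqxx//; right; lra.
apply/negP => y1; case: h.
  by rewrite !step_eq0 ?subrr ?eqxx//; lra.
by rewrite !dstep_eq0 ?subrr ?mulr0 ?eqxx//; left; lra.
Qed.

Lemma node_bound i : (i < m)%N -> `|node i| <= B.
Proof.
move=> im; rewrite /node normrM (@ger0_norm _ A^-1) ?invr_ge0 ?(ltW A0)//.
rewrite ler_pdivrMr// mulrC -KE.
have h0 : 0 <= i%:R :> R by [].
have : i%:R <= (2 * K)%:R :> R by rewrite ler_nat -ltnS.
rewrite natrM ler_norml; lra.
Qed.

Lemma bump_sum n z : \sum_(i < n) bump i z = step (bumparg 0 z + 1) - step (bumparg n z + 1).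
Proof.
apply: (@telescope_sum n (fun i => bump i z) (fun i => step (bumparg i z + 1))) => i.
rewrite /bump; congr (_ - step _); rewrite /bumparg -(natr1 i); ring.
Qed.

Lemma dbump_sum n z : \sum_(i < n) dbump i z =
  A * (dstep (bumparg 0 z + 1) - dstep (bumparg n z + 1)).
Proof.
rewrite mulrBr.
apply: (@telescope_sum n (fun i => dbump i z) (fun i => A * dstep (bumparg i z + 1))) => i.
rewrite /dbump mulrBr; congr (_ - _ * dstep _); rewrite /bumparg -(natr1 i); ring.
Qed.

Lemma bump_sum_le1 n z : \sum_(i < n) bump i z <= 1.
Proof.
rewrite bump_sum; have := step_le1 (bumparg 0 z + 1).
by have := step_ge0 (bumparg n z + 1); lra.
Qed.

(** With K = A B and 2K + 1 bumps, both ends of the telescoped sum lie on the plateaus of [step], so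
    the bumps sum to exactly 1 and their derivatives to 0. *)
Lemma bumparg_ends z : `|z| <= B -> 1 <= bumparg 0 z + 1 /\ bumparg m z + 1 <= 0.
Proof.
move=> zB; have : `|A * z| <= K%:R by rewrite normrM (ger0_norm (ltW A0)) KE ler_pM2l.
rewrite ler_norml /bumparg -natr1 natrM; lra.
Qed.

Lemma bump_sum_eq1 z : `|z| <= B -> \sum_(i < m) bump i z = 1.
Proof.
move=> /bumparg_ends[h1 h2]; rewrite bump_sum step_eq1 ?step_eq0 ?subr0//; lra.
Qed.

Lemma dbump_sum_eq0 z : `|z| <= B -> \sum_(i < m) dbump i z = 0.
Proof.
move=> /bumparg_ends[h1 h2]; rewrite dbump_sum !dstep_eq0 ?subrr ?mulr0//; [left|right]; lra.
Qed.

(** A derivative bump is a difference of two translates of [dstep]; each of the two families has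
    disjoint supports, so the number of nodes does not enter. *)
Lemma dbump_sum_abs C n z : 0 <= C -> (forall x, `|dstep x| <= C) ->
  \sum_(i < n) `|dbump i z| <= A * (2 * C).
Proof.
move=> C0 hC; have sep y := @sum_separated n (@dstep R) C y C0 hC (@dstep_eq0 R).
apply: (@le_trans _ _ (\sum_(i < n) A * (`|dstep (A * z + K%:R + 1 - i%:R)| + `|dstep (A * z + K%:R - i%:R)|))).
  apply: ler_sum => i _; rewrite /dbump normrM (ger0_norm (ltW A0)) ler_pM2l//.
  have -> : bumparg i z + 1 = A * z + K%:R + 1 - i%:R by rewrite /bumparg; ring.
  exact: ler_normB.
rewrite -mulr_sumr ler_pM2l// big_split/=.
have -> : 2 * C = C + C by ring.
exact: lerD (sep _) (sep _).
Qed.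

Lemma elem_bumparg i f : elem f -> elem (fun u => bumparg i (f u)).
Proof.
by move=> ef; apply: elem_sub (elem_cst _); apply: elem_add (elem_cst _); apply: elem_mul => //; exact: elem_cst.
Qed.

Lemma elem_bump i f : elem f -> elem (fun u => bump i (f u)).
Proof.
move=> /(elem_bumparg i) ef; apply: elem_sub; apply: elem_step => //.
by apply: elem_add => //; exact: elem_cst.
Qed.

Lemma derive_bump i f p v : elem f ->
  'D_v (fun u => bump i (f u)) p = dbump i (f p) * 'D_v f p.
Proof.
move=> ef; have e1 := elem_bumparg i ef.
have e2 : elem (fun u => bumparg i (f u) + 1) by apply: elem_add => //; exact: elem_cst.
have D : 'D_v (fun u => bumparg i (f u)) p = A * 'D_v f p.
  have e3 : elem (fun u => A * f u) by apply: elem_mul => //; exact: elem_cst.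
  have e4 : elem (fun u => A * f u + K%:R) by apply: elem_add => //; exact: elem_cst.
  rewrite (derive_elemB _ _ e4 (elem_cst _)) derive_elemC subr0.
  rewrite (derive_elemD _ _ e3 (elem_cst _)) derive_elemC addr0.
  by rewrite (derive_elemM _ _ (elem_cst _) ef) derive_elemC mulr0 addr0.
rewrite (derive_elemB _ _ (elem_step e2) (elem_step e1)) !derive_step//.
rewrite (derive_elemD _ _ e1 (elem_cst _)) derive_elemC addr0 D /dbump.
by move: (dstep _) (dstep _) ('D_v f p) => a b c; ring.
Qed.

Variable F : nat -> nat -> R.

(** [F i j] is the value at the node of index (i, j). The third coordinate is ignored: the field
    does not depend on time. *)
Definition interp p : R := \sum_(i < m) \sum_(j < m) bump i p.1.1 * bump j p.1.2 * F i j.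

Definition dinterp p v : R := \sum_(i < m) \sum_(j < m)
  (dbump i p.1.1 * v.1.1 * bump j p.1.2 + bump i p.1.1 * (dbump j p.1.2 * v.1.2)) * F i j.

Lemma elem_interp : elem interp.
Proof.
apply: elem_sum => i; apply: elem_sum => j; apply: elem_mul (elem_cst _).
by apply: elem_mul; apply: elem_bump; [exact: elem_x1|exact: elem_x2].
Qed.

Lemma derive_interp p v : 'D_v interp p = dinterp p v.
Proof.
have e1 i := elem_bump i (elem_x1 R); have e2 j := elem_bump j (elem_x2 R).
have e3 i j := elem_mul (elem_mul (e1 i) (e2 j)) (elem_cst (F i j)).
rewrite (derive_elem_sum _ (F := fun i u => \sum_(j < m) bump i u.1.1 * bump j u.1.2 * F i j)); last first.
  by move=> i; exact: elem_sum.
apply: eq_bigr => i _.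
rewrite (derive_elem_sum _ (F := fun j u => bump i u.1.1 * bump j u.1.2 * F i j))//.
apply: eq_bigr => j _.
rewrite (derive_elemM _ _ (elem_mul (e1 i) (e2 j)) (elem_cst _)) derive_elemC mulr0 add0r.
rewrite (derive_elemM _ _ (e1 i) (e2 j)) (derive_bump _ _ _ (elem_x1 R)) (derive_bump _ _ _ (elem_x2 R)).
rewrite derive_x1 derive_x2.
by move: (bump _ _) (bump _ _) (dbump _ _) (dbump _ _) (F i j) => a b c d e; ring.
Qed.

(** The weights are non-negative with sum at most 1, also outside the box, so the bound is
    global. *)
Lemma interp_bound W p : (forall i j, (i < m)%N -> (j < m)%N -> `|F i j| <= W) -> `|interp p| <= W.
Proof.
move=> FW; have W0 : 0 <= W by apply: (le_trans _ (FW 0%N 0%N _ _)).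
have h (i : 'I_m) : `|\sum_(j < m) bump i p.1.1 * bump j p.1.2 * F i j| <= bump i p.1.1 * W.
  apply: (le_trans (ler_norm_sum _ _ _)).
  apply: (@le_trans _ _ (\sum_(j < m) bump i p.1.1 * W * bump j p.1.2)).
    apply: ler_sum => j _; rewrite !normrM (ger0_norm (bump_ge0 i _)) (ger0_norm (bump_ge0 j _)).
    by rewrite mulrAC ler_wpM2r ?bump_ge0// ler_wpM2l ?bump_ge0// FW.
  by rewrite -mulr_sumr ler_piMr ?bump_sum_le1// mulr_ge0// bump_ge0.
apply: (le_trans (ler_norm_sum _ _ _)); apply: (@le_trans _ _ (\sum_(i < m) bump i p.1.1 * W)).
  by apply: ler_sum => i _; exact: h.
by rewrite -mulr_suml ler_piMl ?bump_sum_le1.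
Qed.

Section Close.
Variables (p : V) (a om : R).
Hypothesis om0 : 0 <= om.
Hypothesis p1B : `|p.1.1| <= B.
Hypothesis p2B : `|p.1.2| <= B.
Hypothesis Fa : forall i j, (i < m)%N -> (j < m)%N ->
  `|node i - p.1.1| <= A^-1 -> `|node j - p.1.2| <= A^-1 -> `|F i j - a| <= om.

Lemma interp_close : `|interp p - a| <= om.
Proof.
have -> : interp p - a = \sum_(i < m) \sum_(j < m) bump i p.1.1 * bump j p.1.2 * (F i j - a).
  rewrite /interp -[X in _ - X]mul1r -{1}(bump_sum_eq1 p1B) !mulr_suml -sumrB.
  apply: eq_bigr => i _; rewrite -[X in _ - X * _]mulr1 -(bump_sum_eq1 p2B).
  rewrite mulr_sumr mulr_suml -sumrB; apply: eq_bigr => j _; ring.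
have h (i j : 'I_m) : `|bump i p.1.1 * bump j p.1.2 * (F i j - a)| <= bump i p.1.1 * om * bump j p.1.2.
  rewrite !normrM (ger0_norm (bump_ge0 i _)) (ger0_norm (bump_ge0 j _)).
  have [->|i0] := eqVneq (bump i p.1.1) 0; first by rewrite !mul0r.
  have [->|j0] := eqVneq (bump j p.1.2) 0; first by rewrite !(mulr0, mul0r).
  rewrite mulrAC ler_wpM2r ?bump_ge0// ler_wpM2l ?bump_ge0//.
  by apply: Fa => //; apply: bump_local; left.
apply: (le_trans (ler_norm_sum _ _ _)); apply: (@le_trans _ _ (\sum_(i < m) bump i p.1.1 * om)).
  apply: ler_sum => i _; apply: (le_trans (ler_norm_sum _ _ _)).
  apply: (@le_trans _ _ (\sum_(j < m) bump i p.1.1 * om * bump j p.1.2)); first by apply: ler_sum => j _; exact: h.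
  by rewrite -mulr_sumr ler_piMr ?bump_sum_le1// mulr_ge0// bump_ge0.
by rewrite -mulr_suml ler_piMl ?bump_sum_le1.
Qed.

(** The derivatives of a partition of unity sum to 0, so the constant a may be subtracted from the
    nodal values: the gradient is controlled by the local oscillation om divided by the mesh, not by
    the size of F. *)
Lemma dinterp_bound C v : 0 <= C -> (forall x, `|dstep x| <= C) ->
  `|dinterp p v| <= om * (A * (2 * C)) * (`|v.1.1| + `|v.1.2|).
Proof.
move=> C0 hC.
have -> : dinterp p v = \sum_(i < m) \sum_(j < m)
  (dbump i p.1.1 * v.1.1 * bump j p.1.2 + bump i p.1.1 * (dbump j p.1.2 * v.1.2)) * (F i j - a).
  apply/esym/eqP; rewrite -subr_eq0; apply/eqP; rewrite /dinterp -sumrB.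
  transitivity (\sum_(i < m) (dbump i p.1.1 * v.1.1 * - a + bump i p.1.1 * 0)).
    apply: eq_bigr => i _; rewrite -sumrB.
    transitivity (\sum_(j < m) (dbump i p.1.1 * v.1.1 * - a * bump j p.1.2 +
       dbump j p.1.2 * (bump i p.1.1 * v.1.2 * - a))).
      apply: eq_bigr => j _.
      move: (bump i _) (bump j _) (dbump i _) (dbump j _) (F i j) => b c d e f.
      ring.
    by rewrite big_split/= -mulr_sumr -mulr_suml (bump_sum_eq1 p2B) (dbump_sum_eq0 p2B) mul0r mulr1 mulr0.
  under eq_bigr do rewrite mulr0 addr0.
  by rewrite -mulr_suml -mulr_suml (dbump_sum_eq0 p1B) !mul0r.
have h (i j : 'I_m) :
  `|(dbump i p.1.1 * v.1.1 * bump j p.1.2 + bump i p.1.1 * (dbump j p.1.2 * v.1.2)) * (F i j - a)| <=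
  `|dbump i p.1.1| * (`|v.1.1| * om) * bump j p.1.2 + `|dbump j p.1.2| * (`|v.1.2| * om * bump i p.1.1).
  rewrite mulrDl; apply: (le_trans (ler_normD _ _)); apply: lerD.
    have [->|i0] := eqVneq (dbump i p.1.1) 0; first by rewrite !(mul0r, normr0).
    have [->|j0] := eqVneq (bump j p.1.2) 0; first by rewrite !(mulr0, mul0r, normr0).
    have ha : `|F i j - a| <= om by apply: Fa => //; apply: bump_local; [right|left].
    rewrite !(normrM _ (F i j - a), normrM _ (bump _ _), normrM (dbump _ _)) (ger0_norm (bump_ge0 j _)).
    move: (dbump i _) (bump j _) (bump_ge0 j p.1.2) => d b b0.
    rewrite -!mulrA; do 2 (apply: ler_wpM2l => //).
    by rewrite mulrC ler_wpM2r.
  have [->|i0] := eqVneq (dbump j p.1.2) 0; first by rewrite !(mul0r, mulr0, normr0).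
  have [->|j0] := eqVneq (bump i p.1.1) 0; first by rewrite !(mulr0, mul0r, normr0).
  have ha : `|F i j - a| <= om by apply: Fa => //; apply: bump_local; [left|right].
  rewrite (normrM _ (F i j - a)) (normrM (bump _ _)) (normrM (dbump _ _)) (ger0_norm (bump_ge0 i _)).
  move: (dbump j _) (bump i _) (bump_ge0 i p.1.1) => d b b0.
  have -> : b * (`|d| * `|v.1.2|) * `|F i j - a| = `|d| * (`|v.1.2| * `|F i j - a| * b) by ring.
  by apply: ler_wpM2l => //; rewrite ler_wpM2r// ler_wpM2l.
have S1 := dbump_sum_abs m p.1.1 C0 hC; have S2 := dbump_sum_abs m p.1.2 C0 hC.
have AC : 0 <= A * (2 * C) by rewrite mulr_ge0 ?mulr_ge0// ltW.
apply: (le_trans (ler_norm_sum _ _ _)).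
apply: (@le_trans _ _ (\sum_(i < m) (`|dbump i p.1.1| * (`|v.1.1| * om) + (A * (2 * C) * (`|v.1.2| * om)) * bump i p.1.1))).
  apply: ler_sum => i _; apply: (le_trans (ler_norm_sum _ _ _)).
  apply: (le_trans (ler_sum _ (fun j _ => h i j))).
  rewrite big_split/= -mulr_sumr -mulr_suml; apply: lerD.
    by rewrite ler_piMr ?bump_sum_le1// mulr_ge0// mulr_ge0.
  by rewrite -(mulrA (A * _)); apply: ler_wpM2r => //; rewrite mulr_ge0 ?bump_ge0// mulr_ge0.
rewrite big_split/= -mulr_suml -mulr_sumr.
have -> : om * (A * (2 * C)) * (`|v.1.1| + `|v.1.2|) =
  A * (2 * C) * (`|v.1.1| * om) + A * (2 * C) * (`|v.1.2| * om) by ring.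
move: S1 (bump_sum_le1 m p.1.1).
move: (\sum_(i < m) _) (\sum_(i < m) bump _ _) (A * _) AC => s1 s2 k k0 h1 h2.
apply: lerD; first by apply: ler_wpM2r => //; rewrite mulr_ge0.
by rewrite ler_piMr// mulr_ge0// mulr_ge0.
Qed.

End Close.
End Interpolation.

(** * One backward step of the dual transport *)

Section DualStep.
Variable R : realType.
Local Notation P := (R * R)%type.
Local Notation V := (R * R * R)%type.
Implicit Types (psi : V -> R) (u p v : V).

Definition xsupported psi (r : R) := forall u, psi u != 0 -> `|u.1.1| <= r /\ `|u.1.2| <= r.

(** The missing term in v.2 also forces the time derivative to vanish: psi is a function of x
    regarded on space-time. *)
Definition xlipschitz psi (L : R) := forall p v, `|'D_v psi p| <= L * (`|v.1.1| + `|v.1.2|).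

Lemma derive_xsupported psi r v : xsupported psi r -> xsupported ('D_v psi) r.
Proof.
have cl (f : V -> R) : continuous f -> closed [set u | `|f u| <= r].
  move=> cf; apply: (@preimage_closed V R (fun u => `|f u|) [set x | x <= r]); last exact: closed_le.
  by move=> u _; apply: (@continuous_comp _ _ _ f (@Num.norm _ R)); [exact: cf|exact: norm_continuous].
have c : closed [set u : V | `|u.1.1| <= r /\ `|u.1.2| <= r].
  apply: closedI; apply: cl; apply: elem_continuous; [exact: elem_x1|exact: elem_x2].
exact: derive_closed_support.
Qed.

Variables (w : P -> R -> R) (T M : R).
Hypothesis mw : measurable_fun [set p : V | 0 <= p.2] (fun p => w p.1 p.2).
Hypothesis gw : forall s, 0 <= s <= T -> good M (w ^~ s).
Hypothesis weakw : weak_formulation w.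
Hypothesis M0 : 0 <= M.

Variables (Cd B : R) (N K : nat).
Hypothesis Cd0 : 0 <= Cd.
Hypothesis hCd : forall x : R, `|dstep x| <= Cd.
Hypothesis B0 : 0 <= B.
Hypothesis KE : K%:R = 2 ^+ N * B.

Local Notation A := (2 ^+ N : R).
Local Notation m := (2 * K).+1.
Local Notation grid := ('I_m * 'I_m * bool)%type.

Definition vcomp (b : bool) s x : R := if b then (helH (wx w s) x).1 else (helH (wx w s) x).2.

Definition gridvel s b (i j : nat) : R := vcomp b s (node A K i, node A K j).

(** The price of freezing the velocity at s0: a finite sum over nodes and components, hence
    measurable in s and controllable in L^1. *)
Definition gridvar (s0 s : R) : R :=
  \sum_(q : grid) `|gridvel s q.2 q.1.1 q.1.2 - gridvel s0 q.2 q.1.1 q.1.2|.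

Definition speed : R := cU R * M * (1 + B).
Definition modulus : R :=
  (cL R * (1 + 2 * B) ^+ 2 * (1 + B) + cU R) * M * (N.+1%:R * 2^-1 ^+ N).
(** The oscillation over one mesh divided by the mesh: the powers of 2 cancel and a multiple of N +
    1 remains. The outer 2 counts the two components of the field. *)
Definition lipconst : R := 2 * (modulus * (A * (2 * Cd))).

Lemma speed_ge0 : 0 <= speed.
Proof. by rewrite !mulr_ge0 ?cU_ge0 ?addr_ge0. Qed.

Lemma modulus_ge0 : 0 <= modulus.
Proof.
rewrite /modulus mulr_ge0 ?mulr_ge0 ?exprn_ge0//.
by rewrite addr_ge0 ?cU_ge0// !mulr_ge0 ?cL_ge0 ?exprn_ge0 ?addr_ge0// mulr_ge0.
Qed.

Lemma lipconst_ge0 : 0 <= lipconst.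
Proof.
rewrite /lipconst mulr_ge0// mulr_ge0 ?modulus_ge0// mulr_ge0 ?exprn_ge0//.
by rewrite mulr_ge0.
Qed.

Lemma vcomp_bound b s x : 0 <= s <= T -> `|x| <= B -> `|vcomp b s x| <= speed.
Proof.
move=> sT xB; have g : good M (wx w s) by rewrite wxE; [exact: gw|case/andP: sT].
apply: (@le_trans _ _ `|helH (wx w s) x|).
  by rewrite /vcomp; case: b; [exact: norm_fst|exact: norm_snd].
by apply: (le_trans (helH_bound x g)); rewrite ler_wpM2l ?lerD2l// mulr_ge0 ?cU_ge0.
Qed.

Lemma measurable_vcomp b x : measurable_fun setT (fun s : measurableTypeR R => vcomp b s x).
Proof.
have [m1 m2] := measurable_helH mw.
have pr : measurable_fun setT (fun s : measurableTypeR R => (x, s) : P * measurableTypeR R).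
  by apply: measurable_fun_pair; [exact: measurable_cst|exact: measurable_id].
rewrite /vcomp; case: b.
  exact: (measurableT_comp (f := fun p : V => (helH (wx w p.2) p.1).1) m1 pr).
exact: (measurableT_comp (f := fun p : V => (helH (wx w p.2) p.1).2) m2 pr).
Qed.

Lemma vcomp_close b s x x' : 0 <= s <= T -> `|x| <= B -> `|x'| <= B ->
  `|x - x'| <= 2^-1 ^+ N -> `|vcomp b s x - vcomp b s x'| <= modulus.
Proof.
move=> sT xB x'B xx; have g : good M (wx w s) by rewrite wxE; [exact: gw|case/andP: sT].
apply: le_trans (helH_log_lipschitz g xB x'B xx).
by rewrite /vcomp; case: b; [exact: (norm_fst (_ - _))|exact: (norm_snd (_ - _))].
Qed.

Lemma pair_norm_le (x : P) (c : R) : `|x.1| <= c -> `|x.2| <= c -> `|x| <= c.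
Proof.
by move=> h1 h2; have -> : `|x| = Num.max `|x.1| `|x.2| by []; rewrite ge_max h1.
Qed.

Lemma A_gt0 : 0 < A. Proof. by rewrite exprn_gt0. Qed.

Lemma AV : A^-1 = 2^-1 ^+ N. Proof. by rewrite exprVn. Qed.

Lemma gridvel_close b s i j (p : V) : 0 <= s <= T -> (i < m)%N -> (j < m)%N ->
  `|p.1.1| <= B -> `|p.1.2| <= B ->
  `|node A K i - p.1.1| <= A^-1 -> `|node A K j - p.1.2| <= A^-1 ->
  `|gridvel s b i j - vcomp b s p.1| <= modulus.
Proof.
move=> sT im jm p1 p2 h1 h2; apply: vcomp_close => //.
- by apply: pair_norm_le => /=; apply: node_bound => //; exact: A_gt0.
- exact: pair_norm_le.
- by apply: pair_norm_le; rewrite -AV.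
Qed.

Section Field.
Variable s0 : R.
Hypothesis s0T : 0 <= s0 <= T.

Definition field b : V -> R := interp A K (gridvel s0 b).
Definition dfield b : V -> V -> R := dinterp A K (gridvel s0 b).

Lemma elem_field b : elem (field b). Proof. exact: elem_interp. Qed.

Lemma derive_field b p v : 'D_v (field b) p = dfield b p v.
Proof. exact: derive_interp. Qed.

Lemma field_bound b p : `|field b p| <= speed.
Proof.
apply: interp_bound => i j im jm; apply: vcomp_bound => //.
by apply: pair_norm_le => /=; apply: node_bound => //; exact: A_gt0.
Qed.

Lemma gridvar_ge b s i j : (i < m)%N -> (j < m)%N ->
  `|gridvel s b i j - gridvel s0 b i j| <= gridvar s0 s.
Proof.
move=> im jm; rewrite /gridvar (bigD1 (Ordinal im, Ordinal jm, b))//= lerDl.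
by apply: sumr_ge0 => q _.
Qed.

Lemma gridvar_ge0 s : 0 <= gridvar s0 s.
Proof. exact: sumr_ge0. Qed.

Lemma field_close b s p : 0 <= s <= T -> `|p.1.1| <= B -> `|p.1.2| <= B ->
  `|vcomp b s p.1 - field b p| <= modulus + gridvar s0 s.
Proof.
move=> sT p1 p2; rewrite distrC; apply: (@interp_close _ _ _ _ A_gt0 KE) => //.
- by rewrite addr_ge0 ?modulus_ge0 ?gridvar_ge0.
move=> i j im jm h1 h2.
have := gridvel_close b sT im jm p1 p2 h1 h2; have := gridvar_ge b s im jm.
move: (gridvel s b i j) (gridvel s0 b i j) (vcomp b s p.1) modulus (gridvar s0 s) => x y z a c h3 h4.
have -> : y - z = (x - z) - (x - y) by ring.
by apply: (le_trans (ler_normB _ _)); exact: lerD.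
Qed.

Lemma dfield_bound b p v : `|p.1.1| <= B -> `|p.1.2| <= B ->
  `|dfield b p v| <= lipconst / 2 * (`|v.1.1| + `|v.1.2|).
Proof.
move=> p1 p2; have -> : lipconst / 2 = modulus * (A * (2 * Cd)) by rewrite /lipconst; field.
apply: (@dinterp_bound _ _ _ _ A_gt0 KE _ p (vcomp b s0 p.1)) => //.
- exact: modulus_ge0.
move=> i j im jm; exact: gridvel_close.
Qed.

End Field.

(* psi' is the value at t1 of phi (x, s) = psi (x + (t2 - s) beta x).  With b the
   velocity, d/ds phi + b . grad phi is the derivative of psi in the direction
   b - beta + (t2 - s) D beta b. *)
Lemma dual_step psi r L t1 t2 s0 E : 0 <= t1 -> t1 <= t2 -> t2 <= T -> 0 <= s0 <= T ->
  elem psi -> (forall u, 0 <= psi u) -> xsupported psi r -> 0 <= L -> xlipschitz psi L ->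
  r + (t2 - t1) * speed <= B -> 
  (\int[leb1 R]_(s in `]t1, t2])
    (L * (2 * (modulus + gridvar s0 s + (t2 - t1) * (lipconst * speed))) * M)%:E <= E%:E)%E ->
  exists psi', [/\ elem psi', forall u, 0 <= psi' u,
    xsupported psi' (r + (t2 - t1) * speed),
    xlipschitz psi' (L * (1 + (t2 - t1) * lipconst)) &
    `|\int[leb2 R]_x (w x t2 * psi (x, 0)) - \int[leb2 R]_x (w x t1 * psi' (x, 0))| <= E].
Proof.
move=> t10 t12 t2T s0T epsi psi0 xpsi L0 lpsi rB hE.
have h0 : 0 <= t2 - t1 by rewrite subr_ge0.
have T0 : 0 <= T by apply: le_trans t2T; apply: le_trans t12.
have sp0 := speed_ge0; have lc0 := lipconst_ge0.
pose fi b := field s0 b; have efi b : elem (fi b) := elem_field s0 b.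
have fib b p : `|fi b p| <= speed := field_bound s0T b p.
have inB (tau : R) p (b : bool) (z : R) : 0 <= tau <= t2 - t1 -> `|z + tau * fi b p| <= r ->
    `|z| <= r + (t2 - t1) * speed.
  move=> /andP[a0 a1] hz; have -> : z = (z + tau * fi b p) - tau * fi b p by ring.
  apply: (le_trans (ler_normB _ _)); apply: lerD => //; rewrite normrM (ger0_norm a0).
  exact: ler_pM.
pose X b (c : V -> R) p := c p + (t2 - p.2) * fi b p.
have eX b c : elem c -> elem (X b c).
  move=> ec; apply: elem_add => //; apply: elem_mul => //.
  by apply: elem_sub; [exact: elem_cst|exact: elem_x3].
pose c1 (u : V) := u.1.1; pose c2 (u : V) := u.1.2.
have eX1 : elem (X true c1) by apply: eX; exact: elem_x1.
have eX2 : elem (X false c2) by apply: eX; exact: elem_x2.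
have dX b c p v : elem c -> 'D_v (X b c) p = 'D_v c p + (t2 - p.2) * dfield s0 b p v - v.2 * fi b p.
  move=> ec; have e1 : elem (fun u : V => t2 - u.2).
    by apply: elem_sub; [exact: elem_cst|exact: elem_x3].
  rewrite (derive_elemD _ _ ec (elem_mul e1 (efi b))) (derive_elemM _ _ e1 (efi b)).
  rewrite derive_field (derive_elemB _ _ (elem_cst _) (elem_x3 R)) derive_elemC derive_x3.
  by move: (fi b p) (dfield _ _ _ _) ('D_v c p) => x y z; ring.
pose zero : V -> R := fun=> 0; have ez : elem zero := elem_cst 0.
pose phi0 p := psi (X true c1 p, X false c2 p, zero p).
have ephi0 : elem phi0 by exact: elem_comp.
pose phi p := phi0 p * cut T p.
have ephi : elem phi by apply: elem_mul => //; exact: elem_cut.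
(* Compactness is needed over all times seen by the cut-off, negative ones included, hence a cruder
   radius than on [t1, t2]. *)
have sphi : supported phi (`|B| + (`|t2| + 2 * (T + 1)) * speed + 2 * (T + 1)).
  move=> p hp.
  have c0 : cut T p != 0 by apply: contra_neq hp; rewrite /phi => ->; rewrite mulr0.
  have p0 : phi0 p != 0 by apply: contra_neq hp; rewrite /phi => ->; rewrite mul0r.
  have [h1 h2] := xpsi _ p0; have h3 := cut_support T0 c0.
  have rB' : r <= `|B|.
    by apply: (le_trans _ (ler_norm B)); apply: le_trans rB; rewrite lerDl mulr_ge0.
  have k b (z : R) : `|z + (t2 - p.2) * fi b p| <= r -> `|z| <= `|B| + (`|t2| + 2 * (T + 1)) * speed.
    move=> hz; have -> : z = (z + (t2 - p.2) * fi b p) - (t2 - p.2) * fi b p by ring.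
    apply: (le_trans (ler_normB _ _)); apply: lerD; first exact: (le_trans hz).
    rewrite normrM; apply: ler_pM => //; apply: (le_trans (ler_normB _ _)); exact: lerD.
  have q0 : 0 <= (`|t2| + 2 * (T + 1)) * speed.
    by rewrite mulr_ge0// addr_ge0// mulr_ge0// addr_ge0.
  have T1 : 0 <= 2 * (T + 1) by rewrite mulr_ge0// addr_ge0.
  split.
  - by apply: (le_trans (k true _ h1)); rewrite lerDl.
  - by apply: (le_trans (k false _ h2)); rewrite lerDl.
  - by apply: (le_trans h3); rewrite lerDr addr_ge0.
have dphi0 p v : 'D_v phi0 p =
    'D_(((v.1.1 + (t2 - p.2) * dfield s0 true p v - v.2 * fi true p,
          v.1.2 + (t2 - p.2) * dfield s0 false p v - v.2 * fi false p), 0) : V)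
      psi (X true c1 p, X false c2 p, 0).
  rewrite (derive_elem_comp _ _ epsi eX1 eX2 ez) !dX; [|exact: elem_x2|exact: elem_x1].
  by rewrite derive_x1 derive_x2 derive_elemC.
(* Displacements are at most (t2 - t1) [speed], so only points of the box contribute, where the
   interpolated field is close to the velocity. *)
have dphi0_in p v : t1 <= p.2 <= t2 -> 'D_v phi0 p != 0 -> `|p.1.1| <= B /\ `|p.1.2| <= B.
  move=> /andP[pt1 pt2]; rewrite dphi0 => /(derive_xsupported xpsi)/= [h1 h2].
  have tau : 0 <= t2 - p.2 <= t2 - t1 by rewrite subr_ge0 pt2 lerD2l lerN2.
  by split; [apply: (le_trans (inB _ _ _ _ tau h1))|apply: (le_trans (inB _ _ _ _ tau h2))].
pose psi' (u : V) := psi (u.1.1 + (t2 - t1) * fi true u, u.1.2 + (t2 - t1) * fi false u, 0).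
have psi'E p : psi' p = phi0 (p.1, t1) by [].
have dpsi' p v : 'D_v psi' p = 'D_((v.1, 0) : V) phi0 (p.1, t1).
  have -> : psi' = fun u => phi0 (u.1.1, u.1.2, t1) by apply/funext => -[[? ?] ?].
  rewrite (derive_elem_comp _ _ ephi0 (elem_x1 R) (elem_x2 R) (elem_cst t1)).
  by rewrite derive_x1 derive_x2 derive_elemC; case: p v => [[? ?] ?] [[? ?] ?].
exists psi'; split.
- have e (b : bool) c : elem c -> elem (fun u => c u + (t2 - t1) * fi b u).
    by move=> ec; apply: elem_add => //; apply: elem_mul => //; exact: elem_cst.
  by apply: (elem_comp epsi _ _ ez); [apply: (e true); exact: elem_x1|apply: (e false); exact: elem_x2].
- by move=> u; exact: psi0.
- have tau : 0 <= t2 - t1 <= t2 - t1 by rewrite h0 lexx.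
  by move=> u /xpsi/= [h1 h2]; split; [exact: (inB _ _ _ _ tau h1)|exact: (inB _ _ _ _ tau h2)].
- move=> p v; rewrite dpsi'; have [->|nz] := eqVneq ('D_((v.1, 0) : V) phi0 (p.1, t1)) 0.
    by rewrite normr0 !mulr_ge0 ?addr_ge0// mulr_ge0.
  have [|p1 p2] := dphi0_in _ _ _ nz; first by rewrite /= lexx.
  rewrite dphi0; apply: (le_trans (lpsi _ _)); rewrite -mulrA; apply: ler_wpM2l => //=.
  have k b := @dfield_bound s0 s0T b (p.1, t1) (v.1, 0) p1 p2.
  rewrite !mul0r !subr0.
  move: (dfield s0 true _ _) (dfield s0 false _ _) (k true) (k false) => d1 d2 /= k1 k2.
  have k3 (z d : R) : `|d| <= lipconst / 2 * (`|v.1.1| + `|v.1.2|) ->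
      `|z + (t2 - t1) * d| <= `|z| + (t2 - t1) * (lipconst / 2 * (`|v.1.1| + `|v.1.2|)).
    move=> hd; apply: (le_trans (ler_normD _ _)); rewrite lerD2l normrM (ger0_norm h0).
    exact: ler_wpM2l.
  apply: (le_trans (lerD (k3 _ _ k1) (k3 _ _ k2))).
  by rewrite le_eqVlt; apply/orP; left; apply/eqP; field.
(* At s = t2 the displacement vanishes and phi is psi; at s = t1 it is [psi'] by construction. *)
have I2 : \int[leb2 R]_x (w x t2 * psi (x, 0)) = \int[leb2 R]_x (w x t2 * phi (x, t2)).
  apply: eq_Rintegral => x _; rewrite /phi cut_eq1//; last by rewrite /= ger0_norm// (le_trans t10).
  by rewrite mulr1 /phi0 /X /= subrr !mul0r !addr0; case: x.
have I1 : \int[leb2 R]_x (w x t1 * psi' (x, 0)) = \int[leb2 R]_x (w x t1 * phi (x, t1)).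
  apply: eq_Rintegral => x _; rewrite /phi cut_eq1//; last by rewrite /= ger0_norm// (le_trans t12).
  by rewrite mulr1 psi'E.
rewrite I1 I2.
have me : measurable_fun setT (fun s => L * (2 * (modulus + gridvar s0 s + (t2 - t1) * (lipconst * speed))) * M).
  apply: measurable_funM => //; apply: measurable_funM => //; apply: measurable_funM => //.
  apply: measurable_funD => //; apply: measurable_funD => //.
  apply: measurable_sum => q; apply: measurableT_comp => //; apply: measurable_funB => //.
  exact: measurable_vcomp.
apply: (@weak_increment R w T M mw gw weakw phi _ _ E t1 t2 ephi sphi t10 t12 t2T me _ hE).
move=> s /andP[t1s st2].
have sT : 0 <= s <= T by rewrite (le_trans t10 (ltW t1s)) (le_trans st2).
have gv0 := gridvar_ge0 s0 s; have mo0 := modulus_ge0.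
apply: (flux_bound mw gw) => //.
  by rewrite mulr_ge0// mulr_ge0// !addr_ge0// mulr_ge0// mulr_ge0.
move=> x.
(* The material derivative is the directional derivative along the space-time velocity (b, 1), to
   which the chain rule applies at once. *)
have -> : transport w phi (x, s) = 'D_((vcomp true s x, vcomp false s x, 1) : V) phi (x, s).
  rewrite (derive_elem_lin _ _ ephi) /transport /dt /gradx /dot2 /vcomp /= mul1r.
  by rewrite addrC.
set v : V := (_, _, 1).
have -> : 'D_v phi (x, s) = 'D_v phi0 (x, s).
  have sT' : `|(x, s).2| <= T by case/andP: sT => s00 ?; rewrite /= ger0_norm.
  rewrite (derive_elemM _ _ ephi0 (elem_cut T)) derive_cut_eq0// mulr0 add0r cut_eq1// mul1r//.
have [->|nz] := eqVneq ('D_v phi0 (x, s)) 0.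
  by rewrite normr0 mulr_ge0// mulr_ge0// !addr_ge0// mulr_ge0// mulr_ge0.
have [|p1 p2] := dphi0_in _ _ _ nz; first by rewrite /= st2 ltW.
rewrite dphi0; apply: (le_trans (lpsi _ _)); apply: ler_wpM2l => //.
have xB : `|x| <= B by exact: pair_norm_le.
have k b : `|vcomp b s x + (t2 - s) * dfield s0 b (x, s) v - 1 * fi b (x, s)| <=
    modulus + gridvar s0 s + (t2 - t1) * (lipconst * speed).
  have k1 := @field_close s0 b s (x, s) sT p1 p2.
  have k2 := @dfield_bound s0 s0T b (x, s) v p1 p2.
  have k3 : lipconst / 2 * (`|v.1.1| + `|v.1.2|) <= lipconst * speed.
    have -> : lipconst * speed = lipconst / 2 * (speed + speed) by field.
    apply: ler_wpM2l; first by rewrite divr_ge0.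
    by apply: lerD; exact: vcomp_bound.
  move: (dfield _ _ _ _) k2 => d k2.
  have -> : vcomp b s x + (t2 - s) * d - 1 * fi b (x, s) =
    (vcomp b s (x, s).1 - fi b (x, s)) + (t2 - s) * d by rewrite /=; ring.
  apply: (le_trans (ler_normD _ _)); apply: lerD; first exact: k1.
  rewrite normrM ger0_norm ?subr_ge0//; apply: ler_pM => //; rewrite ?subr_ge0//.
    by rewrite lerD2l lerN2 ltW.
  exact: (le_trans k2).
have -> : 2 * (modulus + gridvar s0 s + (t2 - t1) * (lipconst * speed)) =
  (modulus + gridvar s0 s + (t2 - t1) * (lipconst * speed)) +
  (modulus + gridvar s0 s + (t2 - t1) * (lipconst * speed)) by rewrite mulrDl mul1r.
exact: lerD (k true) (k false).
Qed.

End DualStep.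

(** * Choice of the freezing times *)

Section Sampling.
Variable R : realType.
Local Notation lT := (measurableTypeR R).

(** Uniform continuity near a compact interval, through the covering form of compactness; y may
    leave [a, b]. *)
Lemma uniform_modulus (g : R -> R) (a b c eta : R) : continuous g -> 0 < eta -> 
  \forall n \near \oo, forall x y, a <= x <= b -> `|x - y| <= c / n.+1%:R -> `|g x - g y| <= eta.
Proof.
move=> cg eta0.
pose Q (n : nat) x := forall y, `|x - y| <= c / n.+1%:R -> `|g x - g y| <= eta.
suff : \forall n \near \oo, `[a, b]%classic `<=` Q n.
  by apply: filterS => n hn x y xab; apply: hn; rewrite /= in_itv.
apply: (proj1 (compact_near_coveringP _) (@segment_compact R a b)) => x xab.
have eta2 : 0 < eta / 2 by rewrite divr_gt0.
have /cvgrPdist_lt /(_ _ eta2) /nbhs_ballP[d /= d0 hd] := cg x.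
have d2 : 0 < d / 2 by rewrite divr_gt0.
exists (ball x (d / 2), [set n | `|c / n.+1%:R| < d / 2]).
  split => /=; first exact: nbhsx_ballx.
  have cc : c / n.+1%:R @[n --> \oo] --> (0 : R).
    by rewrite -(mulr0 c); apply: cvgMr; exact: cvg_harmonic.
  have /cvgrPdist_lt /(_ _ d2) := cc; apply: filterS => n /=.
  by rewrite sub0r normrN.
move=> [x' n] /= [] ; rewrite /ball/= => xx' hn y xy.
have h1 : `|g x - g x'| < eta / 2 by apply: hd; rewrite /ball/=; lra.
have h2 : `|g x - g y| < eta / 2.
  apply: hd; rewrite /ball/=; have -> : x - y = (x - x') + (x' - y) by ring.
  apply: (le_lt_trans (ler_normD _ _)).
  have cn := ler_norm (c / n.+1%:R).
  have := lt_le_trans xx' (lexx _); move: (_ / n.+1%:R) cn hn xy => z cn hn xy; lra.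
have -> : g x' - g y = (g x - g y) - (g x - g x') by ring.
apply: (le_trans (ler_normB _ _)); lra.
Qed.

Lemma lebesgue_measure_itvoc (a b : R) : a <= b -> leb1 R `]a, b] = (b - a)%:E.
Proof.
move=> ab; have := @lebesgue_measure_itv R `]a, b]; rewrite /= lte_fin => ->.
case: ifPn => [_|]; first by rewrite -EFinB.
by rewrite -leNgt => ba; have -> : a = b by [apply/le_anti/andP|]; rewrite subrr.
Qed.

Lemma integral_cst_itvoc (a b c : R) : a <= b ->
  (\int[leb1 R]_(s in `]a, b]) c%:E = (c * (b - a))%:E)%E.
Proof.
move=> ab; rewrite integral_cst//; have := lebesgue_measure_itvoc ab.
by rewrite /= => ->; rewrite EFinM.
Qed.

Definition grid_time (a tau : R) (n k : nat) : R := a + k%:R * (tau / n.+1%:R).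

(** Density of continuous functions in L^1 on a bounded interval, for each member of the finite
    family separately. *)
Lemma approximation_family (J : finType) (f : J -> R -> R) (a b Kb eta : R) : a <= b ->
  0 < eta -> (forall j, measurable_fun setT (f j : lT -> R)) ->
  (forall j s, a < s <= b -> `|f j s| <= Kb) ->
  exists g : J -> R -> R, (forall j, continuous (g j)) /\
    (\int[leb1 R]_(s in `]a, b]) (\sum_(j : J) `|f j s - g j s|)%:E <= (#|J|%:R * eta)%:E)%E.
Proof.
move=> ab eta0 mf fK.
have mD : measurable (`]a, b]%classic : set lT) by [].
have muD : (leb1 R `]a, b] < +oo)%E by rewrite lebesgue_measure_itvoc// ltry.
have appr j : exists g : R -> R, continuous g /\
    (\int[leb1 R]_(s in `]a, b]) (`|f j s - g s|)%:E <= eta%:E)%E.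
  have fi : (leb1 R).-integrable `]a, b] (EFin \o f j).
    apply: (proj1 (@integral_bound _ lT R (leb1 R) _ (fun=> Kb) _ (Kb * (b - a)) _ _ _ _ _)) => //.
    - exact: measurable_funTS.
    - by move=> s /=; rewrite in_itv/=; exact: fK.
    - by rewrite integral_cst_itvoc.
  have [g [cg _ lg]] := approximation_continuous_integrable mD muD fi.
  have /fine_cvgP[fin /cvgrPdist_lt /(_ _ eta0) lg'] := lg.
  near \oo => n; exists (g n); split => //.
  have /= h1 : (\int[leb1 R]_(z in `]a, b]) `|(f j z - g n z)%:E|)%E \is a fin_num by near: n.
  have /= h2 : `|0 - fine (\int[leb1 R]_(z in `]a, b]) `|(f j z - g n z)%:E|)%E| < eta by near: n.
  rewrite -[leLHS]fineK// lee_fin; apply: (le_trans (ler_norm _)).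
  by rewrite -normrN -(sub0r (fine _)) ltW.
have [g hg] := choice appr; exists g; split => [j|]; first by case: (hg j).
under eq_integral do rewrite -sumEFin.
rewrite (@ge0_integral_sum _ lT R (leb1 R) _ mD) //.
  apply: (@le_trans _ _ (\sum_(j : J) eta%:E)%E); first by apply: lee_sum => j _; case: (hg j).
  by rewrite sumEFin lee_fin sumr_const mulr_natl.
move=> j; apply/measurable_EFinP; apply: measurableT_comp => //; apply: measurable_funB.
  exact: measurable_funTS.
by apply: measurable_funTS; apply: continuous_measurable_fun; case: (hg j).
Unshelve. all: by end_near.
Qed.

Lemma Rintegral_itv_telescope (F : R -> R) (t : nat -> R) n :
  (forall k, t k <= t k.+1) -> (leb1 R).-integrable `]t 0%N, t n] (EFin \o F) ->
  (forall s, 0 <= F s) ->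
  \sum_(k < n) \int[leb1 R]_(s in `]t k, t k.+1]) F s <= \int[leb1 R]_(s in `]t 0%N, t n]) F s.
Proof.
move=> tm + F0; have t0 k : t 0%N <= t k by elim: k => // k IH; apply: (le_trans IH).
elim: n => [|n IH] fi; first by rewrite big_ord0; apply: Rintegral_ge0.
have fn : (leb1 R).-integrable `]t 0%N, t n] (EFin \o F).
  apply: integrableS fi => //; apply: subset_itvl; rewrite bnd_simp; exact: tm.
rewrite big_ord_recr/= -(@Rintegral_itvB _ _ _ _ (t n) fi); last 2 first.
- by rewrite bnd_simp; exact: t0.
- by rewrite bnd_simp; exact: tm.
by have := IH fn; lra.
Qed.

(* Freezing a bounded measurable family at suitable times [sm k] costs little in
   L^1: approximate it by continuous functions and pick in each interval a time
   where the approximation error is at most its mean. *)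
Lemma sampling (J : finType) (f : J -> R -> R) (a tau Kb eps : R) : 0 < tau -> 0 < eps ->
  (forall j, measurable_fun setT (f j : lT -> R)) ->
  (forall j s, a < s <= a + tau -> `|f j s| <= Kb) ->
  \forall n \near \oo, exists sm e : nat -> R, \sum_(k < n.+1) e k <= eps /\
    forall k, (k < n.+1)%N ->
      [/\ grid_time a tau n k < sm k <= grid_time a tau n k.+1, 0 <= e k &
      (\int[leb1 R]_(s in `]grid_time a tau n k, grid_time a tau n k.+1])
         (\sum_(j : J) `|f j s - f j (sm k)|)%:E <= (e k)%:E)%E].
Proof.
move=> tau0 eps0 mf fK.
pose eta := eps / (2 * (#|J|%:R + 1) * (2 + tau)).
have J0 : 0 <= #|J|%:R :> R by [].
have eta0 : 0 < eta by rewrite divr_gt0// mulr_gt0 ?mulr_gt0//; lra.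
have etaE : #|J|%:R * eta * (2 + tau) <= eps / 2.
  have -> : #|J|%:R * eta * (2 + tau) = (eps / 2) * (#|J|%:R / (#|J|%:R + 1)).
    by rewrite /eta; field; apply/andP; split; rewrite gt_eqF//; lra.
  by rewrite ler_piMr ?divr_ge0 ?(ltW eps0)// ler_pdivrMr ?mul1r; lra.
have ab : a <= a + tau by lra.
have [g [cg hg]] := approximation_family ab eta0 mf fK.
pose F s := \sum_(j : J) `|f j s - g j s|.
have F0 s : 0 <= F s by apply: sumr_ge0.
have mF : measurable_fun setT (F : lT -> R).
  apply: measurable_sum => j; apply: measurableT_comp => //; apply: measurable_funB => //.
  by apply: continuous_measurable_fun; exact: cg.
have [iF bF] : (leb1 R).-integrable `]a, (a + tau)] (EFin \o F) /\
    `|\int[leb1 R]_(s in `]a, (a + tau)]) F s| <= #|J|%:R * eta.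
  apply: (@integral_bound _ lT R (leb1 R) _ F _ _ _ _ _ _ hg) => //.
  - exact: measurable_funTS.
  - exact: measurable_funTS.
  - by move=> s _; rewrite ger0_norm.
have U : \forall n \near \oo, forall j x y, a <= x <= a + tau -> `|x - y| <= tau / n.+1%:R ->
    `|g j x - g j y| <= eta.
  by apply: filter_forall => j; exact: uniform_modulus.
apply: filterS U => n U.
pose h := tau / n.+1%:R; pose t (k : nat) := grid_time a tau n k.
have n0 : 0 < n.+1%:R :> R by [].
have h0 : 0 < h by rewrite divr_gt0.
have tS k : t k.+1 = t k + h by rewrite /t /grid_time -natr1 -/h; ring.
have tm k : t k <= t k.+1 by rewrite tS lerDl ltW.
have t00 : t 0%N = a by rewrite /t /grid_time mul0r addr0.
have tn : t n.+1 = a + tau by rewrite /t /grid_time mulrC divfK// gt_eqF.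
have tle k : (k <= n.+1)%N -> t k <= a + tau.
  move=> kn; rewrite -tn /t /grid_time lerD2l ler_wpM2r ?(ltW h0)// ler_nat//.
have tge k : a <= t k by rewrite /t /grid_time lerDl mulr_ge0// ltW.
pose Ak k := \int[leb1 R]_(s in `]t k, t k.+1]) F s.
have Ak0 k : 0 <= Ak k by apply: Rintegral_ge0.
have iFk k : (k < n.+1)%N -> (leb1 R).-integrable `]t k, t k.+1] (EFin \o F).
  move=> kn; apply: integrableS iF => //; apply: subset_itv; rewrite bnd_simp ?tge//.
  exact: tle.
have AkE k : (k < n.+1)%N -> (\int[leb1 R]_(s in `]t k, t k.+1]) (F s)%:E)%E = (Ak k)%:E.
  by move=> kn; rewrite fineK//; apply: integrable_fin_num => //; exact: iFk.
(* A positive slack: if the error exceeded its mean by this much throughout an interval, integration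
   would give a contradiction. *)
pose dl := eps / 2 / n.+1%:R.
have dl0 : 0 < dl by rewrite !divr_gt0.
have ck k c : (\int[leb1 R]_(s in `]t k, t k.+1]) c%:E = (c * h)%:E)%E.
  by rewrite integral_cst_itvoc// tS; congr (_%:E); ring.
have ex k : exists s, (k < n.+1)%N -> t k < s <= t k.+1 /\ F s <= (Ak k + dl) / h.
  have [kn|] := boolP (k < n.+1)%N; last by exists 0.
  apply: contrapT => nex.
  have Fge s : t k < s <= t k.+1 -> (Ak k + dl) / h <= F s.
    move=> sk; rewrite leNgt; apply/negP => Fs; apply: nex; exists s => _; split=> //; exact: ltW.
  have : (((Ak k + dl) / h * h)%:E <= (Ak k)%:E)%E.
    rewrite -(AkE _ kn) -(ck k).
    apply: ge0_le_integral => //.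
    - by move=> s _; rewrite lee_fin divr_ge0 ?(ltW h0)// addr_ge0// ltW.
    - by apply/measurable_EFinP; exact: measurable_funTS.
  by rewrite lee_fin divfK ?gt_eqF//; lra.
have [sm hsm] := choice ex.
exists sm, (fun k => 2 * Ak k + dl + #|J|%:R * eta * h); split.
  have -> : \sum_(k < n.+1) (2 * Ak k + dl + #|J|%:R * eta * h) =
      2 * (\sum_(k < n.+1) Ak k) + dl * n.+1%:R + #|J|%:R * eta * h * n.+1%:R.
    have cs (x : R) : x * n.+1%:R = \sum_(k < n.+1) x by rewrite sumr_const card_ord mulr_natr.
    by rewrite (cs dl) (cs (_ * h)) mulr_sumr -big_split -big_split.
  have -> : dl * n.+1%:R = eps / 2 by rewrite /dl divfK// gt_eqF.
  have -> : #|J|%:R * eta * h * n.+1%:R = #|J|%:R * eta * tau.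
    by rewrite -mulrA /h divfK// gt_eqF.
  have S : \sum_(k < n.+1) Ak k <= #|J|%:R * eta.
    have := @Rintegral_itv_telescope F t n.+1 tm; rewrite t00 tn => /(_ iF F0) S.
    by apply: (le_trans S); apply: le_trans bF; exact: ler_norm.
  move: S etaE; move: (\sum_(k < n.+1) _) (_ * eta) => S z; lra.
move=> k kn; have [sk Fs] := hsm k kn; split => //.
  apply: addr_ge0; first by apply: addr_ge0; [exact: mulr_ge0|exact: ltW].
  by apply: mulr_ge0; [apply: mulr_ge0 => //; exact: ltW|exact: ltW].
have -> : 2 * Ak k + dl + #|J|%:R * eta * h = Ak k + (#|J|%:R * eta + (Ak k + dl) / h) * h.
  by rewrite (mulrDl (_ * eta)) divfK ?gt_eqF//; ring.
rewrite EFinD -(AkE _ kn) -(ck k) -ge0_integralD//; last first.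
- move=> s _; rewrite lee_fin; apply: addr_ge0; first by apply: mulr_ge0 => //; exact: ltW.
  by apply: divr_ge0; [apply: addr_ge0 => //; exact: ltW|exact: ltW].
- by apply/measurable_EFinP; exact: measurable_funTS.
- by move=> s _; rewrite lee_fin.
apply: ge0_le_integral => //.
- by move=> s _; rewrite lee_fin sumr_ge0.
- apply/measurable_EFinP; apply: measurable_funTS; apply: measurable_sum => j.
  by apply: measurableT_comp => //; apply: measurable_funB.
- apply: emeasurable_funD => //; apply/measurable_EFinP; exact: measurable_funTS.
move=> s; rewrite /= in_itv/= => st; rewrite -EFinD lee_fin.
apply: (@le_trans _ _ (F s + (\sum_(j : J) eta + F (sm k)))); last first.
  by apply: lerD => //; apply: lerD => //; rewrite sumr_const mulr_natl.
rewrite /F -!big_split/=; apply: ler_sum => j _.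
have -> : f j s - f j (sm k) = (f j s - g j s) + ((g j s - g j (sm k)) - (f j (sm k) - g j (sm k))) by ring.
apply: (le_trans (ler_normD _ _)); rewrite lerD2l; apply: (le_trans (ler_normB _ _)).
rewrite lerD2r; have /andP[s1 s2] := st; have /andP[s3 s4] := sk.
apply: U.
  by rewrite (le_trans (tge k) (ltW s1)) (le_trans s2)// tle.
rewrite ler_norml; move: s1 s2 s3 s4; rewrite -/(t k) -/(t k.+1) tS /h.
move: (t k) (tau / _) => u z s1 s2 s3 s4; lra.
Qed.

End Sampling.

Ltac nneg := repeat first [done | by apply: ltW | apply: mulr_ge0 | apply: addr_ge0
  | apply: exprn_ge0].

(** * Propagation of positivity *)

Section Positivity.
Variable R : realType.
Local Notation P := (R * R)%type.
Local Notation V := (R * R * R)%type.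
Local Notation lT := (measurableTypeR R).
Implicit Types (psi : V -> R).

Variables (w : P -> R -> R) (T M : R).
Hypothesis mw : measurable_fun [set p : V | 0 <= p.2] (fun p => w p.1 p.2).
Hypothesis gw : forall s, 0 <= s <= T -> good M (w ^~ s).
Hypothesis weakw : weak_formulation w.
Hypothesis M0 : 0 <= M.

(** Non-negativity of w(t) tested on supports of radius r. The Lipschitz constant is left
    existential since it deteriorates along the propagation. *)
Definition positive_at (t r : R) := forall psi, elem psi -> (forall u, 0 <= psi u) ->
  xsupported psi r -> (exists L, 0 <= L /\ xlipschitz psi L) ->
  0 <= \int[leb2 R]_x (w x t * psi (x, 0)).

Section Block.
Variables (Cd B : R) (N K : nat).
Hypothesis Cd0 : 0 <= Cd.
Hypothesis hCd : forall x : R, `|dstep x| <= Cd.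
Hypothesis B0 : 0 <= B.
Hypothesis KE : K%:R = 2 ^+ N * B.

Local Notation m := (2 * K).+1.
Local Notation grid := ('I_m * 'I_m * bool)%type.
Local Notation om := (modulus M B N).
Local Notation lam := (lipconst M Cd B N).
Local Notation sp := (speed M B).

Lemma measurable_gridvar s0 : measurable_fun setT (gridvar w N K s0 : lT -> R).
Proof.
apply: measurable_sum => q; apply: measurableT_comp => //; apply: measurable_funB => //.
exact: measurable_vcomp.
Qed.

Lemma integral_affine_gridvar (t1 t2 s0 c1 c2 e : R) : t1 <= t2 -> 0 <= c1 -> 0 <= c2 ->
  (\int[leb1 R]_(s in `]t1, t2]) (gridvar w N K s0 s)%:E <= e%:E)%E ->
  (\int[leb1 R]_(s in `]t1, t2]) (c1 + c2 * gridvar w N K s0 s)%:E <=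
    (c1 * (t2 - t1) + c2 * e)%:E)%E.
Proof.
move=> t12 c10 c20 he; have mg := measurable_gridvar s0.
have mg' : measurable_fun `]t1, t2] (fun s : lT => (gridvar w N K s0 s)%:E).
  by apply/measurable_EFinP; exact: measurable_funTS.
under eq_integral do rewrite EFinD EFinM.
rewrite ge0_integralD//; last 2 first.
- by move=> s _; rewrite -EFinM lee_fin mulr_ge0// gridvar_ge0.
- exact: emeasurable_funM.
rewrite integral_cst_itvoc// ge0_integralZl//; last by move=> s _; rewrite lee_fin gridvar_ge0.
by rewrite EFinD leeD2l// EFinM lee_pmul// ?lee_fin//; apply: integral_ge0 => s _; rewrite lee_fin gridvar_ge0.
Qed.

Variables (t0 tau : R) (n : nat) (sm e : nat -> R) (r0 : R).
Hypothesis t00 : 0 <= t0.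
Hypothesis tau0 : 0 < tau.
Hypothesis tauT : t0 + tau <= T.
Hypothesis hsm : forall k, (k < n.+1)%N ->
  [/\ grid_time t0 tau n k < sm k <= grid_time t0 tau n k.+1, 0 <= e k &
    (\int[leb1 R]_(s in `]grid_time t0 tau n k, grid_time t0 tau n k.+1])
       (gridvar w N K (sm k) s)%:E <= (e k)%:E)%E].
Hypothesis r0B : r0 <= B.
Hypothesis pos0 : positive_at t0 r0.

Local Notation h := (tau / n.+1%:R).

(** Each backward step enlarges the support by h [speed], multiplies the Lipschitz constant by 1 + h
    [lipconst] and loses one error term. The error integral is proportional to the current Lipschitz
    constant, so the largest one factors out of the sum. *)
Lemma dual_iterate k psi r L : (k <= n.+1)%N ->
  elem psi -> (forall u, 0 <= psi u) -> xsupported psi r -> 0 <= L -> xlipschitz psi L ->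
  r + k%:R * (h * sp) <= r0 ->
  - (M * L * (1 + h * lam) ^+ k * \sum_(j < k) (2 * ((om + h * (lam * sp)) * h + e j))) <=
  \int[leb2 R]_x (w x (grid_time t0 tau n k) * psi (x, 0)).
Proof.
have h0 : 0 < h by rewrite divr_gt0.
have sp0 := speed_ge0 M0 B0; have om0 := modulus_ge0 M0 N B0.
have lam0 := lipconst_ge0 M0 N Cd0 B0.
elim: k psi r L => [|k IH] psi r L kn epsi psi0 xpsi L0 lpsi rk.
  rewrite big_ord0 mulr0 oppr0 /grid_time mul0r addr0.
  apply: pos0 => //; last by exists L.
  by move: rk; rewrite mul0r addr0 => rk u /xpsi[h1 h2]; split; apply: le_trans rk.
have [sk ek he] := hsm kn.
set t1 := grid_time t0 tau n k in sk he *; set t2 := grid_time t0 tau n k.+1 in sk he *.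
have t12 : t2 - t1 = h by rewrite /t2 /t1 /grid_time -natr1; ring.
have t1le : t1 <= t2 by rewrite -subr_ge0 t12 ltW.
have t10 : 0 <= t1 by rewrite addr_ge0// mulr_ge0// ltW.
have t2T : t2 <= T.
  apply: le_trans tauT; rewrite lerD2l; apply: (@le_trans _ _ (n.+1%:R * h)).
    by apply: ler_wpM2r; [exact: ltW|rewrite ler_nat].
  by rewrite mulrC divfK// gt_eqF.
have smT : 0 <= sm k <= T.
  by case/andP: sk => s1 s2; rewrite (le_trans t10 (ltW s1)) (le_trans s2).
have rB : r + (t2 - t1) * sp <= B.
  apply: le_trans r0B; apply: le_trans rk; rewrite t12 lerD2l -(natr1 k) mulrDl mul1r lerDr.
  by rewrite mulr_ge0// mulr_ge0// ltW.
pose Es := M * L * (2 * ((om + h * (lam * sp)) * h + e k)).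
have h0' := ltW h0; have lsp0 : 0 <= h * (lam * sp) by nneg.
have hE : (\int[leb1 R]_(s in `]t1, t2])
    (L * (2 * (om + gridvar w N K (sm k) s + (t2 - t1) * (lam * sp))) * M)%:E <= Es%:E)%E.
  have -> : Es = 2 * L * M * (om + h * (lam * sp)) * (t2 - t1) + 2 * L * M * e k.
    by rewrite /Es t12; ring.
  have c0 : 0 <= 2 * L * M by nneg.
  apply: le_trans (integral_affine_gridvar t1le _ c0 he); last by nneg.
  rewrite le_eqVlt; apply/orP; left; apply/eqP; apply: eq_integral => s _; congr (_%:E).
  by rewrite t12; ring.
have [psi' [epsi' psi'0 xpsi' lpsi' hinc]] :=
  dual_step mw gw weakw M0 Cd0 hCd B0 KE t10 t1le t2T smT epsi psi0 xpsi L0 lpsi rB hE.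
have hl : 0 <= h * lam by nneg.
have L'0 : 0 <= L * (1 + (t2 - t1) * lam) by rewrite t12; nneg.
have rk' : r + (t2 - t1) * sp + k%:R * (h * sp) <= r0.
  by apply: le_trans rk; rewrite t12 -(natr1 k) mulrDl mul1r -addrA lerD2l addrC.
have := IH psi' _ _ (ltnW kn) epsi' psi'0 xpsi' L'0 lpsi' rk'.
rewrite -/t1 t12 big_ord_recr/=.
set S := \sum_(j < k) _ => IHk.
have q1 : 1 <= (1 + h * lam) ^+ k.+1 by rewrite exprn_ege1// lerDl.
have a0 : 0 <= Es by rewrite /Es; nneg.
(* The loss of this step is enlarged so as to share the common factor of the other losses. *)
have : Es <= (1 + h * lam) ^+ k.+1 * Es by rewrite ler_peMl.
move: hinc; rewrite ler_norml => /andP[hinc _].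
have -> : M * L * (1 + h * lam) ^+ k.+1 * (S + 2 * ((om + h * (lam * sp)) * h + e k)) =
  M * (L * (1 + h * lam)) * (1 + h * lam) ^+ k * S + (1 + h * lam) ^+ k.+1 * Es.
  by rewrite /Es (exprS _ k); ring.
move: hinc IHk; move: (_ * S) (_ * Es) => x y; lra.
Qed.

End Block.

(** The number of time steps tends to infinity with N fixed: the freezing error and the term of
    order h disappear, the product of the amplifications is at most an exponential, and only the
    interpolation error 2 [modulus] tau survives. *)
Lemma block_bound (Cd B : R) N K psi r L t0 tau r0 :
  0 <= Cd -> (forall x : R, `|dstep x| <= Cd) -> 0 <= B -> K%:R = 2 ^+ N * B ->
  elem psi -> (forall u, 0 <= psi u) -> xsupported psi r -> 0 <= L -> xlipschitz psi L ->
  0 <= t0 -> 0 < tau -> t0 + tau <= T -> r0 <= B -> positive_at t0 r0 ->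
  r + tau * speed M B <= r0 ->
  - (M * L * expR (tau * lipconst M Cd B N) * (2 * modulus M B N * tau)) <=
  \int[leb2 R]_x (w x (t0 + tau) * psi (x, 0)).
Proof.
move=> Cd0 hCd B0 KE epsi psi0 xpsi L0 lpsi t00 tau0 tauT r0B pos0 rr0.
set om := modulus _ _ _; set lam := lipconst _ _ _ _; set sp := speed _ _ in rr0.
have sp0 : 0 <= sp := speed_ge0 M0 B0; have om0 : 0 <= om := modulus_ge0 M0 N B0.
have lam0 : 0 <= lam := lipconst_ge0 M0 N Cd0 B0.
set D := M * L * expR (tau * lam).
have D0 : 0 <= D by rewrite !mulr_ge0// expR_ge0.
apply/ler_addgt0Pl => eta eta0.
(* The 1 covers the case D = 0. *)
pose eps := eta / (4 * D + 1).
have eps0 : 0 < eps by rewrite divr_gt0// ltr_pwDr// mulr_ge0.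
have epsE : D * (4 * eps) <= eta.
  have -> : D * (4 * eps) = eta * (4 * D / (4 * D + 1)) by rewrite /eps; ring.
  by rewrite ler_piMr ?(ltW eta0)// ler_pdivrMr ?mul1r ?lerDl// ltr_pwDr// mulr_ge0.
pose J := ('I_(2 * K).+1 * 'I_(2 * K).+1 * bool)%type.
pose f (q : J) (s : R) := gridvel w N K s q.2 q.1.1 q.1.2.
have mf q : measurable_fun setT (f q : lT -> R) by exact: measurable_vcomp.
have fK q s : t0 < s <= t0 + tau -> `|f q s| <= sp.
  move=> /andP[s1 s2]; apply: (vcomp_bound gw M0).
    by rewrite (le_trans t00 (ltW s1)) (le_trans s2).
  by apply: pair_norm_le => /=; apply: (node_bound (A_gt0 R N) KE).
have samp := sampling tau0 eps0 mf fK.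
have c1 : \forall n \near \oo, tau / n.+1%:R * (lam * sp) * tau <= eps.
  have cc : (tau * (lam * sp) * tau) * n.+1%:R^-1 @[n --> \oo] --> (0 : R).
    by rewrite -(mulr0 (tau * (lam * sp) * tau)); apply: cvgMr; exact: cvg_harmonic.
  have /cvgrPdist_lt /(_ _ eps0) := cc; apply: filterS => n /=.
  rewrite sub0r normrN => /ltW; apply: le_trans; apply: le_trans (ler_norm _).
  by rewrite le_eqVlt; apply/orP; left; apply/eqP; ring.
near \oo => n.
have [sm [e [se hsm]]] : exists sm e : nat -> R, \sum_(k < n.+1) e k <= eps /\
    forall k, (k < n.+1)%N ->
      [/\ grid_time t0 tau n k < sm k <= grid_time t0 tau n k.+1, 0 <= e k &
      (\int[leb1 R]_(s in `]grid_time t0 tau n k, grid_time t0 tau n k.+1])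
         (gridvar w N K (sm k) s)%:E <= (e k)%:E)%E] by near: n.
have cn : tau / n.+1%:R * (lam * sp) * tau <= eps by near: n.
have n0 : 0 < n.+1%:R :> R by [].
have rk : r + n.+1%:R * (tau / n.+1%:R * sp) <= r0.
  by rewrite mulrA (mulrC n.+1%:R) divfK// gt_eqF.
have := dual_iterate Cd0 hCd B0 KE t00 tau0 tauT hsm r0B pos0 (leqnn _) epsi psi0 xpsi L0 lpsi rk.
rewrite -/om -/lam -/sp.
have -> : grid_time t0 tau n n.+1 = t0 + tau.
  by rewrite /grid_time mulrC divfK// gt_eqF.
have h0 : 0 <= tau / n.+1%:R by rewrite divr_ge0// ltW.
have ex : (1 + tau / n.+1%:R * lam) ^+ n.+1 <= expR (tau * lam).
  have -> : tau * lam = n.+1%:R * (tau / n.+1%:R * lam).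
    by rewrite mulrA (mulrC n.+1%:R) divfK// gt_eqF.
  rewrite expRM_natl ler_pXn2r ?nnegrE ?expR_ge0 ?expR_ge1Dx//.
  by rewrite addr_ge0// mulr_ge0.
have -> : \sum_(j < n.+1) (2 * ((om + tau / n.+1%:R * (lam * sp)) * (tau / n.+1%:R) + e j)) =
    2 * om * tau + 2 * (tau / n.+1%:R * (lam * sp) * tau + \sum_(j < n.+1) e j).
  rewrite -mulr_sumr big_split/= sumr_const card_ord -[_ *+ n.+1]mulr_natr.
  rewrite -(mulrA (om + _)) divfK ?gt_eqF//; move: (\sum_(j < n.+1) _) => s; ring.
set X := 2 * om * tau; set Y := _ + \sum_(j < n.+1) _.
have Y0 : 0 <= Y.
  apply: addr_ge0; first by nneg.
  by apply: sumr_ge0 => j _; case: (hsm j (ltn_ord j)).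
have X0 : 0 <= X by rewrite /X; nneg.
have YE : 2 * Y <= 4 * eps by rewrite /Y; move: se cn; move: (\sum_(j < _) _) (_ * tau) => ? ?; lra.
have step1 : M * L * (1 + tau / n.+1%:R * lam) ^+ n.+1 * (X + 2 * Y) <= D * (X + 2 * Y).
  apply: ler_wpM2r; first by nneg.
  by rewrite ler_wpM2l// mulr_ge0.
have step2 : D * (2 * Y) <= D * (4 * eps) by exact: ler_wpM2l.
move: step1 step2 epsE; rewrite (mulrDr D).
move: (D * X) (D * (2 * Y)) (D * (4 * eps)) (_ * (X + _)) (\int[_]_x _) => a b c d I.
lra.
Unshelve. all: by end_near.
Qed.

(** The ratio 7/6 is small enough that (3/2)(7/6)(1/2) = 7/8 < 1; the factor 6 makes the induction
    close. *)
Lemma natr_le_geometric N : N.+1%:R <= 6 * (7 / 6) ^+ N :> R.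
Proof.
elim: N => [|N IH]; first by rewrite expr0; lra.
rewrite -natr1 exprS; have : 1 <= (7 / 6) ^+ N :> R by rewrite exprn_ege1//; lra.
by move: IH; move: (_ ^+ N) => x; lra.
Qed.

Lemma geometric_nonneg (C x : R) : (forall N : nat, - (C * (7 / 8) ^+ N) <= x) -> 0 <= x.
Proof.
move=> h; have c : - (C * (7 / 8) ^+ N) @[N --> \oo] --> (0 : R).
  rewrite -oppr0; apply: cvgN; rewrite -(mulr0 C); apply: cvgMr.
  by apply: cvg_expr; rewrite ger0_norm; lra.
by apply: (cvgr_to_le c); apply: nearW.
Qed.

(* On a short block the amplification (3/2)^N is beaten by the N 2^-N error. *)
Lemma positivity_block (Cd : R) (b : nat) : 0 <= Cd -> (forall x : R, `|dstep x| <= Cd) ->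
  exists dt0 : R, 0 < dt0 /\ forall t0 tau r0 r, 0 <= t0 -> 0 < tau <= dt0 -> t0 + tau <= T ->
    r0 <= b%:R -> positive_at t0 r0 -> r + tau * speed M b%:R <= r0 -> positive_at (t0 + tau) r.
Proof.
move=> Cd0 hCd; have b0 : 0 <= b%:R :> R by [].
pose c := (cL R * (1 + 2 * b%:R) ^+ 2 * (1 + b%:R) + cU R) * M.
have c0 : 0 <= c.
  by have := modulus_ge0 M0 0 b0; rewrite /modulus -/c expr0 !mulr1.
pose q := 4 * Cd * c.
have q0 : 0 <= q by apply: mulr_ge0 => //; exact: mulr_ge0.
have l0 : 0 < ln (3 / 2 : R) by rewrite ln_gt0//; lra.
(* As [lipconst] is q (N + 1), this length bounds the amplification by (3/2)^(N+1) for every N at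
   once; q + 1 rather than q because q may vanish. *)
exists (ln (3 / 2) / (q + 1)); split; first by rewrite divr_gt0// ltr_pwDr.
move=> t0 tau r0 r t00 /andP[tau0 taud] tauT r0b pos0 rr psi epsi psi0 xpsi [L [L0 lpsi]].
have tq : tau * q <= ln (3 / 2).
  move: taud; rewrite ler_pdivlMr ?ltr_pwDr// mulrDr mulr1; lra.
(* Here 18 = (3/2) * 2 * 6: the extra power of 3/2, the factor of the error, and the constant of
   [natr_le_geometric]. *)
apply: (@geometric_nonneg (M * L * (18 * c * tau))) => N.
have KE : (2 ^ N * b)%:R = 2 ^+ N * b%:R :> R by rewrite natrM natrX.
have := block_bound Cd0 hCd b0 KE epsi psi0 xpsi L0 lpsi t00 tau0 tauT r0b pos0 rr.
apply: le_trans; rewrite lerN2.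
have moE : modulus M b%:R N = c * (N.+1%:R * 2^-1 ^+ N) by [].
have A0 : 2 ^+ N != 0 :> R by rewrite expf_neq0.
have lamE : lipconst M Cd b%:R N = q * N.+1%:R.
  rewrite /lipconst moE /q exprVn; field; exact: A0.
have ex : expR (tau * lipconst M Cd b%:R N) <= (3 / 2) ^+ N.+1.
  have p0 : 0 <= 3 / 2 :> R by lra.
  rewrite lamE mulrA mulrC expRM_natl ler_pXn2r ?nnegrE ?expR_ge0 ?p0//.
  by rewrite -[leRHS]lnK ?ler_expR// posrE; lra.
rewrite moE.
have gN := natr_le_geometric N.
rewrite -!(mulrA (M * L)); apply: ler_wpM2l; first by rewrite mulr_ge0.
apply: (@le_trans _ _ ((3 / 2) ^+ N.+1 * (2 * (c * (6 * (7 / 6) ^+ N * 2^-1 ^+ N)) * tau))).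
  apply: ler_pM => //; rewrite ?expR_ge0//.
    by nneg.
  apply: ler_wpM2r; first exact: ltW.
  by apply: ler_wpM2l => //; apply: ler_wpM2l => //; apply: ler_wpM2r => //; rewrite exprn_ge0.
have -> : (7 / 8 : R) ^+ N = (3 / 2) ^+ N * ((7 / 6) ^+ N * 2^-1 ^+ N).
  by rewrite -!exprMn; congr (_ ^+ N); field.
rewrite (exprS _ N) le_eqVlt; apply/orP; left; apply/eqP.
by move: (_ ^+ N) (_ ^+ N) (_ ^+ N) => x y z; field.
Qed.

(** Induction on the number of blocks of length at most k; the hypothesis on r leaves room in the
    box of radius b for the support to grow at the constant speed all the way back to t0. *)
Lemma positivity_blocks (b : nat) t0 k t r : 0 <= t0 ->
  (forall r', positive_at t0 r') ->
  (forall t0 tau r0 r, 0 <= t0 -> 0 < tau <= k -> t0 + tau <= T ->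
    r0 <= b%:R -> positive_at t0 r0 -> r + tau * speed M b%:R <= r0 -> positive_at (t0 + tau) r) ->
  0 < k -> t0 <= t <= T -> r + (t - t0) * speed M b%:R <= b%:R -> positive_at t r.
Proof.
move=> t00 pos0 H k0 tT; have sp0 := speed_ge0 M0 (ler0n R b).
have [m tm] : exists m : nat, t <= t0 + m%:R * k.
  have [/andP[t0t _]] := tT; have z0 : 0 <= (t - t0) / k by rewrite divr_ge0 ?subr_ge0// ltW.
  exists (Num.bound ((t - t0) / k)); have := @archi_boundP _ _ z0.
  by rewrite ltr_pdivrMr//; lra.
elim: m t r tT tm => [|m IH] t r /andP[t0t tT] tm rb.
  have -> : t = t0 by apply/le_anti; rewrite t0t andbT; move: tm; rewrite mul0r addr0.
  exact: pos0.
have [tm'|tm'] := leP t (t0 + m%:R * k); first by apply: IH => //; rewrite t0t.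
pose t' := t0 + m%:R * k.
have t't0 : t0 <= t' by rewrite lerDl mulr_ge0// ltW.
have t't : t' <= T by apply: le_trans tT; exact: ltW.
have -> : t = t' + (t - t') by ring.
apply: (H t' (t - t') (r + (t - t') * speed M b%:R)) => //.
- exact: (le_trans t00).
- rewrite subr_gt0 tm'/=; move: tm; rewrite -natr1 /t' mulrDl mul1r; lra.
- by have -> : t' + (t - t') = t by ring.
- apply: le_trans rb; rewrite lerD2l; apply: ler_wpM2r => //; lra.
apply: IH; rewrite ?t't0//.
by have -> : r + (t - t') * speed M b%:R + (t' - t0) * speed M b%:R =
  r + (t - t0) * speed M b%:R by ring.
Qed.

(* The speed grows at most linearly in the radius of the support, so the length
   of the time step does not depend on that radius. *)
Lemma positivity t r : (forall r', positive_at 0 r') -> 0 <= t <= T -> positive_at t r.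
Proof.
move=> pos0; have [Cd [Cd0 hCd]] := dstep_bounded R.
pose c := cU R * M.
have c0 : 0 <= c by rewrite mulr_ge0 ?cU_ge0.
pose d := (2 * (c + 1))^-1.
have d0 : 0 < d by rewrite invr_gt0 mulr_gt0// ltr_pwDr.
move=> /andP[t0 tT].
have [m tm] : exists m : nat, t <= m%:R * d.
  have z0 : 0 <= t / d by rewrite divr_ge0// ltW.
  exists (Num.bound (t / d)); have := @archi_boundP _ _ z0.
  by rewrite ltr_pdivrMr// => /ltW.
elim: m t r t0 tT tm => [|m IH] t r t0 tT tm.
  have -> : t = 0 by apply/le_anti; rewrite t0 andbT; move: tm; rewrite mul0r.
  exact: pos0.
have [tm'|tm'] := leP t (m%:R * d); first exact: IH.
have t'0 : 0 <= m%:R * d by rewrite mulr_ge0// ltW.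
have t'T : m%:R * d <= T by apply: le_trans tT; exact: ltW.
have z0 : 0 <= 2 * `|r| + 1 by rewrite addr_ge0// mulr_ge0.
(* Over a time d the support grows by at most d [speed] <= (1 + b) / 2, and r + (1 + b) / 2 <= b as
   soon as 2 |r| + 1 <= b. *)
pose b := Num.bound (2 * `|r| + 1).
have hb : 2 * `|r| + 1 < b%:R by have := @archi_boundP _ _ z0.
have [k [k0 H]] := positivity_block b (ltW Cd0) hCd.
apply: (@positivity_blocks b (m%:R * d) k t r t'0 _ H k0).
- by move=> r'; exact: IH.
- by rewrite tT ltW.
have : (t - m%:R * d) * speed M b%:R <= (1 + b%:R) / 2.
  have -> : (1 + b%:R) / 2 = d * ((c + 1) * (1 + b%:R)).
    by rewrite /d; field; rewrite gt_eqF// ltr_pwDr.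
  apply: ler_pM.
  - by rewrite subr_ge0 ltW.
  - by rewrite speed_ge0.
  - by move: tm; rewrite -natr1 mulrDl mul1r; lra.
  - by rewrite /speed -/c ler_wpM2r ?addr_ge0// lerDl.
have := ler_norm r; lra.
Qed.

End Positivity.

(** * Tail estimate *)

Section Tail.
Variable R : realType.
Local Notation P := (R * R)%type.
Local Notation V := (R * R * R)%type.
Implicit Types (psi : V -> R).

(** Independence of time reduces every derivative to the slice s = 0, where the support is
    compact. *)
Lemma xlipschitz_exists psi r : elem psi -> xsupported psi r ->
  (forall x s, psi (x, s) = psi (x, 0)) -> exists L, 0 <= L /\ xlipschitz psi L.
Proof.
move=> epsi xpsi inv.
have [K1 [K10 h1]] := elem_bounded_box `|r| (elem_derive (1, 0, 0) epsi).
have [K2 [K20 h2]] := elem_bounded_box `|r| (elem_derive (0, 1, 0) epsi).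
have b v K : (forall u, box `|r| u -> `|'D_v psi u| <= K) -> 0 <= K ->
    forall x, `|'D_v psi (x, 0)| <= K.
  move=> h K0 x; have [->|nz] := eqVneq ('D_v psi (x, 0)) 0; first by rewrite normr0.
  have [a1 a2] := derive_xsupported xpsi nz; apply: h; split => /=; rewrite ?normr0//.
    exact: le_trans (ler_norm r).
  exact: le_trans (ler_norm r).
exists (K1 + K2); split; first exact: addr_ge0.
move=> p v.
have -> : 'D_v psi p = 'D_((v.1, 0) : V) psi (p.1, 0).
  have -> : psi = fun u => psi (u.1.1, u.1.2, 0).
    by apply/funext => -[[x1 x2] s]; exact: (inv (x1, x2) s).
  rewrite (derive_elem_comp _ _ epsi (elem_x1 R) (elem_x2 R) (elem_cst 0)).
  rewrite (derive_elem_comp _ _ epsi (elem_x1 R) (elem_x2 R) (elem_cst 0)).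
  by rewrite !derive_x1 !derive_x2 !derive_elemC.
rewrite (derive_elem_lin _ _ epsi)/= mul0r addr0.
move: (b _ _ h1 K10 p.1) (b _ _ h2 K20 p.1).
move: ('D_(1, 0, 0) psi _) ('D_(0, 1, 0) psi _) => d1 d2 k1 k2.
apply: (le_trans (ler_normD _ _)); rewrite (normrM v.1.1) (normrM v.1.2).
have l1 : `|v.1.1| * `|d1| <= (K1 + K2) * `|v.1.1|.
  by rewrite mulrC ler_wpM2r// (le_trans k1)// lerDl.
have l2 : `|v.1.2| * `|d2| <= (K1 + K2) * `|v.1.2|.
  by rewrite mulrC ler_wpM2r// (le_trans k2)// lerDr.
by rewrite mulrDr; exact: lerD.
Qed.

Lemma positive_at_ae (w : P -> R -> R) M t r : good M (w ^~ t) ->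
  {ae leb2 R, forall x, 0 <= w x t} -> positive_at w t r.
Proof.
move=> [mg _ _] w0 psi epsi psi0 _ _.
have mp : measurable_fun setT (fun x : P => psi (x, 0)).
  exact: (measurable_slice 0 (elem_measurable epsi)).
have mf : measurable_fun setT (fun x : P => w x t * psi (x, 0)) by exact: measurable_funM.
have mfE : measurable_fun setT (fun x : P => (w x t * psi (x, 0))%:E) by exact/measurable_EFinP.
have mnE : measurable_fun setT (fun x : P => `|w x t * psi (x, 0)|%:E).
  by apply/measurable_EFinP; exact: measurableT_comp.
apply: fine_ge0.
(* The integrand agrees almost everywhere with its absolute value, which is non-negative
   everywhere. *)
rewrite (@ae_eq_integral _ _ R (leb2 R) setT _ _ measurableT mfE mnE).
  by apply: integral_ge0 => x _; rewrite lee_fin.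
apply: filterS w0 => x wx _ /=; rewrite ger0_norm//; exact: mulr_ge0.
Qed.

Variables (w : P -> R -> R) (T M : R).
Hypothesis mw : measurable_fun [set p : V | 0 <= p.2] (fun p => w p.1 p.2).
Hypothesis gw : forall s, 0 <= s <= T -> good M (w ^~ s).
Hypothesis weakw : weak_formulation w.
Hypothesis T0 : 0 <= T.
Hypothesis w0 : {ae leb2 R, forall x, 0 <= w x 0}.

(* Tends to 2 u - 1_{1 <= u} as n -> oo, where u = |x|^2 / r^2. *)
Definition tail_test (r : R) (n : nat) (p : V) : R :=
  (2 * qn r p - step (n.+2%:R * (qn r p - 1) + 1)) * (1 - step (qn n.+1%:R p - 1)).

Lemma elem_tail_test r n : elem (tail_test r n).
Proof.
have e1 := elem_qn r; have e2 := elem_qn (n.+1%:R : R).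
apply: elem_mul; apply: elem_sub.
- by apply: elem_mul => //; exact: elem_cst.
- apply: elem_step; apply: elem_add (elem_cst _); apply: elem_mul; first exact: elem_cst.
  by apply: elem_sub => //; exact: elem_cst.
- exact: elem_cst.
by apply: elem_step; apply: elem_sub => //; exact: elem_cst.
Qed.

Lemma qn_ge0 r (p : V) : 0 <= qn r p.
Proof. by rewrite /qn divr_ge0 ?sqr_ge0// addr_ge0// -expr2 sqr_ge0. Qed.

(** If 2u < 1 the smoothed indicator vanishes, its slope n + 2 being at least 2; otherwise 2u >= 1
    dominates it. The upper bound is the majorant for passing to the limit. *)
Lemma tail_test_bounds r n p : 0 <= tail_test r n p <= 2 * qn r p.
Proof.
rewrite /tail_test; move: (qn r p) (qn_ge0 r p) => u u0.
have c0 := step_ge0 (qn n.+1%:R p - 1); have c1 := step_le1 (qn n.+1%:R p - 1).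
set c := step (qn _ _ - _) in c0 c1 *.
have s0 := step_ge0 (n.+2%:R * (u - 1) + 1); have s1 := step_le1 (n.+2%:R * (u - 1) + 1).
have n2 : 2 <= n.+2%:R :> R by rewrite ler_nat.
have h : 0 <= 2 * u - step (n.+2%:R * (u - 1) + 1).
  have [u1|u1] := leP 1 (2 * u); first lra.
  rewrite step_eq0; first lra.
  have : n.+2%:R * (u - 1) <= 2 * (u - 1) by rewrite ler_wnM2r//; lra.
  by move: (_ * (u - 1)) => z; lra.
apply/andP; split; first by rewrite mulr_ge0// subr_ge0.
apply: (@le_trans _ _ (2 * u - step (n.+2%:R * (u - 1) + 1))); last lra.
by rewrite ler_piMr//; lra.
Qed.

Lemma tail_test_xsupported r n : xsupported (tail_test r n) (2 * n.+1%:R).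
Proof.
move=> p hp; apply: qn_support; first by [].
rewrite ltNge; apply: contra hp => q2.
by rewrite /tail_test (@step_eq1 _ (qn n.+1%:R p - 1)) ?subrr ?mulr0//; lra.
Qed.

(** At each point the sequence is eventually constant: for u < 1 once (n + 2)(1 - u) >= 1 and the
    cut-off is inactive. The shift by 1 in the argument of [step] gives the indicator the value 1 at
    u = 1 too, as the closed condition r <= |x| demands. *)
Lemma tail_test_cvg r x : 0 < r ->
  tail_test r n (x, 0) @[n --> \oo] -->
    2 / r ^+ 2 * n2 x - (if r <= enorm2 x then 1 else 0).
Proof.
move=> r0; have r20 : 0 < r ^+ 2 by rewrite exprn_gt0.
apply: cvg_near_cst.
have [k1 hk1] : exists k : nat, n2 x < k%:R.
  by exists (Num.bound (n2 x)); have := @archi_boundP _ (n2 x) (n2_ge0 x).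
pose u := n2 x / r ^+ 2.
have ru : (r <= enorm2 x) = (1 <= u).
  rewrite -[LHS](@ler_pXn2r _ 2) ?nnegrE ?(ltW r0) ?sqrtr_ge0//.
  by rewrite enorm2_sqr /u ler_pdivlMr// mul1r.
have [k2 hk2] : exists k : nat, u < 1 -> (1 - u)^-1 < k%:R.
  have [u1|u1] := ltP u 1; last by exists 0%N.
  have z0 : 0 <= (1 - u)^-1 by rewrite invr_ge0; lra.
  by exists (Num.bound ((1 - u)^-1)) => _; have := @archi_boundP _ _ z0.
near=> n.
have cutn : step (qn n.+1%:R (x, 0) - 1) = 0.
  rewrite step_eq0// qnE.
  have : n2 x / n.+1%:R ^+ 2 <= 1.
    rewrite ler_pdivrMr ?exprn_gt0// mul1r (le_trans (ltW hk1))//.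
    apply: (@le_trans _ _ n.+1%:R).
      by rewrite ler_nat; apply: leqW; near: n; exact: nbhs_infty_ge.
    by rewrite expr2 ler_peMl ?ler1n.
  by move: (_ / _) => z hz; lra.
rewrite /tail_test cutn subr0 mulr1 qnE -/u ru mulrAC -mulrA -/u.
case: leP => u1.
  rewrite step_eq1//; have : 0 <= n.+2%:R * (u - 1) by rewrite mulr_ge0// subr_ge0.
  by move: (_ * (u - 1)) => z; lra.
rewrite step_eq0//; have kn : k2%:R <= n.+2%:R :> R.
  by rewrite ler_nat; do 2 apply: leqW; near: n; exact: nbhs_infty_ge.
have : 1 <= n.+2%:R * (1 - u).
  rewrite -ler_pdivrMr ?subr_gt0// mul1r; apply: le_trans kn; exact/ltW/hk2.
have -> : n.+2%:R * (u - 1) = - (n.+2%:R * (1 - u)) by ring.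
by move: (_ * (1 - u)) => z; lra.
Unshelve. all: by end_near.
Qed.

(** Chebyshev's inequality without a pointwise sign for w(t): positivity against [tail_test] passes
    to the limit and gives that the integral of w(t) (2 |x|^2 / r^2 - 1_(r <= |x|)) is non-negative;
    the moment is then moved to time 0 by conservation. *)
Lemma tail_bound r t : 0 < r -> 0 <= t <= T ->
  \int[leb2 R]_(x in [set x | r <= enorm2 x]) w x t <=
  2 / r ^+ 2 * \int[leb2 R]_x (w x 0 * n2 x).
Proof.
move=> r0 tT; have r20 : 0 < r ^+ 2 by rewrite exprn_gt0.
have M0 : 0 <= M by apply: (good_ge0 (gw (s := 0) _)); rewrite lexx.
have gt : good M (w ^~ t) := gw tT.
have K0 : 0 <= 2 / r ^+ 2 by rewrite divr_ge0// ltW.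
pose chi (x : P) : R := if r <= enorm2 x then 1 else 0.
have mA : measurable [set x : P | r <= enorm2 x].
  rewrite (_ : [set x | _] = (@enorm2 R) @^-1` `[r, +oo[%classic); last first.
    by apply/seteqP; split=> x /=; rewrite in_itv/= andbT.
  by rewrite -[X in measurable X]setTI; exact: measurable_enorm2.
have memA x : (x \in [set x : P | r <= enorm2 x]) = (r <= enorm2 x).
  by apply/idP/idP => [/set_mem|/mem_set].
have chiE : chi = \1_[set x : P | r <= enorm2 x].
  by apply/funext => x; rewrite /chi indicE memA; case: ifP.
have mchi : measurable_fun setT chi by rewrite chiE; exact: measurable_indic.
have mn := @measurable_n2 R.
have jn (x : P) : n2 x <= jbracket x ^+ 2 by rewrite jbracket_sqr lerDr.
have i1 : (leb2 R).-integrable setT (EFin \o (fun x => w x t * (2 / r ^+ 2 * n2 x))).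
  apply: (proj1 (good_integral gt _ K0 _)) => [|x].
    by apply: measurable_funM => //; exact: measurable_cst.
  by rewrite ger0_norm; [exact: ler_wpM2l|rewrite mulr_ge0// n2_ge0].
have i2 : (leb2 R).-integrable setT (EFin \o (fun x => w x t * chi x)).
  apply: (proj1 (good_integral_bounded gt mchi ler01 _)) => x.
  by rewrite /chi; case: ifP; rewrite ?normr1 ?normr0.
have i3 : (leb2 R).-integrable setT (EFin \o (fun x => w x t * n2 x)).
  apply: (proj1 (good_integral gt _ ler01 _)) => [//|x].
  by rewrite ger0_norm ?n2_ge0// mul1r.
have Gpos n : 0 <= \int[leb2 R]_x (w x t * tail_test r n (x, 0)).
  apply: (positivity mw gw weakw M0 (r := 2 * n.+1%:R) _ tT).
  - by move=> r'; apply: (positive_at_ae (M := M)) => //; apply: gw; rewrite lexx.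
  - exact: elem_tail_test.
  - by move=> p; case/andP: (tail_test_bounds r n p).
  - exact: tail_test_xsupported.
  - apply: (xlipschitz_exists (elem_tail_test r n) (@tail_test_xsupported r n)) => x s.
    by rewrite /tail_test !qnE.
have L := good_dct gt K0 (fun n => measurable_slice 0 (elem_measurable (elem_tail_test r n)))
  (measurable_funB (measurable_funM (measurable_cst (2 / r ^+ 2)) mn) mchi) _
  (fun x => @tail_test_cvg r x r0).
have {}L := L _.
have : 0 <= \int[leb2 R]_x (w x t * (2 / r ^+ 2 * n2 x - chi x)).
  apply: (cvgr_to_ge (L _)); last exact: nearW.
  move=> n x; have /andP[g0 g1] := tail_test_bounds r n (x, 0).
  rewrite ger0_norm//; apply: (le_trans g1); rewrite qnE mulrA mulrAC.
  by apply: ler_wpM2l.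
have -> : \int[leb2 R]_x (w x t * (2 / r ^+ 2 * n2 x - chi x)) =
    \int[leb2 R]_x (w x t * (2 / r ^+ 2 * n2 x)) - \int[leb2 R]_x (w x t * chi x).
  rewrite -(RintegralB measurableT i1 i2); apply: eq_Rintegral => x _.
  by rewrite mulrBr.
have -> : \int[leb2 R]_x (w x t * (2 / r ^+ 2 * n2 x)) = 2 / r ^+ 2 * \int[leb2 R]_x (w x 0 * n2 x).
  rewrite -(second_moment_conserved mw gw weakw T0 tT) -(RintegralZl _ measurableT i3).
  by apply: eq_Rintegral => x _; rewrite mulrCA.
rewrite subr_ge0; apply: le_trans; rewrite Rintegral_mkcond le_eqVlt; apply/orP; left; apply/eqP.
apply: eq_Rintegral => x _; rewrite patchE memA /chi.
by case: ifP; rewrite ?mulr1 ?mulr0.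
Qed.

End Tail.

Theorem corollary2p10 (R : realType) :
  forall C0 : R, 0 < C0 ->
  exists C : R, 0 < C /\
  forall (sigma : R * R) (eps : R) (w : R * R -> R -> R),
    0 < eps ->
    helical_euler_solution 2 w ->
    in_L1Linf 2 (w ^~ 0) ->
    {ae leb2 R, forall x, 0 <= w x 0} ->
    \int[leb2 R]_x w x 0 = 1 ->
    \int[leb2 R]_x (enorm2 x ^+ 2 * w x 0)
      <= C0 * (eps ^+ 2 + enorm2 sigma ^+ 2) ->
    forall alpha t : R, alpha < 1 -> 0 <= t ->
    \int[leb2 R]_(x in [set x : R * R |
        (eps ^+ 2 + enorm2 sigma ^+ 2) `^ (alpha / 2) <= enorm2 x]) w x t
      <= C * (eps ^+ 2 + enorm2 sigma ^+ 2) `^ (1 - alpha).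
Proof.
move=> C0 C00; exists (2 * C0); split; first by rewrite mulr_gt0.
move=> sigma eps w eps0 [[mw sol] weakw] _ w0 _ mom alpha t _ t0.
move: mom; set rho := eps ^+ 2 + _ => mom.
have rho0 : 0 < rho by rewrite ltr_pwDl ?exprn_gt0// sqr_ge0.
have [M hM] := sol t t0.
have gw s : 0 <= s <= t -> good M (w ^~ s).
  by move=> /hM[[ms _ _] nM]; exact: in_L1Linf_good.
have r0 : 0 < rho `^ (alpha / 2) by exact: powR_gt0.
apply: (le_trans (tail_bound mw gw weakw t0 w0 r0 _)); first by rewrite lexx t0.
have r2 : (rho `^ (alpha / 2)) ^+ 2 = rho `^ alpha.
  by rewrite -powR_mulrn ?(ltW r0)// -powRrM divfK.
have ra0 : 0 < rho `^ alpha by exact: powR_gt0.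
have rE : rho = rho `^ alpha * rho `^ (1 - alpha).
  rewrite -powRD; last by apply/implyP => _; rewrite gt_eqF.
  by rewrite addrC subrK powRr1// ltW.
have -> : \int[leb2 R]_x (w x 0 * n2 x) = \int[leb2 R]_x (enorm2 x ^+ 2 * w x 0).
  by apply: eq_Rintegral => x _; rewrite enorm2_sqr mulrC.
rewrite r2.
apply: (@le_trans _ _ (2 / rho `^ alpha * (C0 * rho))).
  by rewrite ler_wpM2l// divr_ge0// ltW.
rewrite {2}rE le_eqVlt; apply/orP; left; apply/eqP; field.
by rewrite gt_eqF.
Qed.
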